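(* Let $(R,\mathfrak m_R)$ be a complete Noetherian local domain of dimension one, and let $\mathcal X$ be a connected projective normal curve over $R$ which dominates $\operatorname{Spec}(R)$, with closed fiber $X$ and function field $F$. Let $x$ be a closed point of $X$, let $R_x$ be the ring of rational functions in $F$ that are regular at $x$, and let $\mathfrak m_x$ be the maximal ideal of the local ring $R_x$. Assume that for each irreducible component $X_i$ of $X$ which contains $x$, the ring $\mathcal O_{X_i,x}$ is analytically unramified and unibranch, or equivalently, its $\mathfrak m_x$-adic completion is a domain (this is the case if $x$ is a non-singular point of $X_i$). Then the $\mathfrak m_x$-adic completion inclusion $R_x\subset \widetilde R_x$ is Weierstrass.
   Context: All rings are commutative with a unit. A ring homomorphism $\varphi: A\rightarrow B$ is called Weierstrass if for every $b\in B$ there are an element $a\in A$ and a unit $b'\in B^\times$ such that $b=\varphi(a)b'$. A curve $\mathcal X$ over the one-dimensional ring $R$ means a scheme of relative dimension one over $R$ (so $\mathcal X$ has Krull dimension $2$). The closed fiber is the fiber $X$ of $\mathcal X\to\operatorname{Spec}(R)$ over the closed point $\mathfrak m_R$. Thus $R_x=\mathcal O_{\mathcal X,x}$, and $\widetilde R_x=\varprojlim_n R_x/\mathfrak m_x^n$. The irreducible components $X_i$ of $X$ carry the reduced induced structure, so $\mathcal O_{X_i,x}$ is the quotient of $R_x$ by the prime ideal defining $X_i$. A Noetherian local ring is analytically unramified if its completion is reduced. A local ring $S$ is unibranch if the reduction $S_{\mathrm{red}}$ is a domain and the integral closure of $S_{\mathrm{red}}$ in its field of fractions is a local ring. *)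

(* Defs.v *)
From HB Require Import structures.
From mathcomp Require Import all_boot all_algebra ring_quotient.
From mathcomp Require Import generic_quotient.
From mathcomp Require Import boolp classical_sets.
From mathcomp Require Import topology_structure connected.
From mathcomp Require Import ring.

Set Implicit Arguments.
Unset Strict Implicit.
Unset Printing Implicit Defensive.

Import GRing.Theory.
Local Open Scope classical_set_scope.
Local Open Scope ring_scope.
Local Open Scope quotient_scope.

(* Library conventions: [idealr A] and [prime_idealr A] contain proper ideals
   only, so that [{ideal_quot I}] is always a nonzero ring. *)

Definition is_unit (A : comPzRingType) (u : A) := exists v : A, v * u = 1.

Definition weierstrass (A B : comPzRingType) (phi : {rmorphism A -> B}) :=
  forall b : B, exists (a : A) (b' : B), is_unit b' /\ b = phi a * b'.

Definition is_domain (A : comNzRingType) :=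
  forall a b : A, a * b = 0 -> a = 0 \/ b = 0.

Definition reduced (A : comNzRingType) :=
  forall (a : A) (k : nat), a ^+ k = 0 -> a = 0.

Definition maximal_ideal (A : comNzRingType) (m : idealr A) :=
  forall J : idealr A, {subset m <= J} -> {subset J <= m}.

(* [A] is local with maximal ideal [m]. *)
Definition local_ring (A : comNzRingType) (m : idealr A) :=
  maximal_ideal m /\ forall J : idealr A, maximal_ideal J -> J =i m.

Definition is_local (A : comNzRingType) := exists m : idealr A, local_ring m.

Definition noetherian (A : comNzRingType) :=
  forall J : idealr A, exists (k : nat) (g : 'I_k -> A),
    (forall i, g i \in J) /\
    forall a, a \in J -> exists c : 'I_k -> A, a = \sum_i c i * g i.

Definition prime_chain (A : comNzRingType) (d : nat) :=
  exists p : nat -> prime_idealr A,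
    forall i, (i < d)%N ->
      {subset p i <= p i.+1} /\ exists2 a, a \in p i.+1 & a \notin p i.

Definition ring_dim (A : comNzRingType) (d : nat) :=
  prime_chain A d /\ ~ prime_chain A d.+1.

Section Nilradical.
Variable A : comNzRingType.

Definition nilradical_pred : A -> bool := fun a => `[< exists k : nat, a ^+ k = 0 >].

Fact nilradical_closed : idealr_closed nilradical_pred.
Proof.
split.
- by apply/asboolP; exists 1%N; rewrite expr1.
- apply/negP => /asboolP[k]; rewrite expr1n => /eqP; by rewrite oner_eq0.
- move=> a u v /asboolP[k uk] /asboolP[l vl]; apply/asboolP; exists (k + l)%N.
  rewrite exprDn big1 // => i _; case: (leqP l i) => li.
    by rewrite -(subnKC li) exprD vl mul0r mulr0 mul0rn.
  rewrite -addnBA ?exprD; last exact: ltnW.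
  by rewrite exprMn uk mulr0 !mul0r mul0rn.
Qed.

HB.instance Definition _ := isIdealr.Build A nilradical_pred nilradical_closed.
Definition nilradical : idealr A := nilradical_pred.

Definition red_ring : comNzRingType := {ideal_quot nilradical}.
End Nilradical.

Record mult_set (A : comNzRingType) := MultSet {
  mult_set_pred :> {pred A};
  mult_set1 : 1 \in mult_set_pred;
  mult_setM : forall s t,
    s \in mult_set_pred -> t \in mult_set_pred -> s * t \in mult_set_pred;
  mult_set0 : 0 \notin mult_set_pred }.

Section Localization.
Variables (A : comNzRingType) (M : mult_set A).

Definition loc_pair : Type := (A * {s : A | s \in M})%type.
HB.instance Definition _ := Choice.on loc_pair.

Definition loc_equiv (z w : loc_pair) : bool :=
  `[< exists2 u, u \in M & u * (z.1 * val w.2) = u * (w.1 * val z.2) >].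

Fact loc_equiv_is_equiv : equiv_class_of loc_equiv.
Proof.
split=> [z|z w|y x z].
- by apply/asboolP; exists 1 => //; apply: mult_set1.
- by apply/asboolP/asboolP => -[u Mu e]; exists u.
- case: x y z => [a [s Ms]] [b [t Mt]] [c [r Mr]].
  move=> /asboolP[u Mu /= e1] /asboolP[v Mv /= e2]; apply/asboolP.
  exists (u * v * t); first by rewrite !mult_setM.
  rewrite /=.
  have -> : u * v * t * (a * r) = v * r * (u * (a * t)) by ring.
  have -> : u * v * t * (c * s) = u * s * (v * (c * t)) by ring.
  by rewrite e1 -e2; ring.
Qed.

Canonical loc_equiv_rel := EquivRelPack loc_equiv_is_equiv.
Canonical loc_enc_rel := defaultEncModRel loc_equiv.

Definition loc : Type := {eq_quot loc_equiv}.
HB.instance Definition _ := EqQuotient.on loc.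
HB.instance Definition _ := Choice.on loc.

Definition mkfrac (a s : A) (Ms : s \in M) : loc := \pi_loc (a, exist _ s Ms).

Fact mkfracP a s Ms b t Mt :
  @mkfrac a s Ms = @mkfrac b t Mt <-> exists2 u, u \in M & u * (a * t) = u * (b * s).
Proof.
split=> [/eqP|[u Mu e]].
  by rewrite /mkfrac piE => /asboolP.
by apply/eqP; rewrite /mkfrac piE; apply/asboolP; exists u.
Qed.

Fact mkfrac_ind (P : loc -> Prop) :
  (forall a s (Ms : s \in M), P (mkfrac a Ms)) -> forall z, P z.
Proof.
by move=> Pf z; rewrite -[z]reprK; case: (repr z) => a [s Ms]; apply: Pf.
Qed.

Definition loc_add (z w : loc) : loc :=
  let: (a, s) := repr z in let: (b, t) := repr w in
  mkfrac (a * val t + b * val s) (mult_setM (valP s) (valP t)).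
Definition loc_mul (z w : loc) : loc :=
  let: (a, s) := repr z in let: (b, t) := repr w in
  mkfrac (a * b) (mult_setM (valP s) (valP t)).
Definition loc_opp (z : loc) : loc :=
  let: (a, s) := repr z in mkfrac (- a) (valP s).
Definition loc_inj (a : A) : loc := mkfrac a (mult_set1 M).

Fact repr_mkfrac a s (Ms : s \in M) :
  exists2 u, u \in M &
    u * ((repr (mkfrac a Ms)).1 * s) = u * (a * val (repr (mkfrac a Ms)).2).
Proof.
have /eqP : \pi_loc (repr (mkfrac a Ms)) = \pi_loc (a, exist _ s Ms) by rewrite reprK.
by rewrite piE => /asboolP.
Qed.

Fact loc_addE a s (Ms : s \in M) b t (Mt : t \in M) :
  loc_add (mkfrac a Ms) (mkfrac b Mt) = mkfrac (a * t + b * s) (mult_setM Ms Mt).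
Proof.
have [u Mu] := repr_mkfrac a Ms; have [v Mv] := repr_mkfrac b Mt.
rewrite /loc_add.
case: (repr (mkfrac a Ms)) => a' [s' Ms'] /=.
case: (repr (mkfrac b Mt)) => b' [t' Mt'] /= e2 e1.
apply/mkfracP; exists (u * v); first exact: mult_setM.
have -> : u * v * ((a' * t' + b' * s') * (s * t)) =
  v * t' * t * (u * (a' * s)) + u * s * s' * (v * (b' * t)) by ring.
by rewrite e1 e2; ring.
Qed.

Fact loc_mulE a s (Ms : s \in M) b t (Mt : t \in M) :
  loc_mul (mkfrac a Ms) (mkfrac b Mt) = mkfrac (a * b) (mult_setM Ms Mt).
Proof.
have [u Mu] := repr_mkfrac a Ms; have [v Mv] := repr_mkfrac b Mt.
rewrite /loc_mul.
case: (repr (mkfrac a Ms)) => a' [s' Ms'] /=.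
case: (repr (mkfrac b Mt)) => b' [t' Mt'] /= e2 e1.
apply/mkfracP; exists (u * v); first exact: mult_setM.
have -> : u * v * (a' * b' * (s * t)) = u * (a' * s) * (v * (b' * t)) by ring.
by rewrite e1 e2; ring.
Qed.

Fact loc_oppE a s (Ms : s \in M) : loc_opp (mkfrac a Ms) = mkfrac (- a) Ms.
Proof.
have [u Mu] := repr_mkfrac a Ms; rewrite /loc_opp.
case: (repr (mkfrac a Ms)) => a' [s' Ms'] /= e.
by apply/mkfracP; exists u => //; rewrite !mulNr !mulrN e.
Qed.

Fact loc_addA : associative loc_add.
Proof.
elim/mkfrac_ind=> a s Ms; elim/mkfrac_ind=> b t Mt; elim/mkfrac_ind=> c r Mr.
rewrite !loc_addE; apply/mkfracP; exists 1; [exact: mult_set1 | ring].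
Qed.

Fact loc_addC : commutative loc_add.
Proof.
elim/mkfrac_ind=> a s Ms; elim/mkfrac_ind=> b t Mt.
rewrite !loc_addE; apply/mkfracP; exists 1; [exact: mult_set1 | ring].
Qed.

Fact loc_add0 : left_id (loc_inj 0) loc_add.
Proof.
elim/mkfrac_ind=> a s Ms.
rewrite loc_addE; apply/mkfracP; exists 1; [exact: mult_set1 | ring].
Qed.

Fact loc_addN : left_inverse (loc_inj 0) loc_opp loc_add.
Proof.
elim/mkfrac_ind=> a s Ms.
rewrite loc_oppE loc_addE; apply/mkfracP; exists 1; [exact: mult_set1 | ring].
Qed.

Fact loc_mulA : associative loc_mul.
Proof.
elim/mkfrac_ind=> a s Ms; elim/mkfrac_ind=> b t Mt; elim/mkfrac_ind=> c r Mr.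
rewrite !loc_mulE; apply/mkfracP; exists 1; [exact: mult_set1 | ring].
Qed.

Fact loc_mulC : commutative loc_mul.
Proof.
elim/mkfrac_ind=> a s Ms; elim/mkfrac_ind=> b t Mt.
rewrite !loc_mulE; apply/mkfracP; exists 1; [exact: mult_set1 | ring].
Qed.

Fact loc_mul1 : left_id (loc_inj 1) loc_mul.
Proof.
elim/mkfrac_ind=> a s Ms.
rewrite loc_mulE; apply/mkfracP; exists 1; [exact: mult_set1 | ring].
Qed.

Fact loc_mulD : left_distributive loc_mul loc_add.
Proof.
elim/mkfrac_ind=> a s Ms; elim/mkfrac_ind=> b t Mt; elim/mkfrac_ind=> c r Mr.
rewrite !(loc_mulE, loc_addE); apply/mkfracP.
exists 1; [exact: mult_set1 | ring].
Qed.

HB.instance Definition _ :=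
  GRing.isZmodule.Build loc loc_addA loc_addC loc_add0 loc_addN.

Fact loc_nonzero1 : loc_inj 1 != 0.
Proof.
apply/eqP => /mkfracP[u Mu]; rewrite !mulr1 mulr0 => u0.
by have := mult_set0 M; rewrite -u0 Mu.
Qed.

HB.instance Definition _ :=
  GRing.Zmodule_isComNzRing.Build loc loc_mulA loc_mulC loc_mul1 loc_mulD
    loc_nonzero1.

Fact loc_inj_zmod_morphism : zmod_morphism loc_inj.
Proof.
move=> a b; rewrite /loc_inj -[RHS]/(loc_add _ (loc_opp _)) loc_oppE loc_addE.
apply/mkfracP; exists 1; [exact: mult_set1 | ring].
Qed.

Fact loc_inj_monoid_morphism : monoid_morphism loc_inj.
Proof.
split=> // a b; rewrite -[RHS]/(loc_mul _ _) loc_mulE.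
apply/mkfracP; exists 1; [exact: mult_set1 | ring].
Qed.

HB.instance Definition _ :=
  GRing.isZmodMorphism.Build A loc loc_inj loc_inj_zmod_morphism.
HB.instance Definition _ :=
  GRing.isMonoidMorphism.Build A loc loc_inj loc_inj_monoid_morphism.

End Localization.

Section FractionRing.
Variable A : comNzRingType.

Definition regular_elt : {pred A} :=
  fun s => `[< forall a : A, a * s = 0 -> a = 0 >].

Fact regular_elt1 : 1 \in regular_elt.
Proof. by apply/asboolP => a; rewrite mulr1. Qed.

Fact regular_eltM s t :
  s \in regular_elt -> t \in regular_elt -> s * t \in regular_elt.
Proof.
move=> /asboolP rs /asboolP rt; apply/asboolP => a.
by rewrite mulrA => /rt/rs.
Qed.

Fact regular_elt0 : 0 \notin regular_elt.
Proof.
by apply/asboolPn => /(_ 1); rewrite mul1r => /(_ erefl)/eqP; rewrite oner_eq0.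
Qed.

Definition regular_set : mult_set A :=
  MultSet regular_elt1 regular_eltM regular_elt0.

(* For a domain this is the field of fractions. *)
Definition fraction_ring : comNzRingType := loc regular_set.
Definition to_fractions : {rmorphism A -> fraction_ring} :=
  @loc_inj A regular_set.

Definition integral_elt : {pred fraction_ring} :=
  fun z => `[< integralOver to_fractions z >].

Fact integral_elt_subring : subring_closed integral_elt.
Proof.
split; first by apply/asboolP; exact: integral1.
- by move=> u v /asboolP iu /asboolP iv; apply/asboolP; exact: integral_sub.
- by move=> u v /asboolP iu /asboolP iv; apply/asboolP; exact: integral_mul.
Qed.

HB.instance Definition _ :=
  GRing.isSubringClosed.Build fraction_ring integral_elt integral_elt_subring.

Record integral_closure : Type := IntegralClosure {
  integral_closure_val :> fraction_ring;
  _ : integral_closure_val \in integral_elt }.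

HB.instance Definition _ := [isSub for integral_closure_val].
HB.instance Definition _ := [Choice of integral_closure by <:].
HB.instance Definition _ :=
  [SubChoice_isSubComNzRing of integral_closure by <:].

Definition normal_domain :=
  is_domain A /\
  forall z : fraction_ring,
    integralOver to_fractions z -> exists a, z = to_fractions a.

End FractionRing.

Definition unibranch (A : comNzRingType) :=
  is_domain (red_ring A) /\ is_local (integral_closure (red_ring A)).

Section IdealPower.
Variables (A : comNzRingType) (I : idealr A).

Fixpoint ideal_pow (n : nat) : A -> bool :=
  if n is n'.+1 then fun a =>
    `[< exists (k : nat) (b c : 'I_k -> A),
          (forall i, b i \in I) /\ (forall i, ideal_pow n' (c i)) /\
          a = \sum_i b i * c i >]
  else xpredT.

(* I ^ (n + 1); only positive powers are proper ideals. *)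
Definition ideal_powS_pred (n : nat) : A -> bool := ideal_pow n.+1.

Fact ideal_powS_closed n : idealr_closed (ideal_powS_pred n).
Proof.
split.
- apply/asboolP; exists 0%N, (fun=> 0), (fun=> 0); rewrite big_ord0.
  by split=> [[]|] //; split=> [[]|].
- apply/asboolPn => -[k [b [c [Ib [_ e]]]]].
  have : 1 \in I by rewrite e rpred_sum // => i _; rewrite mulrC idealMr.
  by rewrite idealr1.
- move=> a u v /asboolP[k [b [c [Ib [Ic ->]]]]] /asboolP[l [d [e [Id [Ie ->]]]]].
  apply/asboolP.
  exists (k + l)%N.
  exists (fun i => match split i with inl j => a * b j | inr j => d j end).
  exists (fun i => match split i with inl j => c j | inr j => e j end).
  split; first by move=> i; case: (split i) => // j; rewrite idealMr.
  split; first by move=> i; case: (split i).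
  rewrite big_split_ord /= mulr_sumr; congr (_ + _).
    by apply: eq_bigr => i _; rewrite (unsplitK (inl i)) mulrA.
  by apply: eq_bigr => i _; rewrite (unsplitK (inr i)).
Qed.

HB.instance Definition _ n :=
  isIdealr.Build A (ideal_powS_pred n) (ideal_powS_closed n).
Definition ideal_powS (n : nat) : idealr A := ideal_powS_pred n.

End IdealPower.

Section Product.
Variable T : nat -> comNzRingType.

Definition seq_prod : Type := forall n, T n.
HB.instance Definition _ := gen_eqMixin seq_prod.
HB.instance Definition _ := gen_choiceMixin seq_prod.

Let zero : seq_prod := fun=> 0.
Let one : seq_prod := fun=> 1.
Let add (u v : seq_prod) : seq_prod := fun n => u n + v n.
Let opp (u : seq_prod) : seq_prod := fun n => - u n.
Let mul (u v : seq_prod) : seq_prod := fun n => u n * v n.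

Let addA : associative add.
Proof. by move=> u v w; apply: functional_extensionality_dep => n; exact: addrA. Qed.
Let addC : commutative add.
Proof. by move=> u v; apply: functional_extensionality_dep => n; exact: addrC. Qed.
Let add0 : left_id zero add.
Proof. by move=> u; apply: functional_extensionality_dep => n; exact: add0r. Qed.
Let addN : left_inverse zero opp add.
Proof. by move=> u; apply: functional_extensionality_dep => n; exact: addNr. Qed.
Let mulA : associative mul.
Proof. by move=> u v w; apply: functional_extensionality_dep => n; exact: mulrA. Qed.
Let mulC : commutative mul.
Proof. by move=> u v; apply: functional_extensionality_dep => n; exact: mulrC. Qed.
Let mul1 : left_id one mul.
Proof. by move=> u; apply: functional_extensionality_dep => n; exact: mul1r. Qed.
Let mulD : left_distributive mul add.
Proof. by move=> u v w; apply: functional_extensionality_dep => n; exact: mulrDl. Qed.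

HB.instance Definition _ := GRing.isZmodule.Build seq_prod addA addC add0 addN.

Let nonzero1 : one != 0.
Proof.
by apply/eqP => /(congr1 (@^~ 0%N)) /= /eqP; rewrite /one oner_eq0.
Qed.

HB.instance Definition _ :=
  GRing.Zmodule_isComNzRing.Build seq_prod mulA mulC mul1 mulD nonzero1.

End Product.

(* [completion I] is the inverse limit of the rings [A / I ^ (n + 1)], realized
   as the ring of compatible families. *)
Section Completion.
Variables (A : comNzRingType) (I : idealr A).

Definition adic_quot (n : nat) : comNzRingType := {ideal_quot (ideal_powS I n)}.
Definition adic_pi (n : nat) : {rmorphism A -> adic_quot n} :=
  \pi_{ideal_quot (ideal_powS I n)}.

Definition compatible : {pred seq_prod adic_quot} := fun u =>
  `[< forall n a, adic_pi n.+1 a = u n.+1 -> adic_pi n a = u n >].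

Fact adic_piK n (z : adic_quot n) : exists a, adic_pi n a = z.
Proof. by exists (repr z); exact: reprK. Qed.

Fact adic_piS n a : adic_pi n.+1 a = 0 -> adic_pi n a = 0.
Proof.
have piE0 k (b : A) : (adic_pi k b = 0) <-> b \in ideal_powS I k.
  rewrite -[0](rmorph0 (adic_pi k)); split=> [/eqP|Ib].
    by rewrite -Quotient.idealrBE subr0.
  by apply/eqP; rewrite -Quotient.idealrBE subr0.
move=> /piE0 Ia; apply/piE0; elim: n a Ia => [|n IHn] a.
  move=> /asboolP[k [b [c [Ib [_ ->]]]]]; apply/asboolP; exists k, b, c.
  by split=> //; split.
move=> /asboolP[k [b [c [Ib [Ic ->]]]]]; apply/asboolP; exists k, b, c.
by split; [|split=> [i|]]; [|exact: (IHn _ (Ic i))|].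
Qed.

Fact compatible_subring : subring_closed compatible.
Proof.
split.
- apply/asboolP => n a e; rewrite -[RHS]/(1 : adic_quot n).
  apply/eqP; rewrite -subr_eq0 -(rmorph1 (adic_pi n)) -rmorphB.
  by apply/eqP/adic_piS; rewrite rmorphB rmorph1 e subrr.
- move=> u v /asboolP Cu /asboolP Cv; apply/asboolP => n a e.
  have [b eb] := adic_piK (u n.+1); have [c ec] := adic_piK (v n.+1).
  rewrite -[RHS]/(u n - v n) -(Cu _ _ eb) -(Cv _ _ ec).
  apply/eqP; rewrite -subr_eq0 -!rmorphB; apply/eqP/adic_piS.
  by rewrite !rmorphB eb ec e subrr.
- move=> u v /asboolP Cu /asboolP Cv; apply/asboolP => n a e.
  have [b eb] := adic_piK (u n.+1); have [c ec] := adic_piK (v n.+1).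
  rewrite -[RHS]/(u n * v n) -(Cu _ _ eb) -(Cv _ _ ec).
  apply/eqP; rewrite -subr_eq0 -rmorphM -rmorphB; apply/eqP/adic_piS.
  by rewrite rmorphB rmorphM eb ec e subrr.
Qed.

HB.instance Definition _ :=
  GRing.isSubringClosed.Build (seq_prod adic_quot) compatible
    compatible_subring.

Record completion : Type := Completion {
  completion_val :> seq_prod adic_quot;
  _ : completion_val \in compatible }.

HB.instance Definition _ := [isSub for completion_val].
HB.instance Definition _ := [Choice of completion by <:].
HB.instance Definition _ := [SubChoice_isSubComNzRing of completion by <:].

Fact compatible_pi a : (fun n => adic_pi n a) \in compatible.
Proof.
apply/asboolP => n b e; apply/eqP; rewrite -subr_eq0 -rmorphB.
by apply/eqP/adic_piS; rewrite rmorphB e subrr.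
Qed.

Definition completion_map (a : A) : completion := Completion (compatible_pi a).

Fact completion_map_zmod_morphism : zmod_morphism completion_map.
Proof.
move=> a b; apply: val_inj; apply: functional_extensionality_dep => n.
exact: rmorphB.
Qed.

Fact completion_map_monoid_morphism : monoid_morphism completion_map.
Proof.
split; first by apply: val_inj; apply: functional_extensionality_dep => n; exact: rmorph1.
move=> a b; apply: val_inj; apply: functional_extensionality_dep => n.
exact: rmorphM.
Qed.

HB.instance Definition _ :=
  GRing.isZmodMorphism.Build A completion completion_map
    completion_map_zmod_morphism.
HB.instance Definition _ :=
  GRing.isMonoidMorphism.Build A completion completion_map
    completion_map_monoid_morphism.

Definition adic_complete := bijective completion_map.

End Completion.

Definition analytically_unramified (A : comNzRingType) :=
  noetherian A /\ exists2 m : idealr A, local_ring m & reduced (completion m).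

Section Irreducible.
Variable T : topologicalType.
Implicit Types Y Z : set T.

Definition irreducible Z :=
  Z !=set0 /\
  forall C D : set T, closed C -> closed D ->
    Z `<=` C `|` D -> Z `<=` C \/ Z `<=` D.

(* [Z] is an irreducible closed subset of the subspace [Y]. *)
Definition irreducible_closed_in Y Z :=
  irreducible Z /\ exists2 C, closed C & Z = Y `&` C.

(* Irreducible components are closed, so it suffices to compare with
   irreducible closed subsets. *)
Definition irreducible_component Y Z :=
  irreducible_closed_in Y Z /\
  forall Z', irreducible_closed_in Y Z' -> Z `<=` Z' -> Z' = Z.

Definition irreducible_chain Y (d : nat) :=
  exists c : nat -> set T,
    (forall i, (i <= d)%N -> irreducible_closed_in Y (c i)) /\
    forall i, (i < d)%N -> c i `<` c i.+1.

Definition dimension Y (d : nat) :=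
  irreducible_chain Y d /\ ~ irreducible_chain Y d.+1.

Definition pure_dimension Y (d : nat) :=
  forall Z, irreducible_component Y Z -> dimension Z d.

End Irreducible.

Record spec (A : comNzRingType) := Spec {
  spec_pred :> A -> bool;
  spec_idealr : idealr_closed spec_pred;
  spec_prime : prime_idealr_closed spec_pred }.

Section Spec.
Variable A : comNzRingType.

HB.instance Definition _ (p : spec A) :=
  isIdealr.Build A (spec_pred p) (spec_idealr p).
HB.instance Definition _ (p : spec A) :=
  isPrimeIdealrClosed.Build A (spec_pred p) (@spec_prime _ p).

HB.instance Definition _ := gen_eqMixin (spec A).
HB.instance Definition _ := gen_choiceMixin (spec A).

Definition spec_basic_open (f : A) : set (spec A) := [set p : spec A | f \notin spec_pred p].

Definition spec_open (U : set (spec A)) :=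
  forall p, U p -> exists2 f, spec_basic_open f p & spec_basic_open f `<=` U.

Fact spec_openT : spec_open setT.
Proof. by move=> p _; exists 1; rewrite /spec_basic_open /= ?idealr1. Qed.

Fact spec_openI : setI_closed spec_open.
Proof.
move=> U V oU oV p [/oU[f fp fU] /oV[g gp gV]]; exists (f * g).
  by rewrite /spec_basic_open /= prime_idealrM negb_or fp.
move=> q; rewrite /spec_basic_open /= prime_idealrM negb_or => /andP[fq gq].
by split; [exact: fU | exact: gV].
Qed.

Fact spec_open_bigcup (I : Type) (U : I -> set (spec A)) :
  (forall i, spec_open (U i)) -> spec_open (\bigcup_i U i).
Proof.
move=> oU p [i _ /oU[f fp fU]]; exists f => // q /fU Uq; by exists i.
Qed.

HB.instance Definition _ :=
  isOpenTopological.Build (spec A) spec_openT spec_openI spec_open_bigcup.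

End Spec.

Record grading (R : comNzRingType) (A : comAlgType R) := Grading {
  piece :> nat -> {pred A};
  piece_submod : forall d, submod_closed (piece d);
  piece1 : 1 \in piece 0%N;
  pieceM : forall d e a b,
    a \in piece d -> b \in piece e -> a * b \in piece (d + e)%N;
  piece_generate : forall a, exists (n : nat) (c : nat -> A),
    (forall i, c i \in piece i) /\ a = \sum_(i < n) c i;
  piece_direct : forall (n : nat) (c : nat -> A),
    (forall i, c i \in piece i) -> \sum_(i < n) c i = 0 ->
    forall i, (i < n)%N -> c i = 0 }.

(* [A] is generated over [R] by finitely many elements of degree one, i.e. it
   is a quotient of some [R[T_0, ..., T_n]] by a homogeneous ideal [J], and its
   homogeneous spectrum is the closed subscheme [V_+(J)] of projective [n]-space
   over [R]. *)
Definition standard_graded (R : comNzRingType) (A : comAlgType R)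
    (G : grading A) :=
  exists (n : nat) (t : 'I_n.+1 -> A),
    (forall i, t i \in G 1%N) /\
    forall B : {pred A}, subalg_closed B -> (forall i, t i \in B) ->
      forall a, a \in B.

(* The points of [Proj A]: the homogeneous prime ideals of [A] that do not
   contain the irrelevant ideal. *)
Record proj (R : comNzRingType) (A : comAlgType R) (G : grading A) := Proj {
  proj_spec :> spec A;
  proj_homogeneous : forall (n : nat) (c : nat -> A),
    (forall i, c i \in G i) -> \sum_(i < n) c i \in spec_pred proj_spec ->
    forall i, (i < n)%N -> c i \in spec_pred proj_spec;
  proj_relevant : exists (d : nat) (f : A),
    [/\ (0 < d)%N, f \in G d & f \notin spec_pred proj_spec] }.

Section ProjTopology.
Variables (R : comNzRingType) (A : comAlgType R) (G : grading A).
Local Notation X := (proj G).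

HB.instance Definition _ := gen_eqMixin X.
HB.instance Definition _ := gen_choiceMixin X.

Definition proj_basic_open (f : A) : set X := [set x : X | f \notin spec_pred x].

Definition proj_open (U : set X) :=
  forall x, U x -> exists d f,
    [/\ f \in G d, proj_basic_open f x & proj_basic_open f `<=` U].

Fact proj_openT : proj_open setT.
Proof.
move=> x _; exists 0%N, 1; split=> //; first exact: piece1.
by rewrite /proj_basic_open /= idealr1.
Qed.

Fact proj_openI : setI_closed proj_open.
Proof.
move=> U V oU oV x [/oU[d [f [Gf fx fU]]] /oV[e [g [Gg gx gV]]]].
exists (d + e)%N, (f * g); split; first exact: pieceM.
  by rewrite /proj_basic_open /= prime_idealrM negb_or fx.
move=> y; rewrite /proj_basic_open /= prime_idealrM negb_or => /andP[fy gy].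
by split; [exact: fU | exact: gV].
Qed.

Fact proj_open_bigcup (I : Type) (U : I -> set X) :
  (forall i, proj_open (U i)) -> proj_open (\bigcup_i U i).
Proof.
move=> oU x [i _ /oU[d [f [Gf fx fU]]]]; exists d, f; split=> // y /fU Uy.
by exists i.
Qed.

HB.instance Definition _ :=
  isOpenTopological.Build X proj_openT proj_openI proj_open_bigcup.

Definition base_pred (x : X) : R -> bool := fun r => r%:A \in spec_pred x.

Fact base_predE x r : (r \in base_pred x) = (r%:A \in spec_pred x).
Proof. by []. Qed.

Fact base_idealr x : idealr_closed (base_pred x).
Proof.
split; rewrite ?base_predE ?scale0r ?scale1r ?rpred0 ?idealr1 //.
move=> a u v; rewrite !base_predE => xu xv.
by rewrite scalerDl rpredD // -scalerA -mulr_algl idealMr.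
Qed.

Fact base_prime x : prime_idealr_closed (base_pred x).
Proof.
by move=> u v; rewrite !base_predE -scalerA -mulr_algl prime_idealrM.
Qed.

(* The structure morphism to [Spec R]. *)
Definition structure_map (x : X) : spec R :=
  Spec (base_idealr x) (@base_prime x).

Definition fiber (p : idealr R) : set X :=
  [set x : X | spec_pred (structure_map x) =i p].

(* Dense image, i.e. the generic point of [Spec R] is in the closure of the
   image if [R] is a domain. *)
Definition dominant := dense (range structure_map).

(* Each component of each fiber has dimension [d]. *)
Definition relative_dimension (d : nat) :=
  forall p : prime_idealr R, pure_dimension (fiber p) d.

Definition proj_connected := [set: X] !=set0 /\ connected [set: X].

End ProjTopology.

Arguments fiber {R A} G p.

Section Stalk.
Variables (R : comNzRingType) (A : comAlgType R) (G : grading A).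
Variable x : proj G.

Definition hdenom : {pred A} :=
  fun s => `[< exists d, s \in G d /\ s \notin spec_pred x >].

Fact hdenom1 : 1 \in hdenom.
Proof. by apply/asboolP; exists 0%N; rewrite piece1 idealr1. Qed.

Fact hdenomM s t : s \in hdenom -> t \in hdenom -> s * t \in hdenom.
Proof.
move=> /asboolP[d [Gs xs]] /asboolP[e [Gt xt]]; apply/asboolP.
by exists (d + e)%N; rewrite pieceM // prime_idealrM negb_or xs.
Qed.

Fact hdenom0 : 0 \notin hdenom.
Proof. by apply/asboolPn => -[d []]; rewrite rpred0. Qed.

Definition hdenom_set : mult_set A := MultSet hdenom1 hdenomM hdenom0.

(* The local ring at [x] is the ring of fractions [f / g] with [f] and [g]
   homogeneous of the same degree and [g] not in [x]. *)
Definition degree0 : {pred loc hdenom_set} := fun z =>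
  `[< exists (d : nat) (f g : A) (xg : g \in hdenom_set),
        [/\ f \in G d, g \in G d & z = mkfrac f xg] >].

Fact degree0_subring : subring_closed degree0.
Proof.
split.
- apply/asboolP; exists 0%N, 1, 1, (mult_set1 hdenom_set).
  by split=> //; exact: piece1.
- move=> u v /asboolP[d [f [g [xg [Gf Gg ->]]]]].
  move=> /asboolP[e [h [k [xk [Gh Gk ->]]]]]; apply/asboolP.
  exists (d + e)%N, (f * k + - h * g), (g * k), (mult_setM xg xk).
  have [_ lin] := piece_submod G (d + e)%N.
  split; [|exact: pieceM|by rewrite -loc_addE -loc_oppE].
  rewrite mulNr addrC -scaleN1r; apply: lin; last exact: pieceM.
  by rewrite addnC; exact: pieceM.
- move=> u v /asboolP[d [f [g [xg [Gf Gg ->]]]]].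
  move=> /asboolP[e [h [k [xk [Gh Gk ->]]]]]; apply/asboolP.
  exists (d + e)%N, (f * h), (g * k), (mult_setM xg xk).
  by split; [exact: pieceM|exact: pieceM|rewrite -loc_mulE].
Qed.

HB.instance Definition _ :=
  GRing.isSubringClosed.Build (loc hdenom_set) degree0 degree0_subring.

Record stalk : Type := Stalk {
  stalk_val :> loc hdenom_set;
  _ : stalk_val \in degree0 }.

HB.instance Definition _ := [isSub for stalk_val].
HB.instance Definition _ := [Choice of stalk by <:].
HB.instance Definition _ := [SubChoice_isSubComNzRing of stalk by <:].

(* Germs at [x] of functions vanishing on [Z], i.e. the stalk at [x] of the
   ideal sheaf of the reduced induced structure when [Z] is closed: [f / g] is
   a section over the open set where [g] does not vanish. *)
Definition germs_vanishing_pred (Z : set (proj G)) : Z x -> stalk -> bool :=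
  fun=> fun z =>
  `[< exists (d : nat) (f g : A) (xg : g \in hdenom_set),
        [/\ f \in G d, g \in G d, stalk_val z = mkfrac f xg &
          forall y, Z y -> g \notin spec_pred y -> f \in spec_pred y] >].

Fact germs_vanishing_closed (Z : set (proj G)) (Zx : Z x) :
  idealr_closed (germs_vanishing_pred Zx).
Proof.
split.
- apply/asboolP; exists 0%N, 0, 1, (mult_set1 hdenom_set).
  split=> [|||y _ _]; [|exact: piece1|by []|exact: rpred0].
  by have [] := piece_submod G 0%N.
- apply/asboolPn => -[d [f [g [xg [Gf Gg /mkfracP[u xu e] Zf]]]]].
  have /asboolP[? [_ xNg]] := xg; have /asboolP[? [_ xNu]] := xu.
  have : u * (1 * g) \in spec_pred x.
    by rewrite e idealMr // mulr1 Zf.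
  by rewrite mul1r prime_idealrM (negPf xNg) (negPf xNu).
- move=> a u v /asboolP[d [f [g [xg [Gf Gg eu Zf]]]]].
  move=> /asboolP[e [h [k [xk [Gh Gk ev Zh]]]]]; apply/asboolP.
  have /asboolP[c [r [s [xs [Gr Gs ea]]]]] := valP a.
  exists (c + d + e)%N, (r * f * k + h * (s * g)), (s * g * k).
  exists (mult_setM (mult_setM xs xg) xk).
  have [_ lin] := piece_submod G (c + d + e)%N.
  split.
  + rewrite -[r * f * k]scale1r; apply: lin.
      by apply: pieceM => //; exact: pieceM.
    by rewrite addnC; apply: pieceM => //; exact: pieceM.
  + by apply: pieceM => //; exact: pieceM.
  + rewrite -[LHS]/(loc_add (loc_mul (stalk_val a) (stalk_val u)) (stalk_val v)).
    by rewrite ea eu ev loc_mulE loc_addE.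
  + move=> y Zy; rewrite !prime_idealrM !negb_or => /andP[/andP[ys yg] yk].
    by rewrite rpredD // !prime_idealrM ?(Zf y) ?(Zh y) ?orbT.
Qed.

HB.instance Definition _ (Z : set (proj G)) (Zx : Z x) :=
  isIdealr.Build stalk (germs_vanishing_pred Zx) (germs_vanishing_closed Zx).

Definition germs_vanishing (Z : set (proj G)) (Zx : Z x) : idealr stalk :=
  germs_vanishing_pred Zx.

(* The local ring at [x] of the closed subset [Z] with its reduced structure. *)
Definition reduced_stalk (Z : set (proj G)) (Zx : Z x) : comNzRingType :=
  {ideal_quot (germs_vanishing Zx)}.

End Stalk.

Definition proj_normal (R : comNzRingType) (A : comAlgType R) (G : grading A) :=
  forall x : proj G, normal_domain (stalk x).

(* Main.v *)
(* Let S = R_x with completion S^, and let t be the image in S of a nonzero element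
   of m_R. As S is normal, the associated primes q_c = (t : c) of t are the primes
   of the components of X through x, S_(q_c) is a discrete valuation ring in which
   c / t is the inverse of a uniformizer, and by assumption q_c S^ is prime; here
   analytically unramified and unibranch make the completion of S / q_c a domain by
   an idempotent argument in its fraction ring. Given b in S^ of finite valuation at
   every q_c S^, multiplying b by suitable fractions c / t gives an element f of S^
   outside all q_c S^. Then S^ / (f, t) has finite length, so S^ / f is a finite module
   over the complete ring R and S + f S^ = S^; writing the maximal ideal of S^ as
   m_x + f m_x S^ yields f (1 - h) = s with s in m_x, so f, hence b, is an element of S
   times a unit.
   It remains to exclude elements b <> 0 of infinite valuation at some q_c S^. Such a
   b is annihilated by some g that has finite valuation there, since S^ is Noetherian;
   with g chosen suitably b + g has finite valuation everywhere, so that, after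
   removing vertical factors and a unit, b + g = a is in S. Approximating b by d in S
   modulo a ^ 2 makes d / a integral over the normal ring S, so b / a is an idempotent
   of the local ring S^, a contradiction. *)

Require Import Defs.
From HB Require Import structures.
From mathcomp Require Import all_boot all_algebra ring_quotient.
From mathcomp Require Import boolp classical_sets.
From mathcomp Require Import topology_structure connected.
From mathcomp Require Import ring zify.

Set Implicit Arguments.
Unset Strict Implicit.
Unset Printing Implicit Defensive.

Import GRing.Theory.
Local Open Scope classical_set_scope.
Local Open Scope ring_scope.

(** The obstacle is that S^ may, until the very end, have zero divisors, so that a nonzero element
    can have infinite valuation at some q_c S^ only. Valuations are therefore not taken in
    localizations of S^ but expressed by equations [c ^ n * f = t ^ n * f'] in S^ itself, where t
    stays regular. Adjusting c modulo t makes c / t a unit at the other primes, so that one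
    valuation can be changed without touching the others. Flatness arguments become approximation
    arguments: ideals of S^ are closed, and Artin-Rees transfers regularity, both consequences of
    the Noetherian property of the Rees algebra. The geometry enters through four facts: t is
    nonzero in S because the curve is connected and dominates Spec R; q_c contains m_R because R has
    dimension one; no prime lies strictly between q_c and m_x because the fibers have dimension one;
    and the residue field at x is finite over R because x is closed. *)

Lemma dependent_choice (T : Type) (P : nat -> T -> Prop)
    (r : nat -> T -> T -> Prop) (x0 : T) :
  P 0%N x0 ->
  (forall n x, P n x -> exists y, r n x y /\ P n.+1 y) ->
  exists u : nat -> T, u 0%N = x0 /\
    forall n, P n (u n) /\ r n (u n) (u n.+1).
Proof.
move=> P0 step.
have [f fP] : {f : nat * T -> T | forall z, P z.1 z.2 ->
    r z.1 z.2 (f z) /\ P z.1.+1 (f z)}.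
  have H (z : nat * T) : exists y, P z.1 z.2 -> r z.1 z.2 y /\ P z.1.+1 y.
    have [Pz|nPz] := pselect (P z.1 z.2); last by exists x0.
    by have [y] := step _ _ Pz; exists y.
  by have [f fP] := choice H; exists f.
pose u := fix u n := if n is n'.+1 then f (n', u n') else x0.
have Pu n : P n (u n) by elim: n => //= n /(fP (n, u n))[].
by exists u; split=> // n; split=> //; have [] := fP (n, u n) (Pu n).
Qed.

(** * Ideals as predicates, spans and the Noetherian property *)

Section Ideals.
Variable A : comNzRingType.
Implicit Types (I J : A -> Prop) (s : seq A).

Record ideal I : Prop := Ideal {
  ideal0 : I 0;
  idealD : forall u v, I u -> I v -> I (u + v);
  idealM : forall a u, I u -> I (a * u) }.

Lemma idealMl I a u : ideal I -> I u -> I (u * a).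
Proof. by move=> iI Iu; rewrite mulrC; apply: idealM. Qed.

Lemma idealN I u : ideal I -> I u -> I (- u).
Proof. by move=> iI Iu; rewrite -mulN1r; apply: idealM. Qed.

Lemma idealB I u v : ideal I -> I u -> I v -> I (u - v).
Proof. by move=> iI Iu Iv; apply: idealD => //; apply: idealN. Qed.

Lemma idealDr I u v : ideal I -> I v -> I (u + v) -> I u.
Proof. by move=> iI Iv Iuv; rewrite -(addrK v u); apply: idealB. Qed.

Lemma idealBr I u v : ideal I -> I v -> I (u - v) -> I u.
Proof. by move=> iI Iv Iuv; rewrite -(subrK v u); apply: idealD. Qed.

Lemma ideal_sum I (T : Type) (r : seq T) (P : pred T) (F : T -> A) :
  ideal I -> (forall i, P i -> I (F i)) -> I (\sum_(i <- r | P i) F i).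
Proof.
by move=> iI IF; apply: big_ind => //; [exact: ideal0 | exact: idealD].
Qed.

Lemma ideal_idealr (J : idealr A) : ideal (fun a => a \in J).
Proof.
split; [exact: idealr0 | by move=> u v Ju Jv; rewrite rpredD |].
by move=> a u Ju; rewrite idealMr.
Qed.

(* Ideals in the sense of [ideal] may be the whole ring, unlike those in
   [idealr A]. *)
Lemma ideal_idealrE I : ideal I -> ~ I 1 -> {J : idealr A | forall a, (a \in J) <-> I a}.
Proof.
move=> iI I1; pose p : A -> bool := fun a => `[< I a >].
have pc : idealr_closed p.
  split; first by apply/asboolP; exact: ideal0.
    by apply/asboolPn.
  move=> a u v /asboolP Iu /asboolP Iv; apply/asboolP.
  by apply: idealD => //; apply: idealM.
pose HI := isIdealr.Build A p pc.
pose J : idealr A := HB.pack p HI.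
by exists J => a; split => /asboolP.
Qed.

Definition prime_ideal I :=
  [/\ ideal I, ~ I 1 & forall a b, I (a * b) -> I a \/ I b].

Lemma prime_idealX I a n : prime_ideal I -> I (a ^+ n) -> I a.
Proof.
case=> iI I1 pI; elim: n => [|n IHn]; first by rewrite expr0.
by rewrite exprS => /pI[].
Qed.

(** Coefficients are restricted to [P]: later [P] is a step of the adic filtration, so that infinite
    sums of combinations converge, or the image of [R], which expresses finiteness over [R]. *)
Fixpoint lincomb (P : A -> Prop) s (a : A) : Prop :=
  if s is x :: s' then exists c, P c /\ lincomb P s' (a - c * x) else a = 0.

Definition spanned s := lincomb (fun=> True) s.

Lemma lincomb0 (P : A -> Prop) s : P 0 -> lincomb P s 0.
Proof.
by move=> P0; elim: s => //= x s IHs; exists 0; rewrite mul0r subr0.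
Qed.

Lemma lincombD (P : A -> Prop) s a b : (forall c d, P c -> P d -> P (c + d)) ->
  lincomb P s a -> lincomb P s b -> lincomb P s (a + b).
Proof.
move=> PD; elim: s a b => [|x s IHs] a b /=; first by move=> -> ->; rewrite addr0.
move=> [c [Pc ac]] [d [Pd bd]]; exists (c + d); split; first exact: PD.
by rewrite mulrDl opprD addrACA; apply: IHs.
Qed.

Lemma lincombM (P Q : A -> Prop) s a b : (forall c, P c -> Q (b * c)) ->
  lincomb P s a -> lincomb Q s (b * a).
Proof.
move=> PQ; elim: s a => [|x s IHs] a /=; first by move=> ->; rewrite mulr0.
move=> [c [Pc ac]]; exists (b * c); split; first exact: PQ.
by rewrite -mulrA -mulrBr; apply: IHs.
Qed.

Lemma lincomb_mem (P : A -> Prop) s x c : P 0 -> x \in s -> P c ->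
  lincomb P s (c * x).
Proof.
move=> P0; elim: s => //= y s IHs; rewrite inE => /orP[/eqP -> Pc|xs Pc].
  by exists c; rewrite subrr; split=> //; apply: lincomb0.
by exists 0; rewrite mul0r subr0; split=> //; apply: IHs.
Qed.

Lemma lincomb_ind (P Q : A -> Prop) s : Q 0 ->
  (forall a b, Q a -> Q b -> Q (a + b)) ->
  (forall x c, x \in s -> P c -> Q (c * x)) ->
  forall a, lincomb P s a -> Q a.
Proof.
move=> Q0 QD; elim: s => [|x s IHs] Qm a /=; first by move=> ->.
move=> [c [Pc ac]]; rewrite -(subrK (c * x) a); apply: QD.
  by apply: IHs ac => y d ys; apply: Qm; rewrite inE ys orbT.
by apply: Qm => //; rewrite inE eqxx.
Qed.

Lemma lincomb_sum (P : A -> Prop) s (T : Type) (r : seq T) (C : pred T)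
    (F : T -> A) : P 0 -> (forall c d, P c -> P d -> P (c + d)) ->
  (forall i, C i -> lincomb P s (F i)) -> lincomb P s (\sum_(i <- r | C i) F i).
Proof.
by move=> P0 PD H; apply: big_ind => //; [exact: lincomb0 | move=> *; exact: lincombD].
Qed.

Lemma ideal_spanned s : ideal (spanned s).
Proof.
split; [exact: lincomb0 | by move=> u v; apply: lincombD |].
by move=> a u; apply: lincombM.
Qed.

Lemma spanned_mem s x : x \in s -> spanned s x.
Proof. by move=> xs; rewrite -[x]mul1r; apply: lincomb_mem. Qed.

Lemma spanned_sub s I : ideal I -> (forall x, x \in s -> I x) ->
  forall a, spanned s a -> I a.
Proof.
move=> iI sI; apply: lincomb_ind => [||x c xs _]; first exact: ideal0.
  exact: idealD.
by apply: idealM => //; apply: sI.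
Qed.

Lemma spanned_incl s s' a : {subset s <= s'} -> spanned s a -> spanned s' a.
Proof.
move=> ss'; apply: spanned_sub; first exact: ideal_spanned.
by move=> x /ss'; apply: spanned_mem.
Qed.

Lemma spanned_sum k (g c : 'I_k -> A) : spanned (codom g) (\sum_i c i * g i).
Proof.
apply: ideal_sum => [|i _]; first exact: ideal_spanned.
by apply: idealM; [exact: ideal_spanned | apply: spanned_mem; exact: codom_f].
Qed.

Definition noeth := forall I, ideal I -> exists s,
  (forall x, x \in s -> I x) /\ forall a, I a -> spanned s a.

Lemma noetherianP : noetherian A -> noeth.
Proof.
move=> nA I iI; have [I1|I1] := pselect (I 1).
  exists [:: 1]; split=> [x|a _]; first by rewrite inE => /eqP ->.
  by exists a; rewrite mulr1 subrr.
have [J JI] := ideal_idealrE iI I1.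
have [k [g [Jg gen]]] := nA J; exists (codom g); split.
  by move=> x /codomP[i ->]; apply/JI.
by move=> a /JI/gen[c ->]; apply: spanned_sum.
Qed.

(** Finitely many generators of the ideal generated by [X] involve only finitely many elements of
    [X]. This serves for sets that are not ideals, such as homogeneous elements or elements with
    maximal annihilator. *)
Lemma noeth_subset (X : A -> Prop) : noeth -> exists s,
  (forall x, x \in s -> X x) /\ forall x, X x -> spanned s x.
Proof.
move=> nA; pose I a := exists s, (forall x, x \in s -> X x) /\ spanned s a.
have iI : ideal I.
  split; first by exists [::].
    move=> u v [s [sX su]] [s' [sX' sv]]; exists (s ++ s'); split.
      by move=> x; rewrite mem_cat => /orP[/sX|/sX'].
    apply: idealD; first exact: ideal_spanned.
      by apply: spanned_incl su => x; rewrite mem_cat => ->.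
    by apply: spanned_incl sv => x; rewrite mem_cat orbC => ->.
  by move=> a u [s [sX su]]; exists s; split=> //; apply: idealM su; apply: ideal_spanned.
have [s [sI gen]] := nA I iI.
have [s' [sX' ss']] : exists s', (forall x, x \in s' -> X x) /\
    forall x, x \in s -> spanned s' x.
  elim: s sI {gen} => [|x s IHs] sI; first by exists [::].
  have [|s' [sX' ss']] := IHs; first by move=> y ys; apply: sI; rewrite inE ys orbT.
  have [|r [rX rx]] := sI x; first by rewrite inE eqxx.
  exists (r ++ s'); split.
    by move=> y; rewrite mem_cat => /orP[/rX|/sX'].
  move=> y; rewrite inE => /orP[/eqP ->|/ss' sy].
    by apply: spanned_incl rx => z; rewrite mem_cat => ->.
  by apply: spanned_incl sy => z; rewrite mem_cat orbC => ->.
exists s'; split=> // x Xx; apply: (spanned_sub (ideal_spanned s') ss').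
apply: gen; exists [:: x]; split; first by move=> y; rewrite inE => /eqP ->.
by apply: spanned_mem; rewrite inE.
Qed.

Lemma noeth_chain (I : nat -> A -> Prop) : noeth -> (forall n, ideal (I n)) ->
  (forall n a, I n a -> I n.+1 a) ->
  exists n, forall k a, I k a -> I n a.
Proof.
move=> nA iI Imono.
have Ile n m a : (n <= m)%N -> I n a -> I m a.
  by move=> /subnK <-; elim: (m - n)%N => //= k IHk /IHk/Imono.
pose U a := exists n, I n a.
have iU : ideal U.
  split; first by exists 0%N; apply: ideal0.
    move=> u v [n Iu] [m Iv]; exists (maxn n m); apply: idealD => //.
      by apply: Ile Iu; apply: leq_maxl.
    by apply: Ile Iv; apply: leq_maxr.
  by move=> a u [n Iu]; exists n; apply: idealM.
have [s [sU gen]] := nA U iU.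
have [n sn] : exists n, forall x, x \in s -> I n x.
  elim: s sU {gen} => [|x s IHs] sU; first by exists 0%N.
  have [|n sn] := IHs; first by move=> y ys; apply: sU; rewrite inE ys orbT.
  have [|m Ix] := sU x; first by rewrite inE eqxx.
  exists (maxn n m) => y; rewrite inE => /orP[/eqP ->|/sn Iy].
    by apply: Ile Ix; apply: leq_maxr.
  by apply: Ile Iy; apply: leq_maxl.
by exists n => k a Ia; apply: (spanned_sub (iI n) sn); apply: gen; exists k.
Qed.

Lemma noeth_max (F : (A -> Prop) -> Prop) I0 : noeth ->
  (forall I, F I -> ideal I) -> F I0 ->
  exists I, [/\ F I, (forall a, I0 a -> I a) & forall J, F J ->
    (forall a, I a -> J a) -> forall a, J a -> I a].
Proof.
move=> nA Fid FI0; apply: contrapT => nmax.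
pose P (n : nat) I := F I /\ forall a, I0 a -> I a.
pose r (n : nat) I J := (forall a, I a -> J a) /\ ~ (forall a, J a -> I a).
have step n I : P n I -> exists J, r n I J /\ P n.+1 J.
  move=> [FI I0I]; apply: contrapT => nJ; apply: nmax; exists I; split=> //.
  move=> J FJ IJ; apply: contrapT => nJI; apply: nJ; exists J.
  by split=> //; split=> // a /I0I/IJ.
have [u [_ uP]] := @dependent_choice _ P r I0 (conj FI0 (fun a h => h)) step.
have [n un] : exists n, forall k a, u k a -> u n a.
  by apply: noeth_chain => // n; have [[/Fid Fn _] [sub _]] := uP n.
by have [_ [_]] := uP n; apply => a; apply: un.
Qed.

End Ideals.

Arguments spanned {A} s a.
Arguments noeth A : clear implicits.

Section Surjection.
Variables (A B : comNzRingType) (f : {rmorphism A -> B}).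

Lemma ideal_preim (J : B -> Prop) : ideal J -> ideal (fun a => J (f a)).
Proof.
move=> iJ; split; first by rewrite rmorph0; apply: ideal0.
  by move=> u v Ju Jv; rewrite rmorphD; apply: idealD.
by move=> a u Ju; rewrite rmorphM; apply: idealM.
Qed.

Lemma spanned_map s a : spanned s a -> spanned (map f s) (f a).
Proof.
move: a; apply: (spanned_sub (ideal_preim (ideal_spanned (map f s)))) => x xs.
by apply: spanned_mem; apply: map_f.
Qed.

Lemma noeth_surj : (forall b, exists a, f a = b) -> noeth A -> noeth B.
Proof.
move=> fsurj nA J iJ; have [s [sJ gen]] := nA _ (ideal_preim iJ).
exists (map f s); split; first by move=> x /mapP[a /sJ Ja ->].
by move=> b; have [a <-] := fsurj b => /gen/spanned_map.
Qed.

End Surjection.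

(** * Hilbert's basis theorem, powers of ideals and local rings *)

Section HilbertBasis.
Variable A : comNzRingType.

Lemma spanned_lead (m : nat) (s : seq {poly A}) (I : {poly A} -> Prop) a :
  ideal I -> (forall p, p \in s -> I p /\ (size p <= m.+1)%N) ->
  spanned (map (fun p : {poly A} => p`_m) s) a ->
  exists q, [/\ I q, spanned s q, (size q <= m.+1)%N & q`_m = a].
Proof.
move=> iI sI; move: a; apply: lincomb_ind => [|b c [p [Ip sp szp <-]] [q [Iq sq szq <-]]|].
- by exists 0; split; [exact: ideal0 | apply: ideal0; exact: ideal_spanned
    | rewrite size_poly0 | rewrite coef0].
- exists (p + q); split; [exact: idealD | | | by rewrite coefD].
    by apply: idealD => //; apply: ideal_spanned.
  by rewrite (leq_trans (size_polyD _ _)) // geq_max szp.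
- move=> _ c /mapP[p ps ->] _; have [Ip szp] := sI p ps.
  exists (c%:P * p); split; [exact: idealM | | | by rewrite coefCM].
    by apply: idealM; [exact: ideal_spanned | exact: spanned_mem].
  by rewrite mul_polyC (leq_trans (size_scale_leq _ _)).
Qed.

Theorem hilbert_basis : noeth A -> noeth {poly A}.
Proof.
move=> nA I iI.
pose L n a := exists p, [/\ I p, (size p <= n.+1)%N & p`_n = a].
have iL n : ideal (L n).
  split; first by exists 0; rewrite size_poly0 coef0; split=> //; apply: ideal0.
    move=> _ _ [p [Ip sp <-]] [q [Iq sq <-]]; exists (p + q).
    rewrite coefD (leq_trans (size_polyD _ _)) ?geq_max ?sp //.
    by split=> //; apply: idealD.
  move=> a _ [p [Ip sp <-]]; exists (a%:P * p); rewrite coefCM; split=> //.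
    exact: idealM.
  by rewrite mul_polyC (leq_trans (size_scale_leq _ _)).
have Lmono n a : L n a -> L n.+1 a.
  move=> [p [Ip sp <-]]; exists (p * 'X); split; first exact: idealMl.
    by rewrite (leq_trans (size_polyMleq _ _)) // size_polyX addn2.
  by rewrite coefMX.
have [N LN] := noeth_chain nA iL Lmono.
have [lift liftP] : {f : nat -> seq {poly A} | forall n,
    (forall p, p \in f n -> I p /\ (size p <= n.+1)%N) /\
    forall a, L n a -> spanned (map (fun p : {poly A} => p`_n) (f n)) a}.
  apply: cid; suff H n : exists s : seq {poly A},
      (forall p, p \in s -> I p /\ (size p <= n.+1)%N) /\
      forall a, L n a -> spanned (map (fun p : {poly A} => p`_n) s) a.
    by have [f fP] := choice H; exists f.
  have [s [sL gen]] := nA _ (iL n).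
  suff [s' [s'I e]] : exists s' : seq {poly A},
      (forall p, p \in s' -> I p /\ (size p <= n.+1)%N) /\
      map (fun p : {poly A} => p`_n) s' = s.
    by exists s'; rewrite e.
  elim: s sL {gen} => [|x s IHs] sL; first by exists [::].
  have [|s' [s'I <-]] := IHs; first by move=> y ys; apply: sL; rewrite inE ys orbT.
  have [|p [Ip szp <-]] := sL x; first by rewrite inE eqxx.
  by exists (p :: s'); split=> // q; rewrite inE => /orP[/eqP ->|/s'I].
pose G := flatten (map lift (iota 0 N.+1)).
have GI p : p \in G -> I p.
  by move=> /flatten_mapP[n _ pn]; have [/(_ p pn)[]] := liftP n.
exists G; split=> // p; have [n] := ubnP (size p).
elim: n p => // n IHn p; rewrite ltnS leq_eqVlt => /orP[/eqP szp|] Ip; last exact: IHn.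
case: n szp IHn => [|n] szp IHn.
  by move/eqP: szp; rewrite size_poly_eq0 => /eqP ->; apply: ideal0; exact: ideal_spanned.
(* Beyond [N] the ideals of leading coefficients no longer grow, so the generators lifted in degree
   [N], shifted by a power of ['X], serve for all larger degrees. *)
pose m := minn n N.
have Lm : L m p`_n.
  have Ln : L n p`_n by exists p; rewrite szp.
  rewrite /m; case: (leqP n N) => // _; exact: LN Ln.
have [lI lgen] := liftP m.
have [q [Iq sq szq qm]] := spanned_lead iI lI (lgen _ Lm).
have Gq : spanned G q.
  apply: spanned_incl sq => r rl; apply/flatten_mapP; exists m => //.
  by rewrite mem_iota add0n ltnS geq_minr.
rewrite -(subrK ('X^(n - m) * q) p); apply: idealD.
  exact: ideal_spanned.
  2: by apply: idealM => //; exact: ideal_spanned.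
apply: IHn; last by apply: idealB => //; apply: idealM.
have mn : (m <= n)%N by exact: geq_minl.
rewrite ltnS; apply/leq_sizeP => j nj; rewrite coefB coefXnM ifF; last by lia.
move: nj; rewrite leq_eqVlt => /orP[/eqP <-|nj].
  by rewrite subKn // qm subrr.
rewrite !nth_default ?subrr //; last by rewrite szp.
by rewrite (leq_trans szq) //; lia.
Qed.

End HilbertBasis.

(** [B] is an iterated polynomial ring over [A0], Noetherian by Hilbert's theorem; its image stands
    for the subalgebra generated by [ts]. The last clause is the induction principle for this
    subalgebra. *)
Lemma fg_algebra_noeth (A0 A : comNzRingType) (f : {rmorphism A0 -> A})
    (ts : seq A) : noeth A0 ->
  exists (B : comNzRingType) (phi : {rmorphism B -> A}), [/\ noeth B,
    (forall a, exists b, phi b = f a), (forall t, t \in ts -> exists b, phi b = t) &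
    forall P : A -> Prop, (forall a, P (f a)) -> (forall t, t \in ts -> P t) ->
      (forall a b, P a -> P b -> P (a + b)) ->
      (forall a b, P a -> P b -> P (a * b)) -> forall b, P (phi b)].
Proof.
move=> nA0; elim: ts => [|t ts [B [phi [nB phif phits Pphi]]]].
  by exists A0, f; split=> // a; exists a.
have cphi : commr_rmorph phi t by move=> b; apply: mulrC.
exists {poly B}, (horner_morph cphi); split; first exact: hilbert_basis.
- by move=> a; have [b <-] := phif a; exists b%:P; exact: horner_morphC.
- move=> u; rewrite inE => /orP[/eqP ->|/phits[b <-]].
    by exists 'X; exact: horner_morphX.
  by exists b%:P; exact: horner_morphC.
- move=> P Pf Pt PD PM; elim/poly_ind => [|p c IHp].
    by rewrite rmorph0 -(rmorph0 f).
  rewrite rmorphD rmorphM.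
  rewrite [_ 'X]horner_morphX [_ c%:P]horner_morphC; apply: (PD).
    by apply: PM => //; exact: (Pt t (mem_head t ts)).
  apply: (Pphi P Pf _ PD PM) => u us; apply: Pt; by rewrite inE us orbT.
Qed.

Section IdealPowers.
Variables (A : comNzRingType) (m : idealr A).
Local Notation pw := (@ideal_pow A m).

Lemma ideal_powP n (a : A) :
  reflect (exists (k : nat) (b c : 'I_k -> A),
    (forall i, b i \in m) /\ (forall i, pw n (c i)) /\ a = \sum_i b i * c i)
  (pw n.+1 a).
Proof. exact: asboolP. Qed.

Lemma pow_ideal n : ideal (fun a => pw n a).
Proof.
by case: n => [|n]; [split | have := ideal_idealr (ideal_powS m n)].
Qed.

Lemma powM n k a b : pw n a -> pw k b -> pw (n + k) (a * b).
Proof.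
elim: n a => [|n IHn] a; first by move=> _; apply: (idealM (pow_ideal k)).
move=> /ideal_powP[l [c [d [mc [nd ->]]]]] kb; rewrite mulr_suml addSn.
apply/ideal_powP; exists l, c, (fun i => d i * b); split=> //; split.
  by move=> i; apply: IHn.
by apply: eq_bigr => i _; rewrite mulrA.
Qed.

Lemma pow1P a : pw 1 a <-> a \in m.
Proof.
split=> [/ideal_powP[k [b [c [mb [_ ->]]]]]|ma].
  by apply: (ideal_sum _ (ideal_idealr m)) => i _; rewrite mulrC idealMr.
by apply/ideal_powP; exists 1%N, (fun=> a), (fun=> 1); rewrite big_ord1 mulr1.
Qed.

Lemma powX n a : a \in m -> pw n (a ^+ n).
Proof.
move=> ma; elim: n => // n IHn; rewrite exprS -add1n.
by apply: powM => //; apply/pow1P.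
Qed.

(** The inclusion of [m ^ (n + k)] in [m ^ n * m ^ k], as an elimination principle. The induction
    replaces [I] by the ideals [(I : b i)]. *)
Lemma pow_min n (I : A -> Prop) k : ideal I ->
  (forall a b, pw n a -> pw k b -> I (a * b)) -> forall a, pw (n + k) a -> I a.
Proof.
elim: n I => [|n IHn] I iI nkI a.
  by rewrite add0n => ka; rewrite -[a]mul1r; apply: nkI.
rewrite addSn => /ideal_powP[l [b [c [mb [nc ->]]]]].
apply: ideal_sum => // i _; apply: (IHn (fun c => I (b i * c))) => //.
  split; first by rewrite mulr0; apply: ideal0.
    by move=> u v Iu Iv; rewrite mulrDr; apply: idealD.
  by move=> d u Iu; rewrite mulrCA; apply: idealM.
by move=> d e nd ke; rewrite mulrA; apply: nkI => //; rewrite -add1n; apply: powM => //; apply/pow1P.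
Qed.

Lemma pow_leq n k a : (n <= k)%N -> pw k a -> pw n a.
Proof.
move=> /subnK <-; apply: (pow_min (pow_ideal n)) => b c _ nc.
exact: (idealM (pow_ideal n)).
Qed.

End IdealPowers.

Lemma pow_map (A B : comNzRingType) (f : {rmorphism A -> B}) (m : idealr A)
    (n : idealr B) : (forall a, a \in m -> f a \in n) ->
  forall k a, ideal_pow m k a -> ideal_pow n k (f a).
Proof.
move=> mn; elim=> // k IHk a /ideal_powP[l [b [c [mb [kc ->]]]]].
rewrite rmorph_sum; apply/ideal_powP; exists l, (f \o b), (f \o c).
split; first by move=> i; apply: mn.
by split=> [i|]; [apply: IHk | apply: eq_bigr => i _; rewrite rmorphM].
Qed.

Lemma pow_map_surj (A B : comNzRingType) (f : {rmorphism A -> B})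
    (m : idealr A) (n : idealr B) : (forall b, exists a, f a = b) ->
  (forall b, b \in n -> exists2 a, a \in m & f a = b) ->
  forall k b, ideal_pow n k b -> exists2 a, ideal_pow m k a & f a = b.
Proof.
move=> fsurj nm; elim=> [|k IHk] b; first by have [a <-] := fsurj b; exists a.
move=> /ideal_powP[l [c [d [nc [kd ->]]]]].
have /choice[c' c'P] : forall i, exists a, a \in m /\ f a = c i.
  by move=> i; have [a] := nm _ (nc i); exists a.
have /choice[d' d'P] : forall i, exists a, ideal_pow m k a /\ f a = d i.
  by move=> i; have [a] := IHk _ (kd i); exists a.
exists (\sum_i c' i * d' i).
  apply/ideal_powP; exists l, c', d'; split=> [i|]; first by have [] := c'P i.
  by split=> // i; have [] := d'P i.
by rewrite rmorph_sum; apply: eq_bigr => i _; rewrite rmorphM (c'P i).2 (d'P i).2.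
Qed.

Section LocalRings.
Variables (A : comNzRingType) (m : idealr A).

Lemma unit_ideal (I : A -> Prop) u : ideal I -> is_unit u -> I u -> I 1.
Proof. by move=> iI [v <-] Iu; apply: idealM. Qed.

Lemma nonunit_max_ideal (a : A) : ~ is_unit a ->
  exists2 J : idealr A, maximal_ideal J & a \in J.
Proof.
move=> na; pose T := {I : A -> Prop | [/\ ideal I, ~ I 1 & I a]}.
pose I0 b := exists c, c * a = b.
have I0P : [/\ ideal I0, ~ I0 1 & I0 a].
  split=> //; last by exists 1; rewrite mul1r.
  split; first by exists 0; rewrite mul0r.
    by move=> _ _ [c <-] [d <-]; exists (c + d); rewrite mulrDl.
  by move=> b _ [c <-]; exists (b * c); rewrite mulrA.
pose r (x y : T) := forall b, sval x b -> sval y b.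
have [|||I Imax] := @ZL_preorder T (exist _ I0 I0P) (fun x y => `[< r x y >]).
- by move=> x; apply/asboolP.
- by move=> y x z /asboolP xy /asboolP yz; apply/asboolP => b /xy/yz.
- move=> C totC.
  have [[x0 Cx0]|C0] := pselect (exists x, C x); last first.
    by exists (exist _ I0 I0P) => x Cx; case: C0; exists x.
  pose U b := exists2 x, C x & sval x b.
  have UP : [/\ ideal U, ~ U 1 & U a].
    split; last by exists x0 => //; have [] := svalP x0.
      split; first by exists x0 => //; have [/ideal0] := svalP x0.
        move=> u v [x Cx xu] [y Cy yv].
        have [ix _ _] := svalP x; have [iy _ _] := svalP y.
        have [/asboolP xy|/asboolP xy] := totC x y Cx Cy.
          by exists y => //; apply: (idealD iy) => //; apply: xy.
        by exists x => //; apply: (idealD ix) => //; apply: xy.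
      by move=> b u [x Cx xu]; exists x => //; have [ix _ _] := svalP x; apply: (idealM ix).
    by move=> [x _]; have [] := svalP x.
  by exists (exist _ U UP) => x Cx; apply/asboolP => b xb; exists x.
have [iI I1 Ia] := svalP I; have [J JI] := ideal_idealrE iI I1.
exists J; last exact/JI.
move=> K JK b Kb; apply/JI.
have KP : [/\ ideal (fun b => b \in K), ~ 1 \in K & a \in K].
  by split; [exact: ideal_idealr | rewrite idealr1 | apply/JK/JI].
have /Imax/asboolP : `[< r I (exist _ _ KP) >] by apply/asboolP => c /JI/JK.
by apply.
Qed.

Hypothesis Am : local_ring m.

Lemma local_unit a : a \notin m -> is_unit a.
Proof.
move=> ma; apply: contrapT => /nonunit_max_ideal[J Jmax Ja].
by move: ma; rewrite -(Am.2 _ Jmax a) Ja.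
Qed.

Lemma local_nonunit a : a \in m -> ~ is_unit a.
Proof. by move=> ma /(unit_ideal (ideal_idealr m))/(_ ma); rewrite idealr1. Qed.

Lemma local_unit1 a : a \in m -> is_unit (1 - a).
Proof.
move=> ma; apply: local_unit; apply/negP => m1a.
by have := rpredD m1a ma; rewrite subrK idealr1.
Qed.

Lemma proper_sub_max (I : A -> Prop) a : ideal I -> ~ I 1 -> I a -> a \in m.
Proof.
by move=> iI I1 Ia; apply/negP => /negP/local_unit u; apply: I1; apply: unit_ideal Ia.
Qed.

Lemma max_ideal_prime : prime_ideal (fun a => a \in m).
Proof.
split; [exact: ideal_idealr | by rewrite idealr1 | move=> a b mab].
have [am|/negP am] := boolP (a \in m); [by left | right].
have [v va] := local_unit (introN idP am).
by rewrite -[b]mul1r -va -mulrA idealMr.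
Qed.

End LocalRings.

(* A maximal ideal among those containing no power of [m] is prime. *)
Lemma prime_no_power (A : comNzRingType) (m : idealr A) (I : A -> Prop) :
  noeth A -> ideal I -> (forall N, ~ forall a, ideal_pow m N a -> I a) ->
  exists P, [/\ prime_ideal P, (forall a, I a -> P a) &
    forall N, ~ forall a, ideal_pow m N a -> P a].
Proof.
move=> nA iI Im.
pose F J := ideal J /\ forall N, ~ forall a, ideal_pow m N a -> J a.
have [P [[iP Pm] IP Pmax]] : exists P, [/\ F P, (forall a, I a -> P a) &
    forall J, F J -> (forall a, P a -> J a) -> forall a, J a -> P a].
  by apply: noeth_max => // J [].
exists P; split=> //; split=> //.
  by move=> P1; apply: (Pm 0%N) => a _; rewrite -[a]mulr1; apply: idealM.
move=> a b Pab; apply: contrapT => /not_orP[nPa nPb].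
have key c : ~ P c -> exists N, forall z, ideal_pow m N z ->
    exists d, P (z - d * c).
  move=> nPc; pose J z := exists d, P (z - d * c).
  have iJ : ideal J.
    split; first by exists 0; rewrite mul0r subrr; exact: ideal0.
      move=> u v [d Pd] [e Pe]; exists (d + e).
      by rewrite mulrDl opprD addrACA; apply: idealD.
    by move=> e u [d Pd]; exists (e * d); rewrite -mulrA -mulrBr; apply: idealM.
  apply: contrapT => nN; apply: nPc; apply: (Pmax J).
  - by split=> // N JN; apply: nN; exists N.
  - by move=> z Pz; exists 0; rewrite mul0r subr0.
  - by exists 1; rewrite mul1r subrr; exact: ideal0.
have [N aN] := key a nPa; have [M bM] := key b nPb.
apply: (Pm (N + M)%N); apply: pow_min => // z w /aN[d Pd] /bM[e Pe].
have -> : z * w = w * (z - d * a) + d * a * (w - e * b) + d * e * (a * b) by ring.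
apply: idealD => //; last exact: idealM.
by apply: idealD => //; apply: idealM.
Qed.

(** * The Rees algebra *)

Section Rees.
Variables (A : comNzRingType) (m : idealr A).
Local Notation pw := (@ideal_pow A m).
Hypothesis nA : noeth A.

(* The Rees algebra [\sum_n m ^ n X ^ n] is the image of a Noetherian ring. *)
Lemma rees_noeth : exists (B : comNzRingType) (phi : {rmorphism B -> {poly A}}),
  [/\ noeth B, (forall b n, pw n (phi b)`_n) &
    forall n a, pw n a -> exists b, phi b = a *: 'X^n].
Proof.
have [s [ms gen]] := nA (ideal_idealr m).
pose ts : seq {poly A} := map (fun a : A => a *: 'X) s.
have [B [phi [nB phic phit Pphi]]] :=
  @fg_algebra_noeth A {poly A} (polyC : {rmorphism A -> {poly A}}) ts nA.
exists B, phi; split=> //.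
  move=> b n; move: n; apply: (Pphi (fun p : {poly A} => forall n, pw n p`_n)).
  - move=> a n; rewrite coefC; case: eqP => [->|_] //.
    exact: (ideal0 (pow_ideal m n)).
  - move=> _ /mapP[a /ms ma ->] n; rewrite coefZ coefX.
    case: eqP => [->|_]; rewrite ?mulr1 ?mulr0; first exact/pow1P.
    exact: (ideal0 (pow_ideal m n)).
  - by move=> p q Pp Pq n; rewrite coefD; apply: (idealD (pow_ideal m n)).
  - move=> p q Pp Pq n; rewrite coefM; apply: (ideal_sum _ (pow_ideal m n)) => i _.
    by rewrite -{1}(subnKC (ltn_ord i : (i <= n)%N)); apply: powM.
have iI n : ideal (fun a : A => exists b, phi b = a *: 'X^n).
  split; first by exists 0; rewrite rmorph0 scale0r.
    by move=> u v [b e] [c f]; exists (b + c); rewrite rmorphD e f scalerDl.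
  move=> a u [b e]; have [c f] := phic a; exists (c * b).
  by rewrite rmorphM e f /= mul_polyC scalerA.
elim=> [|n IHn] a.
  by move=> _; have [b e] := phic a; exists b; rewrite e expr0 alg_polyC.
rewrite -[n.+1]add1n; move: a; apply: pow_min; first exact: iI.
move=> a b /pow1P/gen ma /IHn[c ec].
have [d ed] : exists d, phi d = a *: 'X^1.
  apply: (spanned_sub (iI 1%N) _ ma) => x xs.
  have [|e ee] := phit (x *: 'X); first exact: (map_f (fun a : A => a *: 'X)).
  by exists e; rewrite ee expr1.
exists (d * c).
by rewrite rmorphM ec ed -scalerAl -scalerAr scalerA -exprD.
Qed.

(** In the Rees algebra the elements with all coefficients in [y A + I] form an ideal with finitely
    many generators, of degrees below [k]. A combination of them has its coefficient of degree
    [n + k] in [y m ^ n + I], and [y] can be cancelled modulo [I]. *)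
Lemma artin_rees_regular (I : A -> Prop) y : ideal I -> (forall a, I (y * a) -> I a) ->
  exists k, forall n a i, I i -> pw (n + k) (y * a - i) -> exists2 j, I j & pw n (a - j).
Proof.
move=> iI yreg; have [B [phi [nB phiP pwphi]]] := rees_noeth.
have iJ : ideal (fun b => forall n, exists a, I ((phi b)`_n - y * a)).
  split; first by exists 0; rewrite rmorph0 coef0 mulr0 subrr; exact: ideal0.
    move=> u v uy vy n; have [a e] := uy n; have [c f] := vy n.
    exists (a + c); rewrite rmorphD coefD mulrDr opprD addrACA; exact: idealD.
  move=> a u /choice[g gP] n; exists (\sum_(j < n.+1) (phi a)`_j * g (n - j)%N).
  rewrite rmorphM coefM mulr_sumr -sumrB; apply: ideal_sum => // j _.
  by rewrite mulrCA -mulrBr; apply: idealM.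
have [s [sJ gen]] := nB _ iJ.
pose k := \max_(b <- s) size (phi b).
exists k => n a i Ii nka; have [b eb] := pwphi _ _ nka.
have sb : spanned s b.
  apply: gen => l; rewrite eb coefZ coefXn; case: eqP => _.
    by exists a; rewrite mulr1 addrAC subrr add0r; apply: idealN.
  by exists 0; rewrite !mulr0 subrr; exact: ideal0.
(* Truncated subtraction is intended: in degrees [N <= k] the order of [w] is unconstrained, and in
   higher degrees the generators have no coefficient. *)
pose Q b := forall N, exists w, pw (N - k) w /\ I ((phi b)`_N - y * w).
have iQ : ideal Q.
  split.
  - move=> N; exists 0; rewrite rmorph0 coef0 mulr0 subrr; split; last exact: ideal0.
    exact: (ideal0 (pow_ideal m _)).
  - move=> u v uQ vQ N; have [w [Nw ew]] := uQ N; have [x [Nx ex]] := vQ N.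
    exists (w + x); rewrite rmorphD coefD mulrDr opprD addrACA; split; last exact: idealD.
    exact: (idealD (pow_ideal m _)).
  - move=> c u /choice[g gP] N.
    exists (\sum_(j < N.+1) (phi c)`_j * g (N - j)%N); split; last first.
      rewrite rmorphM coefM mulr_sumr -sumrB; apply: ideal_sum => // j _.
      by have [_ Ig] := gP (N - j)%N; rewrite mulrCA -mulrBr; apply: idealM.
    apply: (ideal_sum _ (pow_ideal m _)) => j _.
    apply: (@pow_leq _ _ _ (j + (N - j - k))); first by lia.
    by apply: powM; [exact: phiP | have [] := gP (N - j)%N].
have /(_ (n + k)%N)[w [nw]] : Q b.
  apply: (spanned_sub iQ _ sb) => c cs N; have [w ew] := sJ c cs N.
  have [Nk|kN] := leqP N k.
    by exists w; split=> //; have -> : (N - k = 0)%N by lia.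
  have szc : (size (phi c) <= k)%N by rewrite /k (big_rem c) //= leq_maxl.
  exists 0; rewrite mulr0 subr0 nth_default; last by apply: leq_trans (ltnW kN).
  by split; [exact: (ideal0 (pow_ideal m _)) | exact: ideal0].
rewrite addnK in nw; rewrite eb coefZ coefXn eqxx mulr1 => Iw.
exists (a - w); last by rewrite subKr.
apply: yreg; rewrite mulrBr -(subrK i (y * a)) addrAC; exact: idealD.
Qed.

(* If [mu_n] in [m ^ n] is congruent to [z] modulo [I], then the forms
   [mu_n X ^ n] of the Rees algebra satisfy a relation
   [mu_N = \sum_(n < N) b_n mu_n] with [b_n] in [m], so that [z] is in [I + m z]. *)
Theorem krull_intersection (I : A -> Prop) z : local_ring m -> ideal I ->
  (forall n, exists a, pw n a /\ I (z - a)) -> I z.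
Proof.
move=> Am iI zI; have [B [phi [nB phiP pwphi]]] := rees_noeth.
pose X b := exists n a, [/\ pw n a, I (z - a) & phi b = a *: 'X^n].
have [s [sX gen]] := noeth_subset X nB.
have [N sN] : exists N, forall b, b \in s -> exists n a,
    [/\ (n < N)%N, pw n a, I (z - a) & phi b = a *: 'X^n].
  elim: s sX {gen} => [|x s IHs] sX; first by exists 0%N.
  have [|N sN] := IHs; first by move=> y ys; apply: sX; rewrite inE ys orbT.
  have [|n [a [na Ia ex]]] := sX x; first by rewrite inE eqxx.
  exists (maxn N n.+1) => y; rewrite inE => /orP[/eqP ->|/sN[l [c [lN lc Ic ec]]]].
    by exists n, a; rewrite leq_max ltnSn orbT.
  by exists l, c; rewrite leq_max lN.
have [a [Na Ia]] := zI N; have [b eb] := pwphi _ _ Na.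
have sb : spanned s b by apply: gen; exists N, a.
have [d [md Id]] : exists d, d \in m /\ I ((phi b)`_N - d * z).
  move: b sb {eb}; apply: lincomb_ind.
  - by exists 0; rewrite rmorph0 coef0 mul0r subr0 idealr0; split=> //; exact: ideal0.
  - move=> u v [d [md Id]] [e [me Ie]]; exists (d + e); rewrite rpredD //; split=> //.
    by rewrite rmorphD coefD mulrDl opprD addrACA; apply: idealD.
  - move=> x c /sN[n [e [nN ne Ie ex]]] _; exists ((phi c)`_(N - n)); split.
      by apply/pow1P; apply: pow_leq (phiP c (N - n)%N); lia.
    rewrite rmorphM ex -scalerAr coefZ coefMXn ltnNge (ltnW nN) /= mulrC -mulrBr.
    by apply: idealM => //; rewrite -opprB; apply: idealN.
rewrite eb coefZ coefXn eqxx mulr1 in Id.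
have [v v1] := local_unit1 Am md.
have -> : z = v * (z - a + (a - d * z)).
  by rewrite addrA subrK -[X in X - _]mul1r -mulrBl mulrA v1 mul1r.
by apply: idealM => //; apply: idealD.
Qed.

End Rees.

(** * Adic completions *)

Section Completion.
Variables (A : comNzRingType) (m : idealr A).
Local Notation pw := (@ideal_pow A m).
Local Notation C := (completion m).
Local Notation iota := (completion_map m).

Lemma adic_pi_eq0 k (a : A) : (adic_pi m k a = 0) <-> pw k.+1 a.
Proof.
rewrite -[0](rmorph0 (adic_pi m k)); split=> [/eqP|Ia].
  by rewrite -Quotient.idealrBE subr0.
by apply/eqP; rewrite -Quotient.idealrBE subr0.
Qed.

(* [fil n] is the kernel of the projection to [A / m ^ n]. *)
Definition fil (n : nat) (z : C) : Prop :=
  if n is n'.+1 then completion_val z n' = 0 else True.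

Lemma completion_valB (z w : C) n :
  completion_val (z - w) n = completion_val z n - completion_val w n.
Proof. by []. Qed.

Lemma completion_valM (z w : C) n :
  completion_val (z * w) n = completion_val z n * completion_val w n.
Proof. by []. Qed.

Lemma fil_ideal n : ideal (fil n).
Proof.
case: n => [|n]; first by split.
split=> [//|u v uE vE|a u uE].
  by rewrite /fil -[LHS]/(completion_val u n + completion_val v n) uE vE addr0.
by rewrite /fil completion_valM uE mulr0.
Qed.

Lemma fil_iota n a : fil n (iota a) <-> pw n a.
Proof. by case: n => [|n] //; exact: adic_pi_eq0. Qed.

Lemma fil_dense n (z : C) : exists a, fil n (z - iota a).
Proof.
case: n => [|n]; first by exists 0.
have [a ea] := adic_piK (completion_val z n); exists a.
by rewrite /fil completion_valB -ea subrr.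
Qed.

Lemma fil_leq n k z : (n <= k)%N -> fil k z -> fil n z.
Proof.
move=> /subnK <-; elim: (k - n)%N => // l IHl; rewrite addSn => fz; apply: IHl.
move: fz; case: (l + n)%N => //= p zp.
have /asboolP/(_ p 0) := valP z; rewrite !rmorph0 => ->//.
Qed.

Lemma fil_sep z : (forall n, fil n z) -> z = 0.
Proof.
move=> fz; apply: val_inj; apply: functional_extensionality_dep => n.
exact: (fz n.+1).
Qed.

Lemma fil_eq z w : (forall n, fil n (z - w)) -> z = w.
Proof. by move=> /fil_sep/eqP; rewrite subr_eq0 => /eqP. Qed.

Lemma fil_complete (u : nat -> C) : (forall n, fil n (u n.+1 - u n)) ->
  exists z, forall n, fil n (z - u n).
Proof.
move=> uC; pose z0 : seq_prod (adic_quot m) := fun n => completion_val (u n.+1) n.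
have z0C : z0 \in @compatible A m.
  apply/asboolP => n a ea.
  have /asboolP/(_ n a ea) -> := valP (u n.+2).
  have := uC n.+1; rewrite /fil completion_valB /z0 => /eqP.
  by rewrite subr_eq0 => /eqP.
exists (Completion z0C) => -[|n] //.
by rewrite /fil completion_valB /= /z0 subrr.
Qed.

Lemma filM n k z w : fil n z -> fil k w -> fil (n + k) (z * w).
Proof.
move=> nz kw.
have [a za] := fil_dense (n + k) z; have [b wb] := fil_dense (n + k) w.
have na : pw n a.
  apply/fil_iota; rewrite -(subKr z (iota a)); apply: (idealB (fil_ideal n)) => //.
  by apply: fil_leq za; apply: leq_addr.
have kb : pw k b.
  apply/fil_iota; rewrite -(subKr w (iota b)); apply: (idealB (fil_ideal k)) => //.
  by apply: fil_leq wb; apply: leq_addl.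
have -> : z * w = w * (z - iota a) + iota a * (w - iota b) + iota (a * b).
  by rewrite rmorphM; ring.
apply: (idealD (fil_ideal _)); last by apply/fil_iota/powM.
by apply: (idealD (fil_ideal _)); apply: (idealM (fil_ideal _)).
Qed.

Lemma filX n z : fil 1 z -> fil n (z ^+ n).
Proof. by move=> z1; elim: n => // n IHn; rewrite exprS -add1n; apply: filM. Qed.

Lemma fil1_unit z : fil 1 z -> is_unit (1 - z).
Proof.
move=> z1; have [n|v vP] := fil_complete (u := fun n => \sum_(k < n) z ^+ k).
  by rewrite big_ord_recr addrAC subrr add0r; apply: filX.
exists v; apply: fil_eq => n.
have e : (1 - z) * \sum_(k < n) z ^+ k = 1 - z ^+ n.
  by rewrite -[RHS]opprB subrX1 -mulNr opprB.
have -> : v * (1 - z) - 1 = (1 - z) * (v - \sum_(k < n) z ^+ k) - z ^+ n.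
  by rewrite [X in _ = X - _]mulrBr e; ring.
apply: (idealB (fil_ideal n)); last exact: filX.
exact: (idealM (fil_ideal n)).
Qed.

(** The coefficients of each fixed [x] in [s] tend to zero, so they can be summed in the completion,
    one [x] at a time. *)
Lemma lincomb_fil_series K (s : seq C) (w : nat -> C) :
  (forall n, lincomb (fil (n - K)) s (w n)) ->
  exists2 y, spanned s y & forall n, fil (n - K) (y - \sum_(k < n) w k).
Proof.
elim: s w => [|x s IHs] w sw.
  exists 0 => // n; rewrite big1 => [|i _]; last exact: sw.
  by rewrite subrr; apply: (ideal0 (fil_ideal _)).
have /choice[c cP] : forall n, exists c, fil (n - K) c /\
  lincomb (fil (n - K)) s (w n - c * x) by move=> n; apply: (sw n).
have [|y sy yP] := IHs (fun n => w n - c n * x); first by move=> n; have [] := cP n.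
have [|c0 c0P] := fil_complete (u := fun n => \sum_(k < n + K) c k).
  move=> n; rewrite addSn big_ord_recr addrAC subrr add0r.
  by have [] := cP (n + K)%N; rewrite addnK.
exists (y + c0 * x); first by exists c0; rewrite addrK.
move=> n.
have -> : y + c0 * x - \sum_(k < n) w k =
    (y - \sum_(k < n) (w k - c k * x)) + x * (c0 - \sum_(k < n) c k).
  by rewrite sumrB -mulr_suml; ring.
apply: (idealD (fil_ideal _)) => //; apply: (idealM (fil_ideal _)).
have [Kn|nK] := leqP K n; first by have := c0P (n - K)%N; rewrite subnK.
by have -> : (n - K = 0)%N by lia.
Qed.

(** Successive approximation: the corrections [w] have coefficients tending to zero, so their sum is
    again a combination of [s]. A fixed loss [K] in the order of the coefficients is harmless. *)
Lemma spanned_approx K (s : seq C) (Q : C -> Prop) :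
  (forall n z, Q z -> fil n z ->
    exists w, [/\ lincomb (fil (n - K)) s w, fil n.+1 (z - w) & Q (z - w)]) ->
  forall z, Q z -> spanned s z.
Proof.
move=> step z Qz.
have [||u [u0 uP]] := @dependent_choice _ (fun n z => Q z /\ fil n z)
    (fun n z z' => lincomb (fil (n - K)) s (z - z')) z.
- by [].
- move=> n x [Qx nx]; have [w [sw nw Qw]] := step n x Qx nx.
  by exists (x - w); rewrite subKr.
have [y sy yP] := lincomb_fil_series (w := fun n => u n - u n.+1)
  (fun n => (uP n).2).
suff -> : z = y by [].
have tele n : \sum_(k < n) (u k - u k.+1) = z - u n.
  rewrite -u0; elim: n => [|n IHn]; first by rewrite big_ord0 subrr.
  by rewrite big_ord_recr /= IHn; ring.
apply: fil_eq => n; rewrite -opprB; apply: (idealN (fil_ideal n)).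
have := yP (n + K)%N; rewrite addnK tele => /(idealB (fil_ideal n)).
move=> /(_ (u (n + K)%N)); rewrite opprB addrA addrAC addrK; apply.
by apply: fil_leq (uP (n + K)%N).1.2; apply: leq_addr.
Qed.

Definition adic_closure (J : C -> Prop) (z : C) := forall n, exists2 j, J j & fil n (z - j).

(** For [l >= n], an element of [m ^ l = m ^ (l - n) * m ^ n] is a combination of [s] with
    coefficients in [m ^ (l - n)], so the approximation converges. Thus [fil n] lies in the
    extension of [m ^ n]. *)
Lemma fil_pow n z : fil n z -> forall s, (forall a, pw n a -> spanned s a) ->
  spanned (map iota s) z.
Proof.
move=> nz s gen; move: z nz; apply: (spanned_approx (K := n)) => l z nz lz.
have [ln|nl] := ltnP l n.
  exists 0; rewrite subr0; split=> //; last by apply: fil_leq nz.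
  by apply: lincomb0; apply: (ideal0 (fil_ideal _)).
have [a za] := fil_dense l.+1 z; exists (iota a).
have la k : (k <= l.+1)%N -> fil k z -> fil k (iota a).
  move=> kl kz; rewrite -(subKr z (iota a)); apply: (idealB (fil_ideal _)) => //.
  exact: fil_leq za.
split=> //; last by apply: (idealB (fil_ideal _)) => //; apply: la; rewrite // ltnW.
have {la za} : pw (l - n + n) a.
  by rewrite subnK //; apply/fil_iota/la.
pose I a := lincomb (fil (l - n)) (map iota s) (iota a).
apply: (@pow_min _ _ _ I).
  split.
  - by rewrite /I rmorph0; apply: lincomb0; apply: (ideal0 (fil_ideal _)).
  - move=> u v; rewrite /I rmorphD; apply: lincombD.
    by move=> c d; apply: (idealD (fil_ideal _)).
  - move=> b u; rewrite /I rmorphM; apply: lincombM.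
    by move=> c; apply: (idealM (fil_ideal _)).
move=> b c lb /gen; rewrite /I; move: c; apply: lincomb_ind.
- by rewrite mulr0 rmorph0; apply: lincomb0; apply: (ideal0 (fil_ideal _)).
- move=> u v su sv; rewrite mulrDr rmorphD; apply: lincombD => //.
  by move=> c d; apply: (idealD (fil_ideal _)).
- move=> x c xs _; rewrite mulrA rmorphM; apply: lincomb_mem; last first.
    by apply/fil_iota; rewrite mulrC; apply: (idealM (pow_ideal _ _)).
  by apply: map_f.
  by apply: (ideal0 (fil_ideal _)).
Qed.

Lemma fil_sub n (J : C -> Prop) : noeth A -> ideal J ->
  (forall a, pw n a -> J (iota a)) -> forall z, fil n z -> J z.
Proof.
move=> nA iJ nJ z /fil_pow nz; have [s [sn gen]] := nA _ (pow_ideal m n).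
apply: (spanned_sub iJ _ (nz s gen)) => _ /mapP[a /sn/nJ Ja ->] //.
Qed.

(* Generators are obtained by lifting generators of the ideal of initial forms in
   the Rees algebra. *)
Theorem closure_spanned (J : C -> Prop) : noeth A -> ideal J ->
  exists s, (forall x, x \in s -> J x) /\ forall z, adic_closure J z -> spanned s z.
Proof.
move=> nA iJ; have [B [phi [nB phiP pwphi]]] := rees_noeth m nA.
pose init b := forall n, exists j, J j /\ fil n.+1 (iota (phi b)`_n - j).
have iI : ideal init.
  split.
  - move=> n; exists 0; rewrite rmorph0 coef0 rmorph0 subrr; split; first exact: ideal0.
    exact: (ideal0 (fil_ideal n.+1)).
  - move=> u v uI vI n; have [j [Jj uj]] := uI n; have [l [Jl vl]] := vI n.
    exists (j + l); split; first exact: idealD.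
    by rewrite rmorphD coefD rmorphD opprD addrACA; apply: (idealD (fil_ideal n.+1)).
  - move=> a u /choice[j jP] n.
    exists (\sum_(k < n.+1) iota (phi a)`_k * j (n - k)%N); split.
      by apply: ideal_sum => // k _; apply: idealM => //; have [] := jP (n - k)%N.
    rewrite rmorphM coefM rmorph_sum -sumrB; apply: (ideal_sum _ (fil_ideal n.+1)) => k _.
    rewrite rmorphM -mulrBr; apply: (@fil_leq _ (k + (n - k).+1)); first by lia.
    by apply: filM; [apply/fil_iota/phiP | have [] := jP (n - k)%N].
have [t [tI gen]] := nB _ iI.
have [g gP] : exists g : B -> nat -> C, forall b, b \in t -> forall n,
    J (g b n) /\ fil n.+1 (iota (phi b)`_n - g b n).
  suff /choice[g gP] : forall z : B * nat, exists j, z.1 \in t ->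
      J j /\ fil z.2.+1 (iota (phi z.1)`_z.2 - j).
    by exists (fun b n => g (b, n)) => b bt n; apply: (gP (b, n)).
  move=> [b n] /=; have [bt|bt] := boolP (b \in t); last by exists 0.
  by have [j] := tI b bt n; exists j.
pose k := \max_(b <- t) size (phi b).
pose s := [seq g b l | b <- t, l <- index_iota 0 k].
have sJ x : x \in s -> J x.
  by move=> /allpairsP[[b l] /= [bt _ ->]]; have [] := gP b bt l.
exists s; split=> //; apply: (spanned_approx (K := k)) => n z zJ nz.
have [a za] := fil_dense n.+1 z.
have na : pw n a.
  apply/fil_iota; rewrite -(subKr z (iota a)); apply: (idealB (fil_ideal _)) => //.
  exact: fil_leq za.
have [b eb] := pwphi _ _ na.
have tb : spanned t b.
  apply: gen => l; rewrite eb coefZ coefXn; case: eqP => [->|_]; last first.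
    exists 0; rewrite mulr0 rmorph0 subrr; split; first exact: ideal0.
    exact: (ideal0 (fil_ideal l.+1)).
  have [j Jj zj] := zJ n.+1; exists j; split=> //; rewrite mulr1.
  have -> : iota a - j = z - j - (z - iota a) by ring.
  exact: (idealB (fil_ideal n.+1)).
have [w [sw bw]] : exists w, lincomb (fil (n - k)) s w /\
    fil n.+1 (iota (phi b)`_n - w).
  move: b tb {eb}; apply: lincomb_ind.
  - exists 0; rewrite rmorph0 coef0 rmorph0 subrr; split.
      by apply: lincomb0; apply: (ideal0 (fil_ideal _)).
    exact: (ideal0 (fil_ideal n.+1)).
  - move=> u v [w [sw uw]] [y [sy vy]]; exists (w + y); split.
      by apply: lincombD => // c d; apply: (idealD (fil_ideal _)).
    by rewrite rmorphD coefD rmorphD opprD addrACA; apply: (idealD (fil_ideal n.+1)).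
  - move=> x c xt _.
    have szx : (size (phi x) <= k)%N by rewrite /k (big_rem x) //= leq_maxl.
    exists (\sum_(l < n.+1) iota (phi c)`_(n - l) * (if (l < k)%N then g x l else 0)).
    split.
      apply: lincomb_sum => [||l _]; first exact: (ideal0 (fil_ideal _)).
      - by move=> d e; apply: (idealD (fil_ideal _)).
      - case: ifP => lk; last by rewrite mulr0; apply: lincomb0; apply: (ideal0 (fil_ideal _)).
        apply: lincomb_mem; first exact: (ideal0 (fil_ideal _)).
          by apply/allpairsP; exists (x, l : nat); rewrite /= mem_index_iota.
        by apply/fil_iota; apply: pow_leq (phiP c _); lia.
    rewrite rmorphM coefMr rmorph_sum -sumrB; apply: (ideal_sum _ (fil_ideal n.+1)) => l _.
    rewrite rmorphM -mulrBr; case: ifP => lk; last first.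
      rewrite [(phi x)`_l]nth_default ?rmorph0 ?subrr ?mulr0.
        exact: (ideal0 (fil_ideal n.+1)).
      by apply: leq_trans szx _; rewrite leqNgt lk.
    apply: (@fil_leq _ ((n - l) + l.+1)); first by lia.
    by apply: filM; [apply/fil_iota/phiP | have [] := gP x xt l].
exists w; split=> //.
  have -> : z - w = z - iota a + (iota a - w) by ring.
  apply: (idealD (fil_ideal n.+1)) => //.
  by move: bw; rewrite eb coefZ coefXn eqxx mulr1.
have Jw : J w.
  move: sw; apply: lincomb_ind; [exact: ideal0 | exact: idealD | move=> x c /sJ Jx _].
  exact: idealM.
move=> l; have [j Jj zj] := zJ l; exists (j - w); first exact: idealB.
by have -> : z - w - (j - w) = z - j by ring.
Qed.

(** The generators of the closure were chosen in [J] itself. Hence membership in an ideal of the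
    completion may be tested modulo every [fil n]. *)
Lemma closureE (J : C -> Prop) z : noeth A -> ideal J -> adic_closure J z -> J z.
Proof.
move=> nA iJ; have [s [sJ gen]] := closure_spanned nA iJ.
by move=> /gen; apply: spanned_sub.
Qed.

Lemma completion_noeth : noeth A -> noeth C.
Proof.
move=> nA J iJ; have [s [sJ gen]] := closure_spanned nA iJ.
exists s; split=> // z Jz; apply: gen => n; exists z => //.
by rewrite subrr; apply: (ideal0 (fil_ideal n)).
Qed.

(** By Artin-Rees, an approximation of [y * z] in [I] modulo [m ^ (n + k)] yields one of [z] modulo
    [m ^ n]. This takes the place of flatness: an element regular modulo [I] stays regular modulo
    the closure of [I] in the completion. *)
Lemma closure_regular (I : A -> Prop) y z : noeth A -> ideal I ->
  (forall a, I (y * a) -> I a) ->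
  (forall n, exists2 i, I i & fil n (iota y * z - iota i)) ->
  forall n, exists2 i, I i & fil n (z - iota i).
Proof.
move=> nA iI /(artin_rees_regular m nA iI)[k kP] yz n.
have [a za] := fil_dense (n + k) z; have [i Ii yzi] := yz (n + k)%N.
have [|j Ij /fil_iota naj] := kP n a i Ii.
  apply/fil_iota; rewrite rmorphB rmorphM.
  have -> : iota y * iota a - iota i = iota y * z - iota i - iota y * (z - iota a) by ring.
  apply: (idealB (fil_ideal _)) => //; exact: (idealM (fil_ideal _)).
exists j => //; have -> : z - iota j = z - iota a + (iota a - iota j) by ring.
apply: (idealD (fil_ideal n)); last by rewrite -rmorphB.
by apply: fil_leq za; apply: leq_addr.
Qed.

Lemma iota_regular y : noeth A -> (forall a, y * a = 0 -> a = 0) ->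
  forall z, iota y * z = 0 -> z = 0.
Proof.
move=> nA yreg z yz; have i0 : ideal (fun a : A => a = 0).
  by split=> [//|u v -> ->|a u ->]; rewrite ?addr0 ?mulr0.
apply: fil_sep => n; have [|i -> zi] := closure_regular nA i0 yreg (z := z) _ n.
  by move=> k; exists 0; rewrite // yz rmorph0 subrr; exact: (ideal0 (fil_ideal k)).
by rewrite -[z]subr0 -(rmorph0 iota).
Qed.

Section Local.
Hypotheses (nA : noeth A) (Am : local_ring m).

Lemma iota_unit a : is_unit a -> is_unit (iota a).
Proof. by move=> [v va]; exists (iota v); rewrite -rmorphM va rmorph1. Qed.

Lemma is_unitM (B : comNzRingType) (u v : B) : is_unit u -> is_unit v -> is_unit (u * v).
Proof. by move=> [u' eu] [v' ev]; exists (u' * v'); rewrite mulrACA eu ev mulr1. Qed.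

Lemma completion_unit (z : C) : ~ fil 1 z -> is_unit z.
Proof.
move=> nz; have [a za] := fil_dense 1 z.
have ma : a \notin m.
  apply/negP => /pow1P/fil_iota fa; apply: nz.
  by rewrite -(subrK (iota a) z); apply: (idealD (fil_ideal 1)).
have [v va] := local_unit Am ma.
have -> : z = iota a * (1 - iota v * (iota a - z)).
  by rewrite mulrBr mulr1 mulrA -rmorphM [a * v]mulrC va rmorph1 mul1r; ring.
apply: is_unitM; first by apply: iota_unit; exists v.
apply: fil1_unit; apply: (idealM (fil_ideal 1)).
by rewrite -opprB; apply: (idealN (fil_ideal 1)).
Qed.

Lemma completion_idem (e : C) : e * (1 - e) = 0 -> e = 0 \/ e = 1.
Proof.
move=> e0; have [e1|/completion_unit[v ve]] := pselect (fil 1 e).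
  have [v ve] := fil1_unit e1; left.
  by rewrite -[e]mul1r -ve -mulrA [_ * e]mulrC e0 mulr0.
have : 1 - e = v * (e * (1 - e)) by rewrite mulrA ve mul1r.
by rewrite e0 mulr0 => /eqP; rewrite subr_eq0 => /eqP ->; right.
Qed.

(** Krull's intersection theorem modulo [I]. In the role of faithful flatness, it descends
    membership and divisibility from the completion to [A]. *)
Lemma contraction (I : A -> Prop) (a : A) : ideal I ->
  (forall n, exists2 j, I j & fil n (iota a - iota j)) -> I a.
Proof.
move=> iI aI; apply: (krull_intersection nA Am iI) => n.
have [j Ij aj] := aI n; exists (a - j); rewrite subKr; split=> //.
by apply/fil_iota; rewrite rmorphB.
Qed.

Lemma iota_dvd (a y : A) (z : C) : iota a = iota y * z -> exists b, a = y * b.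
Proof.
move=> ayz; apply: (@contraction (fun a => exists b, a = y * b)).
  split; first by exists 0; rewrite mulr0.
    by move=> _ _ [u ->] [v ->]; exists (u + v); rewrite mulrDr.
  by move=> c _ [u ->]; exists (c * u); rewrite mulrCA.
move=> n; have [b zb] := fil_dense n z; exists (y * b); first by exists b.
by rewrite ayz rmorphM -mulrBr; apply: (idealM (fil_ideal n)).
Qed.

End Local.
End Completion.

(** * Completion of a surjective homomorphism *)

Section CompletionMap.
Variables (A B : comNzRingType) (f : {rmorphism A -> B}).
Variables (m : idealr A) (n : idealr B).
Hypothesis fsurj : forall b, exists a, f a = b.
Hypothesis fm : forall a, (f a \in n) = (a \in m).
Local Notation iA := (completion_map m).
Local Notation iB := (completion_map n).
Let idA := @fil_ideal A m.
Let idB := @fil_ideal B n.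

(** The map is built from its graph [r]: [z] and [w] correspond when at every level they have a
    common approximation [a] in [A]. For surjectivity the approximations are corrected step by step,
    a difference in [n ^ k] being lifted to [m ^ k] so that they converge. *)
Lemma completion_lift : exists psi : completion m -> completion n,
  [/\ forall z w, psi (z - w) = psi z - psi w,
      forall z w, psi (z * w) = psi z * psi w,
      forall a, psi (iA a) = iB (f a),
      forall w, exists z, psi z = w &
      forall z, psi z = 0 <-> adic_closure (fun w => exists2 a, f a = 0 & w = iA a) z].
Proof.
have powf k a : ideal_pow m k a -> ideal_pow n k (f a).
  by apply: pow_map => b; rewrite fm.
have powl k b : ideal_pow n k b -> exists2 a, ideal_pow m k a & f a = b.
  apply: (pow_map_surj fsurj) => c nc.
  by have [a ea] := fsurj c; exists a => //; rewrite -fm ea.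
pose r (z : completion m) (w : completion n) := forall k, exists a,
  fil k (z - iA a) /\ fil k (w - iB (f a)).
have runiq z w w' : r z w -> r z w' -> w = w'.
  move=> rw rw'; apply: fil_eq => k; have [a [za wa]] := rw k; have [b [zb wb]] := rw' k.
  have -> : w - w' = w - iB (f a) - (w' - iB (f b)) + iB (f (a - b)).
    by rewrite !rmorphB; ring.
  apply: (idealD (idB k)); first exact: (idealB (idB k)).
  apply/fil_iota/powf/fil_iota; rewrite rmorphB.
  have -> : iA a - iA b = z - iA b - (z - iA a) by ring.
  exact: (idealB (idA k)).
have rB z w z' w' : r z w -> r z' w' -> r (z - z') (w - w').
  move=> rw rw' k; have [a [za wa]] := rw k; have [b [zb wb]] := rw' k.
  exists (a - b); rewrite !rmorphB; split.
    have -> : z - z' - (iA a - iA b) = z - iA a - (z' - iA b) by ring.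
    exact: (idealB (idA k)).
  have -> : w - w' - (iB (f a) - iB (f b)) = w - iB (f a) - (w' - iB (f b)) by ring.
  exact: (idealB (idB k)).
have rM z w z' w' : r z w -> r z' w' -> r (z * z') (w * w').
  move=> rw rw' k; have [a [za wa]] := rw k; have [b [zb wb]] := rw' k.
  exists (a * b); rewrite !rmorphM; split.
    have -> : z * z' - iA a * iA b = z' * (z - iA a) + iA a * (z' - iA b) by ring.
    by apply: (idealD (idA k)); apply: (idealM (idA k)).
  have -> : w * w' - iB (f a) * iB (f b) =
      w' * (w - iB (f a)) + iB (f a) * (w' - iB (f b)) by ring.
  by apply: (idealD (idB k)); apply: (idealM (idB k)).
have ri a : r (iA a) (iB (f a)).
  by move=> k; exists a; rewrite !subrr; split; [apply: (ideal0 (idA k)) | apply: (ideal0 (idB k))].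
have rtot z : exists w, r z w.
  have /choice[u uP] k := fil_dense k z.
  have [k|w wP] := fil_complete (u := fun k => iB (f (u k))).
    rewrite -!rmorphB; apply/fil_iota/powf/fil_iota; rewrite rmorphB.
    have -> : iA (u k.+1) - iA (u k) = z - iA (u k) - (z - iA (u k.+1)) by ring.
    by apply: (idealB (idA k)) => //; apply: fil_leq (uP k.+1).
  by exists w => k; exists (u k).
have rsurj w : exists z, r z w.
  have /choice[v vP] k := fil_dense k w.
  have step k a : fil k (w - iB (f a)) -> exists b, ideal_pow m k (b - a) /\
      fil k.+1 (w - iB (f b)).
    move=> wa; have /powl[c kc ec] : ideal_pow n k (v k.+1 - f a).
      apply/fil_iota; rewrite rmorphB.
      have -> : iB (v k.+1) - iB (f a) = w - iB (f a) - (w - iB (v k.+1)) by ring.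
      by apply: (idealB (idB k)) => //; apply: fil_leq (vP k.+1).
    by exists (a + c); rewrite addrAC subrr add0r rmorphD ec addrCA subrr addr0.
  have [u [_ uP]] := @dependent_choice _ (fun k a => fil k (w - iB (f a)))
    (fun k a b => ideal_pow m k (b - a)) 0 I step.
  have [k|z zP] := fil_complete (u := fun k => iA (u k)).
    by rewrite -rmorphB; apply/fil_iota; have [] := uP k.
  by exists z => k; exists (u k); split=> //; have [] := uP k.
have [psi psiP] := choice rtot.
exists psi; split=> [z w|z w|a|w|z].
- exact: runiq (psiP _) (rB _ _ _ _ (psiP z) (psiP w)).
- exact: runiq (psiP _) (rM _ _ _ _ (psiP z) (psiP w)).
- exact: runiq (psiP _) (ri a).
- by have [z rz] := rsurj w; exists z; apply: runiq rz.
split=> [z0 k|zI].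
  have [a [za]] := psiP z k; rewrite z0 sub0r => /(idealN (idB k)).
  rewrite opprK => /fil_iota/powl[b kb eb].
  exists (iA (a - b)); first by exists (a - b); rewrite // rmorphB eb subrr.
  have -> : z - iA (a - b) = z - iA a + iA b by rewrite rmorphB; ring.
  by apply: (idealD (idA k)) => //; apply/fil_iota.
apply: (runiq z) => // k; have [_ [a fa ->] za] := zI k; exists a; split=> //.
by rewrite fa rmorph0 subrr; apply: (ideal0 (idB k)).
Qed.

End CompletionMap.

(** * Completions of one-dimensional unibranch domains *)

Section DescendingChains.
Variable A : comNzRingType.
Implicit Types K L : A -> Prop.

Definition dcc K L := forall I : nat -> A -> Prop, (forall n, ideal (I n)) ->
  (forall n a, I n.+1 a -> I n a) -> (forall n a, K a -> I n a) ->
  (forall n a, I n a -> L a) ->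
  exists n0, forall n a, (n0 <= n)%N -> I n0 a -> I n a.

Lemma dcc_sub K L L' : (forall a, L' a -> L a) -> dcc K L -> dcc K L'.
Proof. by move=> LL d I iI Id KI IL'; apply: d => // n a /IL'/LL. Qed.

Lemma dcc_refl K : dcc K K.
Proof. by move=> I iI Id KI IK; exists 0%N => n a _ /IK/KI. Qed.

(** The intersections of [I n] with [L] and the sums [I n + L] both become stationary, and the
    modular law then makes [I n] stationary. *)
Lemma dcc_trans K L M : ideal L -> (forall a, K a -> L a) ->
  (forall a, L a -> M a) -> ideal M -> dcc K L -> dcc L M -> dcc K M.
Proof.
move=> iL KL LM iM dKL dLM I iI Id KI IM.
have Ile k n a : (k <= n)%N -> I n a -> I k a.
  by move=> /subnK <-; elim: (n - k)%N => // l IHl /Id.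
have [||||n1 n1P] := dKL (fun n a => I n a /\ L a).
- move=> n; split; first by split; exact: ideal0.
    by move=> u v [Iu Lu] [Iv Lv]; split; exact: idealD.
  by move=> a u [Iu Lu]; split; exact: idealM.
- by move=> n a [/Id].
- by move=> n a Ka; split; [exact: KI | exact: KL].
- by move=> n a [].
have [||||n2 n2P] := dLM (fun n a => exists2 b, I n b & L (a - b)).
- move=> n; split; first by exists 0; rewrite ?subrr; exact: ideal0.
    move=> u v [b Ib Lb] [c Ic Lc]; exists (b + c); first exact: idealD.
    by rewrite opprD addrACA; apply: idealD.
  by move=> a u [b Ib Lb]; exists (a * b); rewrite -?mulrBr; apply: idealM.
- by move=> n a [b /Id Ib Lb]; exists b.
- by move=> n a La; exists 0; rewrite ?subr0 //; exact: ideal0.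
- move=> n a [b /IM Mb /LM Lab]; rewrite -(subrK b a); exact: idealD.
exists (maxn n1 n2) => n a; rewrite geq_max => /andP[n1n n2n] Ia.
have [|b Ib Lab] := n2P n a n2n.
  exists a; last by rewrite subrr; exact: ideal0.
  by apply: Ile Ia; apply: leq_maxr.
have [|Iab _] := n1P n (a - b) n1n.
  split=> //; apply: idealB => //; last exact: Ile Ib.
  by apply: Ile Ia; apply: leq_maxl.
by rewrite -(subrK b a); apply: idealD.
Qed.

(** Modulo [K] the element [h] is killed by all nonunits, so it generates a simple or zero module:
    an ideal of the chain either contains a unit multiple of [h], hence everything, or equals
    [K]. *)
Lemma dcc_step K h : ideal K -> (forall z, ~ is_unit z -> K (z * h)) ->
  dcc K (fun a => exists c, K (a - c * h)).
Proof.
move=> iK Kh I iI Id KI IL.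
have [allu|] := pselect (forall n, exists c, is_unit c /\ I n (c * h)).
  exists 0%N => n a _ /IL[c Kc]; have [d [[v vd] Id']] := allu n.
  rewrite -(subrK (c * h) a); apply: idealD => //; first exact: KI.
  have -> : c * h = c * v * (d * h) by rewrite mulrA -(mulrA c) vd mulr1.
  exact: idealM.
move=> /existsNP[n nP]; exists n => k a _ Ina; apply: (KI).
have [c Kc] := IL _ _ Ina; rewrite -(subrK (c * h) a); apply: idealD => //.
apply: Kh => cu; apply: nP; exists c; split=> //.
by rewrite -(subKr a (c * h)); apply: idealB => //; apply: KI.
Qed.

End DescendingChains.

Section CompleteLocal.
Variables (D : comNzRingType) (m : idealr D).
Hypotheses (nD : noeth D) (Dm : local_ring m).
Local Notation pw := (@ideal_pow D m).
Local Notation E := (completion m).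
Local Notation iota := (completion_map m).

(** Each layer [fil N / fil N.+1] is filtered by adding the generators of [m ^ N] one at a time,
    every step being simple or zero. *)
Lemma dcc_fil N : dcc (fil (m := m) N) (fun=> True).
Proof.
elim: N => [|N IHN]; first exact: dcc_refl.
apply: (dcc_trans (L := fil N)) => //; first exact: fil_ideal.
  by move=> a; apply: fil_leq.
have [s [sN gen]] := nD (pow_ideal m N).
pose G (s : seq D) (z : E) := exists2 w, spanned (map iota s) w & fil N.+1 (z - w).
apply: (@dcc_sub _ _ (G s)).
  move=> z /fil_pow/(_ s gen) sz; exists z => //; rewrite subrr.
  exact: (ideal0 (fil_ideal m N.+1)).
elim: s sN {gen} => [|x s IHs] sN.
  apply: (@dcc_sub _ _ (fil N.+1)); last exact: dcc_refl.
  move=> z [w w0]; have -> : w = 0 by exact: w0.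
  by rewrite subr0.
have iG r : ideal (G r).
  split.
  - exists 0; first exact: (ideal0 (ideal_spanned _)).
    by rewrite subrr; exact: (ideal0 (fil_ideal m N.+1)).
  - move=> u v [w sw uw] [y sy vy]; exists (w + y).
      exact: (idealD (ideal_spanned _)).
    by rewrite opprD addrACA; apply: (idealD (fil_ideal m N.+1)).
  move=> a u [w sw uw]; exists (a * w); first exact: (idealM (ideal_spanned _)).
  by rewrite -mulrBr; apply: (idealM (fil_ideal m N.+1)).
have filG z : fil N.+1 z -> G s z.
  by move=> Nz; exists 0; [exact: (ideal0 (ideal_spanned _)) | rewrite subr0].
apply: (dcc_trans (L := G s)) => //.
- move=> z [w sw zw]; exists w => //; exists 0; split=> //.
  by rewrite mul0r subr0.
- by apply: IHs => y ys; apply: sN; rewrite inE ys orbT.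
apply: (@dcc_sub _ _ (fun a => exists c, G s (a - c * iota x))).
  by move=> z [w [c [_ sw]] zw]; exists c, (w - c * iota x) => //; rewrite opprB addrA subrK.
apply: dcc_step => // z nz; apply: filG; rewrite -add1n; apply: filM.
  by apply: contrapT => /(completion_unit Dm)/nz.
by apply/fil_iota/sN; rewrite inE eqxx.
Qed.

(* The saturations [(f ^ n : s ^ oo)] become constant modulo [s], hence, as they
   are closed, constant. *)
Lemma power_stab N s (f : E) : s \in m -> (forall a, pw N a -> exists b, a = s * b) ->
  exists n k c, f ^+ n * iota s ^+ k = f ^+ n.+1 * c.
Proof.
move=> ms Ns.
pose I n z := exists k w, iota s ^+ k * z = f ^+ n * w.
have iI n : ideal (I n).
  split; first by exists 0%N, 0; rewrite !mulr0.
    move=> u v [k [w e]] [l [y g]]; exists (k + l)%N, (iota s ^+ l * w + iota s ^+ k * y).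
    have -> : iota s ^+ (k + l) * (u + v) =
        iota s ^+ l * (iota s ^+ k * u) + iota s ^+ k * (iota s ^+ l * v).
      by rewrite exprD; ring.
    by rewrite e g; ring.
  by move=> a u [k [w e]]; exists k, (a * w); rewrite mulrCA e mulrCA.
have Id n z : I n.+1 z -> I n z.
  by move=> [k [w e]]; exists k, (f * w); rewrite e exprSr mulrA.
(* [T n] is [I n + s E]. It contains [fil N], so the descending chain condition applies to it,
   whereas [I n] may contain no step of the filtration. *)
pose T n z := exists w, I n (z - iota s * w).
have [||||n nP] := @dcc_fil N T.
- move=> n; split; first by exists 0; rewrite mulr0 subrr; exact: ideal0.
    move=> u v [w Iw] [y Iy]; exists (w + y).
    by rewrite mulrDr opprD addrACA; apply: idealD.
  by move=> a u [w Iw]; exists (a * w); rewrite mulrCA -mulrBr; apply: idealM.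
- by move=> n z [w /Id Iw]; exists w.
- move=> n; apply: (fil_sub nD) => [|a /Ns[b ->]].
    split; first by exists 0; rewrite mulr0 subrr; exact: ideal0.
      move=> u v [w Iw] [y Iy]; exists (w + y).
      by rewrite mulrDr opprD addrACA; apply: idealD.
    by move=> a u [w Iw]; exists (a * w); rewrite mulrCA -mulrBr; apply: idealM.
  by exists (iota b); rewrite rmorphM subrr; exact: ideal0.
- by [].
have step z : I n z -> exists2 w, I n w & I n.+1 (z - iota s * w).
  move=> Iz; have [|w Iw] := nP n.+1 z (leqnSn n).
    by exists 0; rewrite mulr0 subr0.
  exists w => //; have : I n (iota s * w).
    by rewrite -(subKr z (iota s * w)); apply: idealB => //; apply: Id.
  by move=> [k [y e]]; exists k.+1, y; rewrite exprSr -mulrA.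
have stepj j z : I n z -> exists2 w, I n w & I n.+1 (z - iota s ^+ j * w).
  elim: j => [|j IHj] Iz; first by exists z; rewrite // mul1r subrr; exact: ideal0.
  have [w Iw zw] := IHj Iz; have [y Iy wy] := step w Iw; exists y => //.
  have -> : z - iota s ^+ j.+1 * y =
      z - iota s ^+ j * w + iota s ^+ j * (w - iota s * y) by rewrite exprSr; ring.
  by apply: idealD => //; apply: idealM.
suff [k [w e]] : I n.+1 (f ^+ n) by exists n, k, w; rewrite mulrC.
have Ifn : I n (f ^+ n) by exists 0%N, 1; rewrite mul1r mulr1.
apply: (closureE nD (iI n.+1)) => j; have [w Iw zw] := stepj j _ Ifn.
exists (f ^+ n - iota s ^+ j * w) => //; rewrite subKr.
by apply: (idealMl _ (fil_ideal m j)); apply: filX; apply/fil_iota/pow1P.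
Qed.

End CompleteLocal.

Section Fractions.
Variable D : comNzRingType.

Lemma to_fractions_inj : injective (to_fractions D).
Proof.
move=> a b /mkfracP[u /asboolP ureg]; rewrite !mulr1 => e.
by apply/eqP; rewrite -subr_eq0; apply/eqP/ureg; rewrite mulrC mulrBr e subrr.
Qed.

Lemma to_fractions_unit (a : D) : is_domain D -> a != 0 ->
  exists v : fraction_ring D, to_fractions D a * v = 1.
Proof.
move=> domD a0; have areg : a \in @regular_elt D.
  by apply/asboolP => b /domD[//|/eqP]; rewrite (negPf a0).
exists (mkfrac (M := regular_set D) 1 areg).
rewrite -[LHS]/(loc_mul _ _) loc_mulE; apply/mkfracP; exists 1; first exact: mult_set1.
by rewrite !mulr1 !mul1r.
Qed.

End Fractions.

(* The inverse [w] of [z] lies in [D[z] = D + D z], and [w = a + b z] gives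
   [(a + b) z = 1 + b mu], whose right-hand side is a unit. *)
Lemma unit_integral_mem (D D0 K : comNzRingType) (m : idealr D)
    (f : {rmorphism D -> D0}) (g : {rmorphism D0 -> K}) mu (z w : K) :
  local_ring m -> (forall b, exists a, f a = b) -> mu \in m ->
  z * (1 - z) = g (f mu) -> z * w = 1 -> integralOver g w ->
  exists b, z = g (f b).
Proof.
move=> Dm fsurj mmu zmu zw [p /monicP pmon /rootP pw].
pose h a := g (f a).
have zz : z * z = z - h mu by rewrite /h -zmu; ring.
pose M u := exists a b, u = h a + h b * z.
have M0 : M 0 by exists 0, 0; rewrite /h !rmorph0; ring.
have MD u v : M u -> M v -> M (u + v).
  by move=> [a [b ->]] [c [d ->]]; exists (a + c), (b + d); rewrite /h !rmorphD; ring.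
have Mh c u : M u -> M (h c * u).
  by move=> [a [b ->]]; exists (c * a), (c * b); rewrite /h !rmorphM; ring.
have MN u : M u -> M (- u).
  by move=> [a [b ->]]; exists (- a), (- b); rewrite /h !rmorphN; ring.
have Mz u : M u -> M (z * u).
  move=> [a [b ->]]; exists (- (b * mu)), (a + b).
  rewrite mulrDr mulrCA zz /h !rmorphN !rmorphM rmorphD; ring.
have MX k : M (z ^+ k).
  elim: k => [|k IHk]; last by rewrite exprS; apply: Mz.
  by exists 1, 0; rewrite /h !rmorph1 !rmorph0 expr0; ring.
have zwX k : z ^+ k * w ^+ k = 1 by rewrite -exprMn zw expr1n.
have [a [b ewab]] : M w.
  have szp : (size (map_poly g p) <= size p)%N by exact: size_poly.
  move: pw; rewrite (horner_coef_wide _ szp).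
  have : size p != 0%N.
    rewrite size_poly_eq0; apply/eqP => p0; move/eqP: pmon.
    by rewrite p0 lead_coef0 eq_sym oner_eq0.
  move: pmon; rewrite lead_coefE; case: (size p) => // n pn _; rewrite big_ord_recr /=.
  rewrite coef_map /= pn rmorph1 mul1r => e.
  case: n pn e => [|n] pn e.
    by move/eqP: e; rewrite big_ord0 add0r expr0 oner_eq0.
  (* The integral equation of degree [n.+1] for [w], multiplied by [z ^ n], writes [w] as a
     polynomial in [z]. *)
  have -> : w = - \sum_(i < n.+1) g p`_i * z ^+ (n - i).
    have : z ^+ n * (\sum_(i < n.+1) (map_poly g p)`_i * w ^+ i + w ^+ n.+1) = 0.
      by rewrite e mulr0.
    rewrite mulrDr exprSr mulrA zwX mul1r addrC => /eqP; rewrite addr_eq0 => /eqP ->.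
    rewrite mulr_sumr; congr (- _); apply: eq_bigr => i _.
    have -> : z ^+ n = z ^+ (n - i) * z ^+ i by rewrite -exprD subnK // -ltnS.
    by rewrite coef_map /= mulrCA -mulrA zwX mulr1.
  apply: MN; apply: big_ind => // i _.
  by have [c <-] := fsurj p`_i; apply: Mh.
have e1 : h (a + b) * z = h (1 + b * mu).
  have : z * w = 1 by [].
  rewrite ewab mulrDr mulrCA zz => e.
  rewrite /h !rmorphD !rmorphM rmorph1 -/(h _) rmorph1 -e /h; ring.
have [v v1] : is_unit (1 + b * mu).
  by rewrite -[b * mu]opprK -mulrN; apply: (local_unit1 Dm); rewrite mulrN rpredN idealMr.
have [mab|/(local_unit Dm)[c cab]] := boolP (a + b \in m); last first.
  exists (c * (1 + b * mu)); rewrite -/(h _).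
  have -> : h (c * (1 + b * mu)) = h c * h (1 + b * mu) by rewrite /h !rmorphM.
  by rewrite -e1 mulrA /h -!rmorphM cab !rmorph1 mul1r.
(* If [a + b] lies in [m], then [w] is the image of [d] in [m], and [z (1 - z) w ^ 2 = mu w ^ 2]
   becomes [1 - d + mu d ^ 2 = 0] in [K]: impossible, since the left side is the image of a unit. *)
pose d := v * (a + b).
have wd : w = h d.
  have : w * (h (a + b) * z) = w * h (1 + b * mu) by rewrite e1.
  rewrite mulrCA [w * z]mulrC zw mulr1 => e2.
  rewrite /d /h !rmorphM -/(h _) -/(h v) -/(h (a + b)) e2 mulrCA.
  by rewrite /h -!rmorphM v1 !rmorph1 mulr1.
have [u u1] : is_unit (1 - (d - mu * d * d)).
  apply: (local_unit1 Dm); rewrite rpredB //; last by rewrite idealMr // /d idealMr.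
  by rewrite /d idealMr.
have e3 : h (1 - (d - mu * d * d)) = 0.
  have : z * (1 - z) * (w * w) = h mu * (w * w) by rewrite zmu.
  have -> : z * (1 - z) * (w * w) = (z * w) * w - (z * w) * (z * w) by ring.
  rewrite zw !mul1r wd /h => e.
  transitivity (1 - g (f d) + g (f mu) * (g (f d) * g (f d))).
    by rewrite !rmorphB !rmorphM !rmorph1; ring.
  by rewrite -e; ring.
have : h u * h (1 - (d - mu * d * d)) = 1 by rewrite /h -!rmorphM u1 !rmorph1.
by rewrite e3 mulr0 => /eqP; rewrite eq_sym oner_eq0.
Qed.

Section OneDimensional.
Variables (D : comNzRingType) (m : idealr D).
Local Notation pw := (@ideal_pow D m).
Local Notation E := (completion m).
Local Notation iota := (completion_map m : {rmorphism D -> completion m}).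
Hypotheses (nD : noeth D) (Dm : local_ring m) (domD : is_domain D).
Hypothesis dimD : forall s, s != 0 -> exists N, forall a, pw N a -> exists b, a = s * b.
Hypothesis redE : reduced E.

Lemma domain_reg (s : D) : s != 0 -> forall a, s * a = 0 -> a = 0.
Proof. by move=> s0 a /domD[/eqP|//]; rewrite (negPf s0). Qed.

Lemma domain_exp (s : D) n : s != 0 -> s ^+ n != 0.
Proof.
move=> s0; elim: n => [|n IHn]; first by rewrite expr0 oner_eq0.
rewrite exprS; apply/eqP => /domD[]/eqP; first by rewrite (negPf s0).
by rewrite (negPf IHn).
Qed.

(** [power_stab] gives [f ^ n * (s ^ k - f * c) = 0], and reducedness lowers the exponent [n] to
    one. *)
Lemma power_split s (f : E) : s \in m -> s != 0 ->
  exists k c, f * (iota s ^+ k - f * c) = 0.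
Proof.
move=> ms s0; have [N Ns] := dimD s0.
have [n [k [c e]]] := power_stab nD Dm f ms Ns; exists k, c.
apply: (redE (k := n.+1)); rewrite exprMn.
have e0 : f ^+ n * (iota s ^+ k - f * c) = 0 by rewrite mulrBr e exprSr; ring.
set y := iota s ^+ k - f * c in e0 *.
have -> : f ^+ n.+1 * y ^+ n.+1 = f * y ^+ n * (f ^+ n * y) by rewrite !exprS; ring.
by rewrite e0 mulr0.
Qed.

Lemma completion_field : (forall s, s \in m -> s = 0) ->
  forall z : E, z = 0 \/ is_unit z.
Proof.
move=> m0 z; have [z1|/(completion_unit Dm)] := pselect (fil 1 z); last by right.
left; apply: (fil_sub (J := fun z => z = 0) nD _ _ z1).
  by split=> [//|u v -> ->|a u ->]; rewrite ?addr0 ?mulr0.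
by move=> a /pow1P/m0 ->; rewrite rmorph0.
Qed.

(** The fraction [z = d / a] is a root of [X ^ 2 - X + mu], hence integral. In the local integral
    closure [z] or [1 - z] is a unit; its inverse is integral as well, which forces this unit to
    come from [D]. *)
Lemma unibranch_dvd a d mu : is_local (integral_closure (red_ring D)) ->
  a != 0 -> mu \in m -> d * (a - d) = a ^+ 2 * mu -> exists b, d = a * b.
Proof.
move=> [m' loc'] a0 mmu e.
pose D0 := red_ring D; pose f : {rmorphism D -> D0} := \pi_(red_ring D)%qT.
pose g := to_fractions D0.
have fsurj b : exists a, f a = b by exists (repr b); exact: reprK.
have finj x y : f x = f y -> x = y.
  move=> /eqP; rewrite -Quotient.idealrBE => /asboolP[k].
  move=> xy; apply/eqP; rewrite -subr_eq0; apply/negPn/negP => /(domain_exp k).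
  by rewrite xy eqxx.
have dom0 : is_domain D0.
  move=> x y; have [x' <-] := fsurj x; have [y' <-] := fsurj y.
  rewrite -rmorphM -(rmorph0 f) => /finj/domD[->|->]; by [left|right].
have fa0 : f a != 0 by apply/eqP; rewrite -(rmorph0 f) => /finj/eqP; rewrite (negPf a0).
have [v av] := to_fractions_unit dom0 fa0.
pose z := g (f d) * v.
have zmu : z * (1 - z) = g (f mu).
  have : g (f (d * (a - d))) * v ^+ 2 = g (f (a ^+ 2 * mu)) * v ^+ 2 by rewrite e.
  rewrite [a ^+ 2]expr2 !rmorphM !rmorphB.
  have -> : g (f d) * (g (f a) - g (f d)) * v ^+ 2 = z * (g (f a) * v - z) by rewrite /z; ring.
  have -> : g (f a) * g (f a) * g (f mu) * v ^+ 2 =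
    g (f mu) * (g (f a) * v) * (g (f a) * v) by ring.
  by rewrite av !mulr1.
have zint : integralOver g z.
  exists ('X^2 - 'X + (f mu)%:P).
    apply/monicP; rewrite -addrA lead_coefDl ?lead_coefXn // size_polyXn.
    rewrite (leq_ltn_trans (size_polyD _ _)) // size_polyN size_polyX gtn_max /=.
    by rewrite (leq_ltn_trans (size_polyC_leq1 _)).
  apply/rootP; rewrite !rmorphD rmorphN /= map_polyXn map_polyX map_polyC /= !hornerE.
  by rewrite /g -zmu; ring.
have z1int : integralOver g (1 - z).
  exact: (integral_sub (integral1 g) zint).
suff [b zb] : exists b, z = g (f b).
  exists b; apply: finj; apply: (@to_fractions_inj D0).
  by rewrite !rmorphM -/g -zb /z mulrCA av mulr1.
have zi : z \in @integral_elt D0.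
  rewrite unfold_in.
  apply/asboolP.
  exact: zint.
pose Z := IntegralClosure zi.
have [mZ|/(local_unit loc')[W WZ]] := boolP (Z \in m').
  have mZ' : 1 - Z \notin m'.
    apply/negP => mZ'; have := rpredD mZ mZ'.
    by rewrite addrC subrK idealr1.
  have [W WZ] := local_unit loc' mZ'.
  have WZ' : (1 - z) * val W = 1 by move: (congr1 val WZ); rewrite mulrC.
  have /asboolP Wint := valP W.
  have [b zb] := unit_integral_mem (z := 1 - z) Dm fsurj mmu
    (etrans (etrans (congr1 _ (subKr 1 z)) (mulrC _ _)) zmu) WZ' Wint.
  by exists (1 - b); rewrite !rmorphB !rmorph1 -/g -zb subKr.
have WZ' : z * val W = 1 by move: (congr1 val WZ); rewrite mulrC.
have /asboolP Wint := valP W.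
exact: (unit_integral_mem Dm fsurj mmu zmu WZ' Wint).
Qed.

(** The splitting [f * (a - f * c) = 0] with [a = s ^ k] makes [f * c / a] an idempotent of the
    fraction ring. Its approximation [d / a] with [d] in [D] lies in [D] by unibranchness, so the
    idempotent lies in the local ring [E] and is trivial: [0] forces [f = 0], and [1] makes [f] a
    divisor of [a], hence regular. *)
Lemma completion_domain : is_local (integral_closure (red_ring D)) ->
  forall f g : E, f * g = 0 -> f = 0 \/ g = 0.
Proof.
move=> locD f g0 fg0.
have [m0|/existsNP[s /not_implyP[ms /eqP s0]]] := pselect (forall s, s \in m -> s = 0).
  have [->|[v vf]] := completion_field m0 f; first by left.
  by right; rewrite -[g0]mul1r -vf -mulrA fg0 mulr0.
have [k [c fsk]] := power_split f ms s0.
pose a := s ^+ k; pose f1 := f * c; pose g := iota a - f1.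
have a0 : a != 0 by apply: domain_exp.
have fg : f * g = 0 by rewrite /g /a rmorphXn.
have areg (z : E) : iota a * z = 0 -> z = 0.
  by apply: (iota_regular nD); apply: domain_reg.
have f1a : f1 + g = iota a by rewrite /g addrC subrK.
have f1g : f1 * g = 0 by rewrite /f1 mulrAC fg mul0r.
(* The precision is [a ^ 2 * s]: the factor [a ^ 2] makes [d (a - d) / a ^ 2] an element [mu] of
   [D], and the factor [s] places [mu] in [m]. *)
have [N NP] : exists N, forall b, pw N b -> exists b', b = a ^+ 2 * s * b'.
  apply: dimD; apply/eqP => /domD[]/eqP; last by rewrite (negPf s0).
  by rewrite (negPf (domain_exp 2 a0)).
have [d f1d] := fil_dense N f1.
have [h h1 eh] : exists2 h, fil 1 h & f1 - iota d = iota (a ^+ 2) * h.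
  apply: (fil_sub (J := fun z => exists2 h, fil 1 h & z = iota (a ^+ 2) * h) nD _ _ f1d).
    split; first by exists 0; rewrite ?mulr0 //; exact: (ideal0 (fil_ideal m 1)).
      move=> _ _ [u u1 ->] [v v1 ->]; exists (u + v); last by rewrite mulrDr.
      exact: (idealD (fil_ideal m 1)).
    move=> b _ [u u1 ->]; exists (b * u); last by rewrite mulrCA.
    exact: (idealM (fil_ideal m 1)).
  move=> b /NP[b' ->]; exists (iota (s * b')); last by rewrite -rmorphM mulrA.
  by apply/fil_iota/pow1P; rewrite mulrC idealMr.
have ed : iota d = f1 - iota (a ^+ 2) * h by rewrite -eh subKr.
pose w := h * (f1 + f1 - iota a - iota (a ^+ 2) * h).
have edd : iota (d * (a - d)) = iota (a ^+ 2) * w.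
  rewrite rmorphM rmorphB ed.
  have -> : (f1 - iota (a ^+ 2) * h) * (iota a - (f1 - iota (a ^+ 2) * h)) =
    f1 * (iota a - f1) + iota (a ^+ 2) * w by rewrite /w; ring.
  by rewrite -f1a [f1 + g]addrC addrK f1g add0r.
have [mu emu] := iota_dvd nD Dm edd.
have mmu : mu \in m.
  apply/pow1P/fil_iota; have -> : iota mu = w.
    apply/eqP; rewrite -subr_eq0; apply/eqP/areg/areg.
    by rewrite mulrA -rmorphM -expr2 mulrBr -edd emu rmorphM subrr.
  by rewrite /w mulrC; apply: (idealM (fil_ideal m 1)).
have [b db] := unibranch_dvd locD a0 mmu emu.
pose e := iota b + iota a * h.
have ef1 : f1 = iota a * e.
  have ea : iota (a ^+ 2) = iota a * iota a by rewrite -rmorphM.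
  by rewrite -(subrK (iota d) f1) eh ea db rmorphM /e; ring.
have eg : g = iota a * (1 - e) by rewrite /g ef1; ring.
have [e0|e1] : e = 0 \/ e = 1.
  apply: (completion_idem Dm); apply: (areg); apply: areg.
  by rewrite -[RHS]f1g ef1 eg; ring.
- left; apply: areg; rewrite mulrC.
  by have := fg; rewrite /g ef1 e0 mulr0 subr0.
- right; apply: areg; rewrite -f1a eg e1 subrr mulr0 addr0 /f1.
  by rewrite mulrAC fg0 mul0r.
Qed.

Lemma completion_one_dim : is_domain E -> forall f : E, f != 0 ->
  exists N, forall z, fil N z -> exists h, z = f * h.
Proof.
move=> domE f f0.
have [m0|/existsNP[s /not_implyP[ms /eqP s0]]] := pselect (forall s, s \in m -> s = 0).
  exists 0%N => z _; have [fe|[v vf]] := completion_field m0 f.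
    by move: f0; rewrite fe eqxx.
  by exists (v * z); rewrite mulrA [f * v]mulrC vf mul1r.
have [k [c /domE[/eqP|/eqP]]] := power_split f ms s0; first by rewrite (negPf f0).
rewrite subr_eq0 => /eqP ef.
have [N NP] := dimD (domain_exp k s0); exists N.
apply: (fil_sub (J := fun z => exists h, z = f * h) nD).
  split; first by exists 0; rewrite mulr0.
    by move=> _ _ [u ->] [v ->]; exists (u + v); rewrite mulrDr.
  by move=> b _ [u ->]; exists (b * u); rewrite mulrCA.
move=> b /NP[b' ->]; exists (c * iota b'); rewrite mulrA -ef.
by rewrite rmorphM rmorphXn.
Qed.

End OneDimensional.

(** * Associated primes of an element of a normal domain *)

(** The source of integral equations: for the sequence [u k = (c / t) ^ k * y], a term depending on
    the earlier ones is a monic relation for [c / t] acting on [y]. *)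
Lemma noeth_sequence (A : comNzRingType) (u : nat -> A) : noeth A ->
  exists n (e : nat -> A), u n = \sum_(k < n) e k * u k.
Proof.
move=> nA; pose I n a := exists e : nat -> A, a = \sum_(k < n) e k * u k.
have [n||n nP] := noeth_chain (I := I) nA.
- split; first by exists (fun=> 0); rewrite big1 // => i _; rewrite mul0r.
    move=> _ _ [e ->] [f ->]; exists (fun k => e k + f k).
    by rewrite -big_split; apply: eq_bigr => i _; rewrite mulrDl.
  move=> a _ [e ->]; exists (fun k => a * e k).
  by rewrite mulr_sumr; apply: eq_bigr => i _; rewrite mulrA.
- move=> n _ [e ->]; exists (fun k => if k == n then 0 else e k).
  rewrite big_ord_recr /= eqxx mul0r addr0; apply: eq_bigr => i _.
  by rewrite ltn_eqF.
have [|e ue] := nP n.+1 (u n); last by exists n, e.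
exists (fun k => (k == n)%:R); rewrite big_ord_recr /= eqxx mul1r big1 ?add0r //.
by move=> i _; rewrite ltn_eqF // mul0r.
Qed.

Lemma prime_avoid_inter (A : comNzRingType) (T : eqType) (P : A -> Prop)
    (I : T -> A -> Prop) (s : seq T) : prime_ideal P ->
  (forall i, ideal (I i)) -> (forall i, i \in s -> exists2 y, I i y & ~ P y) ->
  exists2 y, ~ P y & forall i, i \in s -> I i y.
Proof.
move=> [iP P1 pP] iI; elim: s => [|i s IHs] sP; first by exists 1.
have [|y Py yI] := IHs; first by move=> j js; apply: sP; rewrite inE js orbT.
have [|z Iz Pz] := sP i; first by rewrite inE eqxx.
exists (z * y); first by move=> /pP[].
move=> j; rewrite inE => /orP[/eqP ->|/yI Ij]; first exact: idealMl.
exact: idealM.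
Qed.

Lemma prime_avoidance (A : comNzRingType) (T : eqType) (J : A -> Prop)
    (P : T -> A -> Prop) (s : seq T) : ideal J ->
  (forall i, i \in s -> prime_ideal (P i)) ->
  (forall i, i \in s -> exists2 y, J y & ~ P i y) ->
  exists2 y, J y & forall i, i \in s -> ~ P i y.
Proof.
move=> iJ; elim: s => [|i s IHs] sp sJ; first by exists 0 => //; exact: ideal0.
have [j js|j js|g Jg gP] := IHs.
- by apply: sp; rewrite inE js orbT.
- by apply: sJ; rewrite inE js orbT.
have [iPi Pi1 pPi] := sp i (mem_head i s).
have [Pg|nPg] := pselect (P i g); last first.
  by exists g => // j; rewrite inE => /orP[/eqP ->|/gP].
have [h Jh nPh] := sJ i (mem_head i s).
(* Primes contained in [P i] are left out: they are avoided together with [P i]. The others have a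
   common element [e] outside [P i]. *)
pose s' := [seq j <- s | `[< exists2 y, P j y & ~ P i y >]].
(* Outside [s] nothing is known of [P j]; the whole ring is the default, so that every [Q j] is an
   ideal. *)
pose Q j := if j \in s then P j else fun=> True.
have [|j|j|e nPe eP] := @prime_avoid_inter A T (P i) Q s'.
- exact: sp (mem_head i s).
- rewrite /Q; case: ifP => // js; have [] // := sp j.
  by rewrite inE js orbT.
- rewrite mem_filter => /andP[/asboolP[y Py nPy] js]; exists y => //.
  by rewrite /Q js.
have nPhe : ~ P i (h * e) by move=> /pPi[].
have nP' : ~ P i (g + h * e) by rewrite addrC => /(idealDr iPi Pg).
exists (g + h * e); first by apply: idealD => //; apply: idealMl.
move=> j; rewrite inE => /orP[/eqP -> //|js Pj].
have [iPj _ _] : prime_ideal (P j) by apply: sp; rewrite inE js orbT.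
have [js'|] := boolP (j \in s').
  have := eP j js'; rewrite /Q js => Pe.
  by apply: (gP j js); apply: idealDr Pj => //; apply: idealM.
rewrite mem_filter js andbT => /asboolPn np; apply: np.
by exists (g + h * e).
Qed.

Section Divisors.
Variables (S : comNzRingType) (nS : noeth S) (Snorm : normal_domain S).
Variables (t : S) (t0 : t != 0).
Let domS : is_domain S := Snorm.1.

(** The equation is an integral equation for [c / s], cleared of denominators. *)
Lemma normal_dvd n (e : nat -> S) (c s : S) : s != 0 ->
  c ^+ n = \sum_(k < n) e k * c ^+ k * s ^+ (n - k) -> exists a, c = s * a.
Proof.
move=> s0 ce; have [v sv] := to_fractions_unit domS s0; pose g := to_fractions S.
have [|a ea] := Snorm.2 (g c * v); last first.
  exists a; apply: (@to_fractions_inj S).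
  by rewrite rmorphM -ea mulrCA sv mulr1.
exists ('X^n - \poly_(k < n) e k).
  apply/monicP; rewrite lead_coefDl ?lead_coefXn // size_polyN size_polyXn.
  exact: size_poly.
apply/rootP; rewrite rmorphB /= map_polyXn hornerD hornerN hornerXn exprMn -rmorphXn ce.
have -> : map_poly g (\poly_(k < n) e k) = \poly_(k < n) g (e k).
  apply/polyP => i; rewrite coef_map !coef_poly; case: ifP => // _; exact: rmorph0.
rewrite horner_poly rmorph_sum mulr_suml -sumrB big1 // => k _.
rewrite !rmorphM !rmorphXn exprMn.
have -> : v ^+ n = v ^+ k * v ^+ (n - k) by rewrite -exprD subnKC // ltnW.
have -> : g (e k) * g c ^+ k * g s ^+ (n - k) * (v ^+ k * v ^+ (n - k)) =
  g (e k) * (g c ^+ k * v ^+ k) * (g s * v) ^+ (n - k) by rewrite exprMn; ring.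
by rewrite sv expr1n mulr1 subrr.
Qed.

Definition dvd a b := exists w : S, b = a * w.

(** The ideal [(t S : c)], the annihilator of the class of [c] in [S / t S]. *)
Definition colon c y := dvd t (c * y).

Lemma colon_ideal c : ideal (colon c).
Proof.
split; first by exists 0; rewrite !mulr0.
  by move=> u v [w ew] [w' ew']; exists (w + w'); rewrite !mulrDr ew ew'.
by move=> a u [w ew]; exists (a * w); rewrite mulrCA ew mulrCA.
Qed.

Lemma colon_t c : colon c t.
Proof. by exists c; rewrite mulrC. Qed.

Lemma mulIt a b : t * a = t * b -> a = b.
Proof.
move=> e; have /domS[/eqP|/eqP] : t * (a - b) = 0 by rewrite mulrBr e subrr.
  by rewrite (negPf t0).
by rewrite subr_eq0 => /eqP.
Qed.

Lemma mulItX n a b : t ^+ n * a = t ^+ n * b -> a = b.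
Proof. by elim: n a b => [|n IHn] a b; rewrite ?mul1r // exprS -!mulrA => /mulIt/IHn. Qed.

Lemma colon_zero c : prime_ideal (colon c) -> c != 0.
Proof.
move=> [_ c1 _]; apply/eqP => c0; apply: c1; exists 0.
by rewrite c0 mul0r mulr0.
Qed.

(** Maximal annihilators in [S / t S] are prime. Let the finite list [L] span all [c] with maximal
    annihilator: an element killing every class in [L] kills each such [c], so the prime [colon c]
    contains, and by maximality equals, some [colon d] with [d] in [L]. *)
Lemma associated_primes : exists L : seq S,
  (forall c, c \in L -> prime_ideal (colon c)) /\
  forall y, (forall c, c \in L -> ~ colon c y) -> forall z, dvd t (y * z) -> dvd t z.
Proof.
pose maxc c := ~ dvd t c /\ forall c', ~ dvd t c' ->
  (forall y, colon c y -> colon c' y) -> forall y, colon c' y -> colon c y.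
have maxc_prime c : maxc c -> prime_ideal (colon c).
  move=> [ct cmax]; split; first exact: colon_ideal.
    by rewrite /colon mulr1.
  move=> a b cab; have [ca|ca] := pselect (colon c a); [by left | right].
  apply: (cmax (c * a)) => //; last by move: cab; rewrite /colon mulrA.
  by move=> y [w e]; exists (a * w); rewrite mulrAC e -mulrA (mulrC a).
have [L [Lmax gen]] := noeth_subset maxc nS.
exists L; split=> [c /Lmax/maxc_prime //|y yL z yz].
apply: contrapT => ntz.
pose F (I : S -> Prop) := exists2 c, ~ dvd t c & forall y, I y <-> colon c y.
have [J [[c ct cJ] zJ Jmax]] : exists J, [/\ F J, (forall a, colon z a -> J a) &
    forall I, F I -> (forall a, J a -> I a) -> forall a, I a -> J a].
  apply: noeth_max nS _ _; last by exists z.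
  move=> I [d _ dI]; split; first by apply/dI; exact: ideal0 (colon_ideal d).
    by move=> u v /dI du /dI dv; apply/dI; exact: (idealD (colon_ideal d)).
  by move=> a u /dI du; apply/dI; exact: (idealM (colon_ideal d)).
have cmax : maxc c.
  split=> // c' c't cc' a c'a; apply/cJ; apply: (Jmax (colon c')) => //.
    by exists c'.
  by move=> b /cJ/cc'.
have [d dL dc] : exists2 d, d \in L & forall a, colon d a -> colon c a.
  apply: contrapT => nd.
  have [d dL|b ncb bL] := prime_avoid_inter (s := L) (maxc_prime _ cmax) colon_ideal.
    apply: contrapT => ny; apply: nd; exists d => // a da; apply: contrapT => ca.
    by apply: ny; exists a.
  apply: ncb; have := gen c cmax; apply: (spanned_sub (I := fun a => colon a b)) => //.
  split; first by exists 0; rewrite mul0r mulr0.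
    by move=> u v [w ew] [w' ew']; exists (w + w'); rewrite mulrDl mulrDr ew ew'.
  by move=> a u [w ew]; exists (a * w); rewrite -mulrA ew mulrCA.
have [_ dmax] := Lmax d dL.
apply: (yL d dL); apply: (dmax c) => //; apply/cJ; apply: zJ.
by rewrite /colon mulrC.
Qed.

Section AssociatedPrime.
Variables (c : S) (cprime : prime_ideal (colon c)).

Lemma iter_step n y z : c ^+ n * y = t ^+ n * z -> forall z', c * z = t * z' ->
  c ^+ n.+1 * y = t ^+ n.+1 * z'.
Proof. by move=> e z' e'; rewrite exprS -mulrA e mulrCA e' exprSr -mulrA. Qed.

(* The fraction [c / t] is not integral over [S]: otherwise [c] would be divisible
   by [t]. *)
Lemma val_finite y : y != 0 -> exists n z, c ^+ n * y = t ^+ n * z /\ ~ colon c z.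
Proof.
move=> y0; apply: contrapT => nfin.
have [||u [u0 uP]] := @dependent_choice _ (fun n z => c ^+ n * y = t ^+ n * z)
  (fun n z z' => c * z = t * z') y.
- by rewrite !expr0.
- move=> n z e; have [z' e'] : colon c z.
    by apply: contrapT => ncz; apply: nfin; exists n, z.
  by exists z'; split=> //; exact: iter_step e'.
have [n [e ue]] := noeth_sequence u nS.
have [_ c1 _] := cprime; apply: c1; rewrite /colon mulr1.
apply: (@normal_dvd n e _ _ t0); apply/eqP; rewrite -subr_eq0; apply/eqP.
suff /domS[//|/eqP] : (c ^+ n - \sum_(k < n) e k * c ^+ k * t ^+ (n - k)) * y = 0.
  by rewrite (negPf y0).
rewrite mulrBl (uP n).1 ue mulr_sumr mulr_suml -sumrB big1 // => k _.
have -> : t ^+ n = t ^+ (n - k) * t ^+ k by rewrite -exprD subnK // ltnW.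
have -> : e k * c ^+ k * t ^+ (n - k) * y = e k * t ^+ (n - k) * (c ^+ k * y) by ring.
by rewrite (uP k).1; ring.
Qed.

(** Starting from [t], multiply repeatedly by [c / t]: the last term inside the prime is [p], and
    the next one is [s]. *)
Lemma uniformizer : exists p s, [/\ colon c p, c * p = t * s & ~ colon c s].
Proof.
have [n [z [e ncz]]] := val_finite t0.
suff H k y : colon c y -> c ^+ k * y = t ^+ k * z ->
    exists p s, [/\ colon c p, c * p = t * s & ~ colon c s] by apply: H e; exact: colon_t.
elim: k y => [|k IHk] y cy; first by rewrite !mul1r => eyz; case: ncz; rewrite -eyz.
have [y' ey'] := cy; have [cy'|ncy'] := pselect (colon c y'); last by exists y, y'.
move=> e'; apply: (IHk y' cy'); apply: mulIt.
by rewrite mulrCA -ey' !mulrA -exprSr e' exprS.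
Qed.

(** By [s * y = p * y'], the fraction [c / t] acts as [s / p]. If [p] is in [P], then each [y] in
    [colon c] has [s * y] in [P], hence is in [P]. Otherwise [P] is stable under [c / t], and [t] in
    [P] would have infinite valuation. *)
Lemma associated_prime_min (P : S -> Prop) : prime_ideal P -> P t ->
  (forall a, P a -> colon c a) -> forall a, colon c a -> P a.
Proof.
move=> [iP _ pP] Pt Pc.
have [p [s [cp cps ncs]]] := uniformizer.
have key y y' : c * y = t * y' -> s * y = p * y'.
  move=> e; apply: mulIt; rewrite mulrA -cps.
  by rewrite -mulrA mulrCA e; ring.
have nPs : ~ P s by move=> /Pc.
have [Pp|nPp] := pselect (P p).
  move=> a [w e]; have /pP[//|//] : P (s * a).
  by rewrite (key _ _ e); apply: idealMl.
have iter n : exists2 y, P y & c ^+ n * t = t ^+ n * y.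
  elim: n => [|n [y Py e]]; first by exists t; rewrite // !mul1r.
  have [y' e'] := Pc y Py; exists y'; last exact: iter_step e'.
  have /pP[//|//] : P (p * y') by rewrite -(key _ _ e'); apply: idealM.
have [n [z [e ncz]]] := val_finite t0.
have [y Py e'] := iter n; case: ncz; suff -> : z = y by exact: Pc.
by apply: (@mulItX n); rewrite -e -e'.
Qed.

End AssociatedPrime.

(* Choosing the [c]'s suitably makes [c / t] a unit at the other associated
   primes of [t]. *)
Lemma vertical_primes : exists L : seq S,
  [/\ forall c, c \in L -> prime_ideal (colon c),
      forall y, (forall c, c \in L -> ~ colon c y) -> forall z, dvd t (y * z) -> dvd t z &
      forall c d, c \in L -> d \in L -> c != d ->
        exists y y', [/\ ~ colon d y, c * y = t * y' & ~ colon d y']].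
Proof.
have [L0 [L0p L0reg]] := associated_primes.
(* Each prime gets a canonical representative [rep c], so that different members of the list have
   different, hence incomparable, primes. *)
pose same c d := `[< forall y, colon c y <-> colon d y >].
pose rep c := choose (same c) c.
have srep c y : colon (rep c) y <-> colon c y.
  have /asboolP/(_ y) : same c (rep c) by apply: chooseP; apply/asboolP.
  by move=> [? ?]; split.
pose L1 := undup (map rep L0).
have L1P c : c \in L1 -> exists2 c0, c0 \in L0 & c = rep c0.
  by rewrite mem_undup => /mapP.
have L1p c : c \in L1 -> prime_ideal (colon c).
  move=> /L1P[c0 /L0p[_ c1 cp] ->]; split; first exact: colon_ideal.
    by move=> /srep.
  by move=> a b /srep/cp[/srep|/srep]; [left | right].
have L1inc c d : c \in L1 -> d \in L1 -> (forall y, colon c y -> colon d y) -> c = d.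
  move=> cL dL cd.
  have dc := associated_prime_min (L1p d dL) (L1p c cL) (colon_t c) cd.
  have [c0 c0L ec] := L1P c cL; have [d0 d0L ed] := L1P d dL.
  have scd : same c0 =1 same d0.
    have cd0 z : colon c0 z <-> colon d0 z.
      by split=> /srep H; apply/srep; move: H; rewrite -ec -ed; [exact: cd | exact: dc].
    by move=> y; apply/asboolP/asboolP => H z; have := H z; have := cd0 z; tauto.
  rewrite ec ed /rep (eq_choose scd); apply: choose_id.
    by rewrite -scd; apply/asboolP.
  by apply/asboolP.
(* As the primes are incomparable, there is for each [d] an element [v d] lying in all of them
   except [colon d]; sums of these realize every pattern of memberships. *)
have pattern (B : S -> Prop) : exists w, forall d, d \in L1 ->
    (B d -> colon d w) /\ (~ B d -> ~ colon d w).
  have /choice[v vP] : forall d, exists y, d \in L1 ->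
      ~ colon d y /\ forall d', d' \in L1 -> d' != d -> colon d' y.
    move=> d; have [dL|ndL] := boolP (d \in L1); last by exists 0.
    have [d'|y ny yP] := prime_avoid_inter (s := [seq d' <- L1 | d' != d])
      (L1p d dL) colon_ideal.
      rewrite mem_filter => /andP[d'd d'L]; apply: contrapT => ny.
      case/eqP: d'd; apply: (L1inc d' d d'L dL) => a d'a; apply: contrapT => nda.
      by apply: ny; exists a.
    by exists y => _; split=> // d' d'L d'd; apply: yP; rewrite mem_filter d'd.
  exists (\sum_(d <- L1 | `[< ~ B d >]) v d) => d dL; split=> Bd.
    rewrite big_seq_cond; apply: ideal_sum => [|d' /andP[d'L /asboolP Bd']].
      exact: colon_ideal.
    by have [_] := vP d' d'L; apply=> //; apply/eqP => e; apply: Bd'; rewrite -e.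
  rewrite -big_filter (bigD1_seq d) ?filter_uniq ?undup_uniq //=; last first.
    by rewrite mem_filter dL andbT; apply/asboolP.
  have [nv _] := vP d dL; move=> H; apply: nv; move: H; apply: idealDr.
    exact: colon_ideal.
  rewrite big_seq_cond; apply: ideal_sum => [|d' /andP[]]; first exact: colon_ideal.
  rewrite mem_filter => /andP[_ d'L] d'd.
  by have [_] := vP d' d'L; apply => //; rewrite eq_sym.
have /choice[adj adjP] : forall c, exists c', c \in L1 ->
    (forall y, colon c' y <-> colon c y) /\
    forall d, d \in L1 -> c != d ->
      exists y y', [/\ ~ colon d y, c' * y = t * y' & ~ colon d y'].
  move=> c; have [cL|ncL] := boolP (c \in L1); last by exists 0.
  have /choice[y yP] : forall d, exists y, d \in L1 -> c != d -> colon c y /\ ~ colon d y.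
    move=> d; have [[y yP]|ny] := pselect (exists y, colon c y /\ ~ colon d y).
      by exists y.
    exists 0 => dL /eqP cd; exfalso; apply: cd; apply: L1inc => // a ca.
    by apply: contrapT => nda; apply: ny; exists a.
  have /choice[y' y'P] : forall d, exists y', d \in L1 -> c != d -> c * y d = t * y'.
    move=> d; have [[dL cd]|nd] := pselect (d \in L1 /\ c != d).
      by have [[y' e] _] := yP d dL cd; exists y'.
    by exists 0 => dL cd; case: nd.
  have [w wP] := pattern (fun d => ~ colon d (y' d)).
  (* Adding [t * w] keeps the prime and [y] but replaces [y'] by [y' + w * y]. Since [w] is outside
     [colon d] exactly when [y'] is inside, the new quotient is outside [colon d]. *)
  exists (c + t * w) => _; split.
    move=> z; rewrite /colon mulrDl -mulrA; split=> [[u e]|[u ->]].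
      by exists (u - w * z); rewrite mulrBr -e addrK.
    by exists (u + w * z); rewrite mulrDr.
  move=> d dL cd; exists (y d), (y' d + w * y d); have [_ ny] := yP d dL cd.
  have [_ _ pd] := L1p d dL; have [w1 w2] := wP d dL.
  have ey' := y'P d dL cd; split=> //.
    by rewrite mulrDl ey'; ring.
  have [cy'|ncy'] := pselect (colon d (y' d)).
    rewrite addrC => /(idealDr (colon_ideal d) cy')/pd[|//].
    by apply: w2; apply.
  move=> H; apply: (ncy'); apply: idealDr H; first exact: colon_ideal.
  by apply: (idealMl _ (colon_ideal d)); apply: w1.
exists (map adj L1); split.
- move=> _ /mapP[c cL ->]; have [e _] := adjP c cL; have [_ c1 cp] := L1p c cL.
  split; [exact: colon_ideal | by move=> /e |].
  by move=> a b /e/cp[/e|/e]; [left | right].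
- move=> y yL z; apply: L0reg => c0 c0L c0y.
  have cL : rep c0 \in L1 by rewrite mem_undup map_f.
  have [e _] := adjP _ cL; apply: (yL (adj (rep c0))); first exact: map_f.
  exact/e/srep.
- move=> _ _ /mapP[c cL ->] /mapP[d dL ->] ncd.
  have [_ H] := adjP c cL; have [e _] := adjP d dL.
  have [|y [y' [ny eq ny']]] := H d dL; first by apply: contraNneq ncd => ->.
  by exists y, y'; split=> // /e.
Qed.

End Divisors.

(** * Weierstrass preparation over a normal local ring *)

Section FiniteOverComplete.
Variables (R S : comNzRingType) (mR : idealr R) (m : idealr S).
Variables (rho : {rmorphism R -> S}) (tau : R).
Hypotheses (nS : noeth S) (R_complete : adic_complete mR).
Hypotheses (rho_m : forall r, r \in mR -> rho r \in m) (mtau : tau \in mR).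
Local Notation pw := (@ideal_pow S m).
Local Notation E := (completion m).
Local Notation iota := (completion_map m : {rmorphism S -> E}).
Local Notation scalar := (fun c : S => exists r, c = rho r).
Let t := rho tau.

Lemma scalar0 : scalar 0. Proof. by exists 0; rewrite rmorph0. Qed.

Lemma scalarD c d : scalar c -> scalar d -> scalar (c + d).
Proof. by move=> [r ->] [r' ->]; exists (r + r'); rewrite rmorphD. Qed.

Lemma lincomb_scalar_sub (s s' : seq S) a : {subset s <= s'} ->
  lincomb scalar s a -> lincomb scalar s' a.
Proof.
move=> ss'; move: a; apply: lincomb_ind => [|a b|x c /ss' xs sc].
- exact: lincomb0 scalar0.
- exact: (lincombD scalarD).
- by apply: lincomb_mem => //; exact: scalar0.
Qed.

Lemma quotient_pow_fg (es : seq S) :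
  (forall s, exists2 e, lincomb scalar es e & s - e \in m) ->
  forall N, exists es', forall s, exists2 e, lincomb scalar es' e & pw N (s - e).
Proof.
move=> fg1; elim=> [|N [es' fgN]]; first by exists [::] => s; exists 0.
have [hs [hsN gen]] := nS (pow_ideal m N).
pose es'' := es' ++ [seq h * e | h <- hs, e <- es]; exists es'' => s.
have [e se ue] := fgN s.
suff [v sv uv] : exists2 v, lincomb scalar es'' v & pw N.+1 (s - e - v).
  exists (e + v); last by rewrite opprD addrA.
  apply: (lincombD scalarD) => //.
  by apply: lincomb_scalar_sub se => x xs; rewrite mem_cat xs.
move: (s - e) (gen _ ue); apply: lincomb_ind => [|a b [v sv av] [w sw bw]|h c hhs _].
- exists 0; first exact: lincomb0 scalar0.
  by rewrite subrr; exact: (ideal0 (pow_ideal m N.+1)).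
- exists (v + w); first exact: (lincombD scalarD).
  by rewrite opprD addrACA; exact: (idealD (pow_ideal m N.+1)).
- have [d sd cd] := fg1 c; exists (h * d).
    move: d sd {cd}; apply: lincomb_ind => [|a b sa sb|x r xes sr].
    + by rewrite mulr0; apply: lincomb0 scalar0.
    + by rewrite mulrDr; apply: (lincombD scalarD).
    + rewrite mulrCA; apply: lincomb_mem => //; first exact: scalar0.
      by rewrite mem_cat; apply/orP; right; apply/allpairsP; exists (h, x).
  rewrite mulrC -mulrBr -addn1; apply: powM; first exact: hsN.
  exact/pow1P.
Qed.

(** Completeness of [R] enters here: the coefficient of each generator is a power series in [tau],
    which converges in [R], so the sum exists in [S] and not merely in its completion. *)
Lemma scalar_series (es : seq S) (e : nat -> S) : (forall k, lincomb scalar es (e k)) ->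
  exists y, forall n, pw n (y - \sum_(k < n) t ^+ k * e k).
Proof.
elim: es e => [|x es IHes] e se.
  exists 0 => n; rewrite big1 ?subrr; last by move=> i _; rewrite (se i) mulr0.
  exact: (ideal0 (pow_ideal m n)).
have /choice[r rP] : forall k, exists r, lincomb scalar es (e k - rho r * x).
  by move=> k; have [_ [[r ->] sr]] := se k; exists r.
have [y yP] := IHes _ rP.
have [k|z zP] := fil_complete (m := mR)
    (u := fun n => completion_map mR (\sum_(k < n) tau ^+ k * r k)).
  rewrite -rmorphB big_ord_recr addrAC subrr add0r; apply/fil_iota.
  by apply: (idealMl _ (pow_ideal mR k)); exact: powX.
have [back _ backK] := R_complete.
exists (y + rho (back z) * x) => n.
have -> : y + rho (back z) * x - \sum_(k < n) t ^+ k * e k =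
    y - \sum_(k < n) t ^+ k * (e k - rho (r k) * x) +
    x * rho (back z - \sum_(k < n) tau ^+ k * r k).
  have -> : \sum_(k < n) t ^+ k * (e k - rho (r k) * x) =
      \sum_(k < n) t ^+ k * e k - x * \sum_(k < n) rho (tau ^+ k * r k).
    rewrite mulr_sumr -sumrB; apply: eq_bigr => k _.
    by rewrite rmorphM rmorphXn -/t; ring.
  by rewrite rmorphB rmorph_sum; ring.
apply: (idealD (pow_ideal m n)) => //; apply: (idealM (pow_ideal m n)).
apply: (pow_map rho_m); apply/fil_iota; rewrite rmorphB.
by have := zP n; rewrite -{1}(backK z).
Qed.

(** Every [w] is [e + f * g + t * w'] with [e] in the finite [R]-module spanned by [es']. Iterating
    on [w'], the terms [e] sum to an element of [S] and the terms [g] to one of [E]. *)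
Lemma finite_over_complete (es : seq S) (f : E) (M : nat) :
  (forall s, exists2 e, lincomb scalar es e & s - e \in m) ->
  (forall z, fil M z -> exists g h, z = f * g + iota t * h) ->
  forall z, exists s h, z = iota s + f * h.
Proof.
move=> fg1 fM z; have [es' fgM] := quotient_pow_fg fg1 M.
have step (w : E) : exists x : S * E * E,
    lincomb scalar es' x.1.1 /\ w = iota x.1.1 + f * x.1.2 + iota t * x.2.
  have [a wa] := fil_dense M w; have [e se ae] := fgM a.
  have [|g [h egh]] := fM (w - iota e).
    have -> : w - iota e = w - iota a + iota (a - e) by rewrite rmorphB; ring.
    by apply: (idealD (fil_ideal m M)) => //; apply/fil_iota.
  by exists (e, g, h); split=> //=; rewrite -addrA -egh addrC subrK.
have [nx nxP] := choice step.
pose u k := iter k (fun w => (nx w).2) z.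
pose e k := (nx (u k)).1.1; pose g k := (nx (u k)).1.2.
have zE n : z = iota (\sum_(k < n) t ^+ k * e k) +
    f * (\sum_(k < n) iota t ^+ k * g k) + iota t ^+ n * u n.
  elim: n => [|n IHn]; first by rewrite !big_ord0 rmorph0 mulr0 !add0r mul1r.
  rewrite {1}IHn !big_ord_recr /= rmorphD rmorphM rmorphXn.
  rewrite {1}[u n](nxP (u n)).2 -/(e n) -/(g n) exprS; ring.
have [y yP] := scalar_series (fun k => (nxP (u k)).1).
have tn n : fil n (iota t ^+ n).
  by rewrite -rmorphXn; apply/fil_iota/powX/rho_m.
have [n|h hP] := fil_complete (u := fun n => \sum_(k < n) iota t ^+ k * g k).
  by rewrite big_ord_recr addrAC subrr add0r; apply: (idealMl _ (fil_ideal m n)).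
exists y, h; apply: fil_eq => n; rewrite {1}(zE n).
have -> : iota (\sum_(k < n) t ^+ k * e k) + f * (\sum_(k < n) iota t ^+ k * g k) +
    iota t ^+ n * u n - (iota y + f * h) =
  u n * iota t ^+ n - iota (y - \sum_(k < n) t ^+ k * e k) -
    f * (h - \sum_(k < n) iota t ^+ k * g k) by rewrite rmorphB; ring.
apply: (idealB (fil_ideal m n)); last exact: (idealM (fil_ideal m n)).
apply: (idealB (fil_ideal m n)); first exact: (idealM (fil_ideal m n)).
exact/fil_iota.
Qed.

End FiniteOverComplete.

Section Vertical.
Variables (S : comNzRingType) (m : idealr S).
Hypotheses (nS : noeth S) (Sm : local_ring m) (Snorm : normal_domain S).
Variables (t : S) (t0 : t != 0) (mt : t \in m) (L : seq S).
Local Notation pw := (@ideal_pow S m).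
Local Notation E := (completion m).
Local Notation iota := (completion_map m : {rmorphism S -> E}).
Let domS : is_domain S := Snorm.1.

(* The closure of the extension of the associated prime [colon t c]. *)
Definition vert c (z : E) := forall n, exists2 y, colon t c y & fil n (z - iota y).

Hypothesis Lprime : forall c, c \in L -> prime_ideal (colon t c).
Hypothesis Lreg : forall y, (forall c, c \in L -> ~ colon t c y) ->
  forall z, dvd t (y * z) -> dvd t z.
Hypothesis Lunit : forall c d, c \in L -> d \in L -> c != d ->
  exists y y', [/\ ~ colon t d y, c * y = t * y' & ~ colon t d y'].
Hypothesis vert_prime : forall c, c \in L -> forall f g,
  vert c (f * g) -> vert c f \/ vert c g.
Hypothesis vert_dim : forall c, c \in L -> forall f, ~ vert c f ->
  exists M, forall z, pw M z -> exists g, vert c (iota z - f * g).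
Hypothesis finite_quotient : forall f M,
  (forall z, fil M z -> exists g h, z = f * g + iota t * h) ->
  forall z, exists s h, z = iota s + f * h.

Lemma vert_ideal c : ideal (vert c).
Proof.
have ic := colon_ideal t c; split.
- move=> n; exists 0; first exact: ideal0.
  by rewrite rmorph0 subrr; exact: (ideal0 (fil_ideal m n)).
- move=> u v uP vP n; have [y cy uy] := uP n; have [y' cy' vy'] := vP n.
  exists (y + y'); first exact: idealD.
  by rewrite rmorphD opprD addrACA; exact: (idealD (fil_ideal m n)).
- move=> a u uP n; have [b ab] := fil_dense n a; have [y cy uy] := uP n.
  exists (b * y); first exact: idealM.
  have -> : a * u - iota (b * y) = u * (a - iota b) + iota b * (u - iota y).
    by rewrite rmorphM; ring.
  by apply: (idealD (fil_ideal m n)); apply: (idealM (fil_ideal m n)).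
Qed.

Lemma vert_iota c y : vert c (iota y) <-> colon t c y.
Proof.
split=> [|cy n]; last first.
  by exists y => //; rewrite subrr; exact: (ideal0 (fil_ideal m n)).
exact: (contraction nS Sm (colon_ideal t c)).
Qed.

Lemma vert_prime_ideal c : c \in L -> prime_ideal (vert c).
Proof.
move=> cL; split; [exact: vert_ideal | | exact: vert_prime].
by rewrite -(rmorph1 iota) => /vert_iota; have [] := Lprime cL.
Qed.

Lemma iota_reg y : y != 0 -> forall z, iota y * z = 0 -> z = 0.
Proof.
move=> y0; apply: (iota_regular nS) => a /domS[/eqP|//].
by rewrite (negPf y0).
Qed.

Lemma iota_cancel y : y != 0 -> forall z w, iota y * z = iota y * w -> z = w.
Proof.
move=> y0 z w e; apply/eqP; rewrite -subr_eq0; apply/eqP/(iota_reg y0).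
by rewrite mulrBr e subrr.
Qed.

Lemma iota_cancelX n z w : iota t ^+ n * z = iota t ^+ n * w -> z = w.
Proof.
elim: n z w => [|n IHn] z w; first by rewrite !mul1r.
by rewrite exprS -!mulrA => /(iota_cancel t0)/IHn.
Qed.

Lemma tE_ideal : ideal (fun z : E => exists g, z = iota t * g).
Proof.
split; first by exists 0; rewrite mulr0.
  by move=> _ _ [u ->] [v ->]; exists (u + v); rewrite mulrDr.
by move=> a _ [u ->]; exists (a * u); rewrite mulrCA.
Qed.

Lemma vert_dvd c f : vert c f -> exists f', iota c * f = iota t * f'.
Proof.
move=> cf; apply: (closureE nS (J := fun z => exists g, iota c * z = iota t * g) _ (z := f)).
  split; first by exists 0; rewrite !mulr0.
    by move=> u v [u' eu] [v' ev]; exists (u' + v'); rewrite !mulrDr eu ev.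
  by move=> a u [u' eu]; exists (a * u'); rewrite mulrCA eu mulrCA.
move=> n; have [y [w cy] fy] := cf n; exists (iota y) => //.
by exists (iota w); rewrite -!rmorphM cy.
Qed.

Lemma regular_mod_t y : (forall c, c \in L -> ~ colon t c y) ->
  forall z g, iota y * z = iota t * g -> exists h, z = iota t * h.
Proof.
move=> yL z g e; apply: (closureE nS tE_ideal) => n.
have iI : ideal (dvd t).
  split; first by exists 0; rewrite mulr0.
    by move=> _ _ [u ->] [v ->]; exists (u + v); rewrite mulrDr.
  by move=> a _ [u ->]; exists (a * u); rewrite mulrCA.
have [|_ [w ->] zw] := closure_regular nS iI (Lreg yL) (z := z) _ n.
  move=> k; have [b gb] := fil_dense k g; exists (t * b); first by exists b.
  by rewrite e rmorphM -mulrBr; apply: (idealM (fil_ideal m k)).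
by exists (iota (t * w)) => //; exists (iota w); rewrite -rmorphM.
Qed.

(* [finv c f] and [infv c f] say that [f] has finite, resp. infinite, valuation at
   the discrete valuation ring of the completion at [vert c]; [c / t] is the inverse of
   a uniformizer. *)
Definition finv c (f : E) :=
  exists n f', ~ vert c f' /\ iota c ^+ n * f = iota t ^+ n * f'.

Definition infv c (f : E) :=
  forall n, exists2 f', vert c f' & iota c ^+ n * f = iota t ^+ n * f'.

Lemma infv_vert c f : infv c f -> vert c f.
Proof. by move=> /(_ 0%N)[f' cf']; rewrite !mul1r => ->. Qed.

Lemma nvert_finv c f : ~ vert c f -> finv c f.
Proof. by move=> ncf; exists 0%N, f; rewrite !mul1r. Qed.

Lemma finv_ninfv c f : finv c f -> ~ infv c f.
Proof.
move=> [n [f' [nf' e]]] /(_ n)[f'' cf'']; rewrite e => /iota_cancelX e'.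
by apply: nf'; rewrite e'.
Qed.

Lemma nfinv_infv c f : ~ finv c f -> infv c f.
Proof.
move=> nfin; elim=> [|n [f' cf' e]].
  by exists f => //; apply: contrapT => /nvert_finv/nfin.
have [f'' e'] := vert_dvd cf'.
have e'' : iota c ^+ n.+1 * f = iota t ^+ n.+1 * f''.
  by rewrite exprS -mulrA e mulrCA e' exprSr -mulrA.
by exists f'' => //; apply: contrapT => nf''; apply: nfin; exists n.+1, f''.
Qed.

Lemma infv_ideal c : ideal (infv c).
Proof.
split.
- by move=> n; exists 0; rewrite ?mulr0 //; exact: (ideal0 (vert_ideal c)).
- move=> u v uP vP n; have [u' cu eu] := uP n; have [v' cv ev] := vP n.
  exists (u' + v'); first exact: (idealD (vert_ideal c)).
  by rewrite !mulrDr eu ev.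
- move=> a u uP n; have [u' cu eu] := uP n; exists (a * u').
    exact: (idealM (vert_ideal c)).
  by rewrite mulrCA eu mulrCA.
Qed.

Lemma finvM c f g : c \in L -> finv c f -> finv c g -> finv c (f * g).
Proof.
move=> cL [n [f' [nf' ef]]] [k [g' [ng' eg]]]; exists (n + k)%N, (f' * g'); split.
  by move=> /(vert_prime cL)[].
by rewrite !exprD mulrACA ef eg mulrACA.
Qed.

Lemma infv_prime c : c \in L -> prime_ideal (infv c).
Proof.
move=> cL; split; [exact: infv_ideal | by move=> /infv_vert; have [] := vert_prime_ideal cL |].
move=> f g fg; have [ff|/nfinv_infv] := pselect (finv c f); last by left.
have [fing|/nfinv_infv] := pselect (finv c g); last by right.
by case: (finv_ninfv (finvM cL ff fing)).
Qed.

Lemma finv_iota c y : c \in L -> y != 0 -> finv c (iota y).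
Proof.
move=> cL /(val_finite nS Snorm t0 (Lprime cL))[n [z [e nz]]].
exists n, (iota z); split; first by move=> /vert_iota.
by rewrite -!rmorphXn -!rmorphM e.
Qed.

Lemma infv_mulI c y f : c \in L -> y != 0 -> infv c (iota y * f) -> infv c f.
Proof.
move=> cL y0; have [_ _ pc] := infv_prime cL => /pc[|//].
by move/(finv_ninfv (finv_iota cL y0)).
Qed.

Lemma infv_eq c y y' f f' : c \in L -> y' != 0 ->
  iota y * f = iota y' * f' -> infv c f -> infv c f'.
Proof.
move=> cL y0 e fi; apply: (infv_mulI cL y0); rewrite -e.
exact: (idealM (infv_ideal c)).
Qed.

Lemma vertical_neq0 c : c \in L -> c != 0.
Proof. by move=> /Lprime/colon_zero. Qed.

(* [reduces f f' w]: multiplying [f] by the fractions [c / t], for [c] in [w],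
   gives [f'] without creating new zeros along the [vert d]. *)
Definition reduces (f f' : E) (w : seq S) := [/\ {subset w <= L},
  iota (\prod_(c <- w) c) * f = iota t ^+ size w * f',
  forall d, d \in L -> vert d f' -> vert d f,
  forall d, d \in L -> infv d f' -> infv d f &
  forall g, (forall d, d \in L -> infv d g \/ infv d (f - g)) ->
    exists2 g', iota (\prod_(c <- w) c) * g = iota t ^+ size w * g' &
      forall d, d \in L -> infv d g' \/ infv d (f' - g')].

Lemma reduces_refl f : reduces f f [::].
Proof.
split=> //; first by rewrite big_nil rmorph1 !mul1r.
by move=> g gP; exists g; rewrite // big_nil rmorph1 !mul1r.
Qed.

Lemma reduces_trans f g h v w : reduces f g v -> reduces g h w -> reduces f h (v ++ w).
Proof.
move=> [vL ef fv fi fr] [wL eg gv gi gr].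
have cat_mul a b c : iota (\prod_(c <- v) c) * a = iota t ^+ size v * b ->
    iota (\prod_(c <- w) c) * b = iota t ^+ size w * c ->
    iota (\prod_(c <- v ++ w) c) * a = iota t ^+ size (v ++ w) * c.
  move=> e e'; rewrite big_cat rmorphM size_cat exprD /= -mulrA mulrCA e mulrCA e'.
  by rewrite mulrA.
split; first by move=> c; rewrite mem_cat => /orP[/vL|/wL].
- exact: cat_mul ef eg.
- by move=> d dL /(gv d dL)/(fv d dL).
- by move=> d dL /(gi d dL)/(fi d dL).
move=> a /fr[a' ea /gr[a'' ea' aP]]; exists a'' => //; exact: cat_mul ea ea'.
Qed.

(** By the choice of [L], the fraction [c / t] is a unit at every other [vert d], so no new zero
    appears there. Infinite valuations persist since [infv d] is a prime containing no nonzero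
    element of [S]. In a splitting of [f] the part [g] lies in [vert c] in either case, as [f]
    does. *)
Lemma reduces_step c f f' : c \in L -> vert c f -> iota c * f = iota t * f' ->
  reduces f f' [:: c].
Proof.
move=> cL cf e; split; first by move=> d; rewrite inE => /eqP ->.
- by rewrite big_seq1 expr1.
- move=> d dL; have [<- //|cd] := eqVneq c d.
  have [y [y' [ny ey ny']]] := Lunit cL dL cd.
  have [iP _ pP] := vert_prime_ideal dL => df'.
  have /pP[/vert_iota//|//] : vert d (iota y' * f).
  have -> : iota y' * f = iota y * f'; last exact: (idealM iP).
  apply: (iota_cancel t0); rewrite [RHS]mulrCA -e !mulrA -!rmorphM -ey.
  by rewrite [y * c]mulrC.
- by move=> d dL; exact: (infv_eq dL (vertical_neq0 cL) (esym e)).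
move=> g gP.
have cg : vert c g.
  have [/infv_vert//|/infv_vert cfg] := gP c cL.
  rewrite -(subKr f g); exact: (idealB (vert_ideal c)).
have [g' eg] := vert_dvd cg; exists g'; first by rewrite big_seq1 expr1.
move=> d dL; have [gi|gi] := gP d dL; [left | right].
  exact: (infv_eq dL t0 eg).
by apply: (infv_eq (y := c) dL t0 _ gi); rewrite !mulrBr e eg.
Qed.

Lemma reduces_at c f : c \in L -> finv c f -> exists f' w, reduces f f' w /\ ~ vert c f'.
Proof.
move=> cL [n [f' [nf' e]]]; elim: n f e => [|n IHn] f e.
  exists f, [::]; split; first exact: reduces_refl.
  by move: e; rewrite !mul1r => ->.
have [cf|ncf] := pselect (vert c f); last first.
  by exists f, [::]; split=> //; exact: reduces_refl.
have [g eg] := vert_dvd cf.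
have [|f'' [w [fr nf'']]] := IHn g.
  apply: (iota_cancel t0); rewrite mulrCA -eg mulrA -exprSr e exprS.
  by rewrite -mulrA.
exists f'', ([:: c] ++ w); split=> //.
exact: reduces_trans (reduces_step cL cf eg) fr.
Qed.

Lemma reduction f : (forall c, c \in L -> finv c f) ->
  exists f' w, reduces f f' w /\ forall c, c \in L -> ~ vert c f'.
Proof.
move=> ffin.
(* The condition [c \in L] is doubled so that one copy can become membership in the list of the
   induction while the other stays. *)
suff [f' [w [fr f'L]]] : exists f' w, reduces f f' w /\
  forall c, c \in L -> c \in L -> ~ vert c f' by exists f', w; split=> // c cL; apply: f'L.
elim: {1}L => [|c s [f' [w [fr f's]]]]; first by exists f, [::]; split=> //; exact: reduces_refl.
have [cL|ncL] := boolP (c \in L); last first.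
  exists f', w; split=> // d; rewrite inE => /orP[/eqP ->|]; last exact: f's.
  by rewrite (negPf ncL).
have [_ _ _ fi _] := fr.
have [|f'' [w' [fr' nf'']]] := reduces_at (f := f') cL.
  by apply: contrapT => /nfinv_infv/(fi c cL); apply: finv_ninfv; exact: ffin.
exists f'', (w ++ w'); split; first exact: reduces_trans fr fr'.
move=> d; rewrite inE => /orP[/eqP -> _ //|ds dL].
by have [_ _ vd _ _] := fr' => /(vd d dL); exact: f's.
Qed.

Lemma word_neq0 w : {subset w <= L} -> \prod_(c <- w) c != 0.
Proof.
elim: w => [|c w IHw] wL; first by rewrite big_nil oner_eq0.
rewrite big_cons; apply/eqP => /domS[]/eqP.
  by rewrite (negPf (vertical_neq0 (wL c (mem_head c w)))).
by rewrite (negPf (IHw _)) // => d dw; apply: wL; rewrite inE dw orbT.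
Qed.

(** The reduction of [t] itself: up to [y], [t] is the product of the uniformizers belonging to [w].
    With [W] the product of [w], it turns divisibility of [W * e] by [t ^ (size w).+1 / t] into
    divisibility of [y * e], hence of [e], by [t]. *)
Lemma word_t : exists w y, [/\ {subset w <= L},
  \prod_(c <- w) c * t = t ^+ size w * y, forall c, c \in L -> ~ colon t c y &
  forall b, (forall d, d \in L -> infv d b) ->
    exists2 b', iota (\prod_(c <- w) c) * b = iota t ^+ size w * b' &
      forall d, d \in L -> infv d b'].
Proof.
have [c cL|f' [w [[wL e _ _ wr] f'L]]] := @reduction (iota t).
  exact: finv_iota.
rewrite -rmorphM -rmorphXn in e; have [y ey] := iota_dvd nS Sm e.
have ef' : f' = iota y.
  by apply: (@iota_cancelX (size w)); rewrite -rmorphXn -e ey rmorphM.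
exists w, y; split=> // [c cL|b bi].
  by move=> /vert_iota; rewrite -ef'; exact: f'L.
have [|b' eb _] := wr b; first by move=> d dL; left; exact: bi.
exists b' => // d dL; rewrite -rmorphXn in eb.
apply: (infv_eq dL _ eb); last exact: bi.
by elim: (size w) => [|n IHn]; rewrite ?oner_eq0 // exprS; apply/eqP => /domS[]/eqP;
  rewrite ?(negPf t0) ?(negPf IHn).
Qed.

(** Such an [f] is divisible by [t] with a quotient of the same kind, so it lies in all
    [t ^ n E]. *)
Lemma infv_all_eq0 f : (forall d, d \in L -> infv d f) -> f = 0.
Proof.
have [w [y [wL ey yL wb]]] := word_t.
have step g : (forall d, d \in L -> infv d g) ->
    exists2 g', g = iota t * g' & forall d, d \in L -> infv d g'.
  move=> gi; have [b eb bi] := wb g gi.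
  have eyb : iota y * g = iota t * b.
    apply: (@iota_cancelX (size w)); rewrite mulrA -rmorphXn -rmorphM -ey rmorphM.
    by rewrite mulrAC eb rmorphXn mulrAC mulrA.
  have [h eh] := regular_mod_t yL eyb; exists h => // d dL.
  by apply: (infv_mulI dL t0); rewrite -eh; exact: gi.
move=> fi; apply: fil_sep => n.
have [g ->] : exists g, f = iota t ^+ n * g.
  suff [g e _] : exists2 g, f = iota t ^+ n * g & forall d, d \in L -> infv d g by exists g.
  elim: n => [|n [g e gi]]; first by exists f; rewrite ?mul1r.
  by have [h eh hi] := step g gi; exists h; rewrite // e eh exprSr mulrA.
by apply: (idealMl _ (fil_ideal m n)); rewrite -rmorphXn; apply/fil_iota/powX.
Qed.

(** For each [c] in the word [w] of [t], some power of [m] lies in [f E + vert c]. Multiplying along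
    the word, with multiplicities, leaves modulo [f] an element [e] such that [W * e] is divisible
    by [t ^ size w], hence [e] by [t]. *)
Lemma nonvertical_dim f : (forall c, c \in L -> ~ vert c f) ->
  exists M, forall z, fil M z -> exists g h, z = f * g + iota t * h.
Proof.
move=> fL; have [w [y [wL ey yL _]]] := word_t.
suff [M MP] : exists M, forall z, pw M z -> exists g e h,
    iota z = f * g + e /\ iota (\prod_(c <- w) c) * e = iota t ^+ size w * h.
  exists M; apply: (fil_sub nS).
    split; first by exists 0, 0; rewrite !mulr0 addr0.
      move=> _ _ [g [h ->]] [g' [h' ->]]; exists (g + g'), (h + h').
      by rewrite !mulrDr addrACA.
    by move=> a _ [g [h ->]]; exists (a * g), (a * h); ring.
  move=> z /MP[g [e [h [ez ew]]]].
  have [|h' eh'] := regular_mod_t yL (z := e) (g := h); last by exists g, h'; rewrite ez eh'.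
  apply: (@iota_cancelX (size w)); rewrite mulrA -rmorphXn -rmorphM -ey rmorphM.
  by rewrite mulrAC ew rmorphXn mulrAC mulrA.
elim: w {ey} wL => [|c w IHw] wL.
  exists 0%N => z _; exists 0, (iota z), (iota z).
  by rewrite mulr0 add0r big_nil rmorph1 !mul1r.
have [|M MP] := IHw; first by move=> d dw; apply: wL; rewrite inE dw orbT.
have cL : c \in L by apply: wL; exact: mem_head.
have [N NP] := vert_dim cL (fL c cL).
exists (N + M)%N; apply: pow_min.
  split; first by exists 0, 0, 0; rewrite rmorph0 !mulr0 addr0.
    move=> u v [g [e [h [eu ew]]]] [g' [e' [h' [ev ew']]]].
    exists (g + g'), (e + e'), (h + h').
    by rewrite rmorphD eu ev !mulrDr ew ew' addrACA.
  move=> a u [g [e [h [eu ew]]]]; exists (iota a * g), (iota a * e), (iota a * h).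
  by rewrite rmorphM eu mulrDr; split; [ring | rewrite mulrCA ew mulrCA].
move=> a b /NP[g ag] /MP[g' [e [h [eb ew]]]].
have [k ek] := vert_dvd ag.
exists (g * iota b + (iota a - f * g) * g'), ((iota a - f * g) * e), (k * h); split.
  by rewrite rmorphM eb; ring.
rewrite big_cons rmorphM mulrACA ek ew /= exprS; ring.
Qed.

Lemma nonvertical_quotient f : (forall c, c \in L -> ~ vert c f) ->
  forall z, exists s h, z = iota s + f * h.
Proof. by move=> /nonvertical_dim[M MP]; exact: finite_quotient MP. Qed.

Lemma nonvertical_weierstrass f : (forall c, c \in L -> ~ vert c f) ->
  exists a u, is_unit u /\ f = iota a * u.
Proof.
move=> fL; have [f1|/(completion_unit Sm) fu] := pselect (fil 1 f); last first.
  by exists 1, f; rewrite rmorph1 mul1r.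
have fE := nonvertical_quotient fL.
pose J z := exists s h, [/\ s \in m, fil 1 h & z = iota s + f * h].
have i1 := fil_ideal m 1.
have iJ : ideal J.
  split.
  - exists 0, 0; rewrite rmorph0 mulr0 addr0 idealr0; split=> //; exact: ideal0.
  - move=> _ _ [s [h [ms h1 ->]]] [s' [h' [ms' h1' ->]]]; exists (s + s'), (h + h').
    rewrite rpredD // rmorphD mulrDr addrACA; split=> //; exact: idealD.
  - move=> a _ [s [h [ms h1 ->]]]; have [s' [h' ea]] := fE a.
    exists (s' * s), (h' * iota s + a * h); rewrite idealMr //; split=> //.
      apply: idealD => //; apply: idealM => //.
      exact/fil_iota/pow1P.
    by rewrite mulrDr {1}ea rmorphM; ring.
have [s [h [ms h1 ef]]] : J f.
  apply: (fil_sub nS iJ _ f1) => a /pow1P ma; exists a, 0.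
  by rewrite mulr0 addr0; split=> //; exact: ideal0.
have [v ev] := fil1_unit h1; exists s, v; split; first by exists (1 - h); rewrite mulrC.
have -> : iota s = f * (1 - h) by rewrite mulrBr mulr1 {1}ef addrK.
by rewrite -mulrA [_ * v]mulrC ev mulr1.
Qed.

(** The multiplications are undone: with [W] the product of the word and [f = a * u], [W] divides
    [t ^ size w * a] in [E], hence in [S]. *)
Lemma finite_weierstrass b : (forall c, c \in L -> finv c b) ->
  exists a u, is_unit u /\ b = iota a * u.
Proof.
move=> bfin; have [f [w [[wL e _ _ _] fL]]] := reduction bfin.
have [a [u [[v vu] ef]]] := nonvertical_weierstrass fL.
have W0 := word_neq0 wL; set W := \prod_(c <- w) c in e W0.
have eW : iota (t ^+ size w * a) = iota W * (b * v).
  by rewrite mulrA e ef rmorphM rmorphXn -!mulrA [u * v]mulrC vu mulr1.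
have [a' ea'] := iota_dvd nS Sm eW.
exists a', u; split; first by exists v.
have -> : iota a' = b * v by apply: (iota_cancel W0); rewrite -eW ea' rmorphM.
by rewrite -mulrA vu mulr1.
Qed.

(* The relation [b_n = \sum_(k < n) e_k b_k] between the iterates
   [b_n = (c / t) ^ n b] gives an annihilator of [b] of valuation [- n] at [vert c]. *)
Lemma infv_annihilator c b : c \in L -> infv c b -> exists2 g, g * b = 0 & finv c g.
Proof.
move=> cL bi; have /choice[u uP] : forall n, exists f', iota c ^+ n * b = iota t ^+ n * f'.
  by move=> n; have [f' _ e] := bi n; exists f'.
have [n [e un]] := noeth_sequence u (completion_noeth (m := m) nS).
have [p [s [cp eps ncs]]] := uniformizer nS Snorm t0 (Lprime cL).
exists (iota c ^+ n - \sum_(k < n) e k * iota c ^+ k * iota t ^+ (n - k)).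
  rewrite mulrBl uP un mulr_sumr mulr_suml -sumrB big1 // => k _.
  have -> : iota t ^+ n = iota t ^+ (n - k) * iota t ^+ k by rewrite -exprD subnK // ltnW.
  have -> : e k * iota c ^+ k * iota t ^+ (n - k) * b =
    e k * iota t ^+ (n - k) * (iota c ^+ k * b) by ring.
  by rewrite uP; ring.
set g := _ - _; apply: contrapT => /nfinv_infv gi.
have [iI _ pI] := infv_prime cL.
(* [h] is [p ^ n * g / t ^ n], computed with [c * p = t * s]. All terms of the sum contain [p], so
   [h] is congruent to [s ^ n] modulo [vert c] and lies outside it. *)
pose h := iota s ^+ n - \sum_(k < n) e k * iota s ^+ k * iota p ^+ (n - k).
have eps' : iota c * iota p = iota t * iota s by rewrite -!rmorphM eps.
have eh : iota p ^+ n * g = iota t ^+ n * h.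
  rewrite /g /h !mulrBr -!exprMn [iota p * _]mulrC eps' !mulr_sumr.
  congr (_ - _); apply: eq_bigr => k _.
  have -> : iota p ^+ n = iota p ^+ (n - k) * iota p ^+ k by rewrite -exprD subnK // ltnW.
  have -> : iota t ^+ n = iota t ^+ (n - k) * iota t ^+ k by rewrite -exprD subnK // ltnW.
  have -> : iota p ^+ (n - k) * iota p ^+ k * (e k * iota c ^+ k * iota t ^+ (n - k)) =
    e k * (iota c * iota p) ^+ k * iota p ^+ (n - k) * iota t ^+ (n - k).
    by rewrite exprMn; ring.
  by rewrite eps' exprMn; ring.
have : infv c (iota t ^+ n * h) by rewrite -eh; apply: (idealM iI).
case/pI => [|/infv_vert ch].
  by move/(prime_idealX (infv_prime cL)); apply: finv_ninfv; exact: finv_iota.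
have [iV _ _] := vert_prime_ideal cL; apply: ncs; apply/vert_iota.
apply: (prime_idealX (n := n) (vert_prime_ideal cL)); apply: (idealBr iV _ ch).
apply: (ideal_sum _ iV) => k _; have -> : (n - k = (n - k.+1).+1)%N by have := ltn_ord k; lia.
by apply: (idealM iV); rewrite exprS; apply: (idealMl _ iV); apply/vert_iota.
Qed.

Theorem vertical_weierstrass b : exists a u, is_unit u /\ b = iota a * u.
Proof.
have [bfin|/existsNP[c1 /not_implyP[c1L /nfinv_infv c1i]]] :=
  pselect (forall c, c \in L -> finv c b); first exact: finite_weierstrass.
have [->|/eqP b0] := pselect (b = 0).
  by exists 0, 1; rewrite rmorph0 mul0r; split=> //; exists 1; rewrite mulr1.
have [c2 c2L c2f] : exists2 c, c \in L & finv c b.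
  apply: contrapT => nf; move/eqP: b0; apply; apply: infv_all_eq0 => d dL.
  by apply: nfinv_infv => df; apply: nf; exists d.
exfalso.
(* The annihilator of [b] is contained in none of the primes [infv c] at which [b] has infinite
   valuation, so a single annihilator [g] avoids all of them. *)
have [|c|c|g gb gP] := @prime_avoidance E S (fun g => g * b = 0) infv
    [seq c <- L | `[< infv c b >]].
- split; first by rewrite mul0r.
    by move=> u v eu ev; rewrite mulrDl eu ev addr0.
  by move=> a u eu; rewrite -mulrA eu mulr0.
- by rewrite mem_filter => /andP[_ cL]; exact: infv_prime.
- rewrite mem_filter => /andP[/asboolP ci cL].
  by have [g gb /finv_ninfv gf] := infv_annihilator cL ci; exists g.
have gi c : c \in L -> finv c b -> infv c g.
  move=> cL cf; have [iI _ pI] := infv_prime cL.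
  by have /pI[//|/(finv_ninfv cf)//] : infv c (g * b) by rewrite gb; exact: (ideal0 iI).
have gf c : c \in L -> infv c b -> finv c g.
  move=> cL ci; apply: contrapT => /nfinv_infv; apply: gP.
  by rewrite mem_filter cL andbT; apply/asboolP.
have dich c : c \in L -> infv c b \/ infv c g.
  move=> cL; have [cf|/nfinv_infv] := pselect (finv c b); last by left.
  by right; exact: gi.
have sumf c : c \in L -> finv c (b + g).
  move=> cL; apply: contrapT => /nfinv_infv ci; have iI := infv_ideal c.
  have [cb|cg] := dich c cL.
    have /(finv_ninfv (gf c cL cb))// : infv c g.
    by apply: idealDr iI cb _; rewrite addrC.
  have cb := idealDr iI cg ci; exact: (finv_ninfv (gf c cL cb)).
have [h [w [[wL eh _ _ hr] hL]]] := reduction sumf.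
have W0 := word_neq0 wL; set W := \prod_(c <- w) c in eh hr W0.
(* The last clause of [reduces] carries the splitting [b + g] over to [h = b' + g'], so that
   [b' * g' = 0] still holds. *)
have [|b' eb' _] := hr b.
  by move=> d dL; rewrite addrAC subrr add0r; exact: dich.
pose g' := h - b'.
have eg' : iota W * g = iota t ^+ size w * g' by rewrite /g' mulrBr -eb' -eh; ring.
have bg' : b' * g' = 0.
  apply: (@iota_cancelX (size w)); apply: (@iota_cancelX (size w)).
  have -> : iota t ^+ size w * (iota t ^+ size w * (b' * g')) =
    (iota t ^+ size w * b') * (iota t ^+ size w * g') by ring.
  by rewrite -eb' -eg' mulrACA [b * g]mulrC gb; ring.
have [a [u [[v vu] ea]]] := nonvertical_weierstrass hL.
have ahv : iota a = h * v by rewrite ea -mulrA [u * v]mulrC vu mulr1.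
have naL c : c \in L -> ~ vert c (iota a).
  move=> cL ca; apply: (hL c cL); rewrite ea; exact: (idealMl _ (vert_ideal c)).
have a0 : a != 0.
  apply/eqP => ea0; apply: (naL c1 c1L); rewrite ea0 rmorph0.
  exact: (ideal0 (vert_ideal c1)).
pose f1 := b' * v; pose g1 := g' * v.
have fga : f1 + g1 = iota a by rewrite -mulrDl /g' addrC subrK ahv.
have fg0 : f1 * g1 = 0 by rewrite mulrACA bg' mul0r.
(* [a ^ 2] is again outside all [vert c], so [f1] is an element [d] of [S] up to a multiple of
   [a ^ 2]; [d (a - d)] is then divisible by [a ^ 2] in [S], which gives the integral equation of
   [d / a]. *)
have [|d [z ef1]] := @nonvertical_quotient (iota (a * a)) _ f1.
  by move=> c cL; rewrite rmorphM => /(vert_prime cL)[]; exact: naL.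
rewrite rmorphM in ef1.
have ed : iota d = f1 - iota a * iota a * z by rewrite ef1 addrK.
have [mu emu] : exists mu, d * (a - d) = a * a * mu.
  apply: (iota_dvd nS Sm (z := z * (f1 + f1 - iota a - iota a * iota a * z))).
  have -> : completion_map m (d * (a - d)) = iota d * (iota a - iota d) by rewrite -rmorphB -rmorphM.
  have -> : completion_map m (a * a) = iota a * iota a by rewrite -rmorphM.
  rewrite ed; have -> : (f1 - iota a * iota a * z) *
      (iota a - (f1 - iota a * iota a * z)) = f1 * (iota a - f1) +
      iota a * iota a * (z * (f1 + f1 - iota a - iota a * iota a * z)) by ring.
  by rewrite -fga addrAC subrr add0r fg0 add0r.
have [k ek] : exists k, d = a * k.
  apply: (normal_dvd Snorm (n := 2) (e := fun i => if i == 0%N then - mu else 1) a0).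
  rewrite big_ord_recl big_ord1 /= !expr1 !expr0 !mulr1 !mul1r.
  have -> : d ^+ 2 = d * a - d * (a - d) by ring.
  by rewrite emu; ring.
have [e1|e1] : iota k + iota a * z = 0 \/ iota k + iota a * z = 1.
  apply: (completion_idem Sm); apply: (iota_reg a0); apply: (iota_reg a0).
  rewrite -[RHS]fg0 -[g1](addKr f1) fga ef1 ek rmorphM; ring.
- have f10 : f1 = 0 by rewrite ef1 ek rmorphM -mulrA -mulrDr e1 mulr0.
  have b'0 : b' = 0 by rewrite -[b']mulr1 -vu mulrA -/f1 f10 mul0r.
  move/eqP: b0; apply; apply: (iota_reg W0); by rewrite eb' b'0 mulr0.
- have g10 : g1 = 0.
    rewrite -[g1](addKr f1) fga ef1 ek rmorphM -mulrA -mulrDr e1 mulr1.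
    by rewrite addNr.
  have g'0 : g' = 0 by rewrite -[g']mulr1 -vu mulrA -/g1 g10 mul0r.
  have g0 : g = 0 by apply: (iota_reg W0); rewrite eg' g'0 mulr0.
  by apply: (finv_ninfv (gf c1 c1L c1i)); rewrite g0; exact: (ideal0 (infv_ideal c1)).
Qed.

End Vertical.

(** * Graded rings and germs *)

Section Graded.
Variables (R : comNzRingType) (A : comAlgType R) (G : grading A).

Lemma piece0 d : 0 \in G d.
Proof. by have [] := piece_submod G d. Qed.

Lemma pieceZD d r u v : u \in G d -> v \in G d -> r *: u + v \in G d.
Proof. by have [_] := piece_submod G d; apply. Qed.

Lemma pieceD d u v : u \in G d -> v \in G d -> u + v \in G d.
Proof. by move=> Gu Gv; rewrite -[u]scale1r; apply: pieceZD. Qed.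

Lemma pieceZ d r u : u \in G d -> r *: u \in G d.
Proof. by move=> Gu; rewrite -[r *: u]addr0; apply: pieceZD => //; exact: piece0. Qed.

Lemma pieceN d u : u \in G d -> - u \in G d.
Proof. by move=> Gu; rewrite -scaleN1r; apply: pieceZ. Qed.

Lemma piece_sum d (I : Type) (r : seq I) (P : pred I) (F : I -> A) :
  (forall i, P i -> F i \in G d) -> \sum_(i <- r | P i) F i \in G d.
Proof.
move=> GF; apply: (big_ind (fun a => a \in G d)) => //; first exact: piece0.
by move=> u v; apply: pieceD.
Qed.

Lemma pieceX d u n : u \in G d -> u ^+ n \in G (n * d)%N.
Proof.
move=> Gu; elim: n => [|n IHn]; first exact: piece1.
by rewrite exprS mulSn; apply: pieceM.
Qed.

Lemma pieceX1 u n : u \in G 1%N -> u ^+ n \in G n.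
Proof. by move=> /(pieceX n); rewrite muln1. Qed.

Lemma pieceM_sub n j u v : (j <= n)%N -> u \in G j -> v \in G (n - j)%N -> u * v \in G n.
Proof. by move=> jn Gu Gv; rewrite -(subnKC jn); apply: pieceM. Qed.

(** A decomposition into homogeneous components is stored as a polynomial whose value at [1] is the
    element; graded products then become products of polynomials. *)
Definition homogeneous_poly (p : {poly A}) := forall i, p`_i \in G i.

Lemma homogeneous_polyE a : exists p, homogeneous_poly p /\ p.[1] = a.
Proof.
have [n [c [cG ->]]] := piece_generate G a; exists (\poly_(i < n) c i); split.
  by move=> i; rewrite coef_poly; case: ifP => _; [exact: cG | exact: piece0].
by rewrite horner_poly; apply: eq_bigr => i _; rewrite expr1n mulr1.
Qed.

Lemma homogeneous_poly_inj p q : homogeneous_poly p -> homogeneous_poly q ->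
  p.[1] = q.[1] -> p = q.
Proof.
move=> hp hq e; apply/eqP; rewrite -subr_eq0; apply/eqP/polyP => i; rewrite coef0.
have [si|si] := leqP (size (p - q)) i; first exact: nth_default.
apply: (piece_direct (g := G) (n := size (p - q)) (c := fun i => (p - q)`_i)) => //.
  by move=> j; rewrite coefB; apply: pieceD => //; apply: pieceN.
have e0 : (p - q).[1] = 0 by rewrite hornerD hornerN e subrr.
by rewrite -[RHS]e0 horner_coef; apply: eq_bigr => j _; rewrite expr1n mulr1.
Qed.

(* The polynomial [\sum_i a_i X ^ i], where [a_i] is the component of degree [i]
   of [a]. *)
Definition hpoly a : {poly A} := sval (cid (homogeneous_polyE a)).

Lemma hpolyG a i : (hpoly a)`_i \in G i.
Proof. by rewrite /hpoly; case: cid => p [] /=. Qed.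

Lemma hpoly1 a : (hpoly a).[1] = a.
Proof. by rewrite /hpoly; case: cid => p [] /=. Qed.

Lemma hpoly_unique p a : homogeneous_poly p -> p.[1] = a -> hpoly a = p.
Proof.
by move=> hp e; apply: homogeneous_poly_inj => //; [exact: hpolyG | rewrite hpoly1].
Qed.

Lemma hpoly_sum a : a = \sum_(i < size (hpoly a)) (hpoly a)`_i.
Proof.
by rewrite -[LHS](hpoly1 a) horner_coef; apply: eq_bigr => i _; rewrite expr1n mulr1.
Qed.

Lemma hpolyD a b : hpoly (a + b) = hpoly a + hpoly b.
Proof.
apply: hpoly_unique; last by rewrite hornerD !hpoly1.
by move=> i; rewrite coefD; apply: pieceD; exact: hpolyG.
Qed.

Lemma hpolyZ r a : hpoly (r *: a) = (r%:A)%:P * hpoly a.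
Proof.
apply: hpoly_unique; last by rewrite hornerM hornerC hpoly1 mulr_algl.
by move=> i; rewrite coefCM mulr_algl; apply: pieceZ; exact: hpolyG.
Qed.

Lemma hpolyN a : hpoly (- a) = - hpoly a.
Proof.
apply: hpoly_unique; last by rewrite hornerN hpoly1.
by move=> i; rewrite coefN; apply: pieceN; exact: hpolyG.
Qed.

Lemma hpolyM a b : hpoly (a * b) = hpoly a * hpoly b.
Proof.
apply: hpoly_unique; last by rewrite hornerM !hpoly1.
move=> i; rewrite coefM; apply: piece_sum => j _.
by apply: (pieceM_sub (ltnSE (ltn_ord j))); exact: hpolyG.
Qed.

Lemma hpoly_hom d f : f \in G d -> hpoly f = f *: 'X^d.
Proof.
move=> Gf; apply: hpoly_unique; last by rewrite hornerZ hornerXn expr1n mulr1.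
move=> i; rewrite coefZ coefXn; case: eqP => [->|_]; first by rewrite mulr1.
by rewrite mulr0 piece0.
Qed.

Lemma hpoly_hom_coef d f : f \in G d -> (hpoly f)`_d = f.
Proof. by move=> /hpoly_hom ->; rewrite coefZ coefXn eqxx mulr1. Qed.

Lemma hpolyM_hom d f a i : f \in G d ->
  (hpoly (f * a))`_(d + i) = f * (hpoly a)`_i.
Proof.
move=> /hpoly_hom e; rewrite hpolyM e -scalerAl coefZ coefXnM.
by rewrite ltnNge leq_addr addKn.
Qed.

Lemma proj_memP (y : proj G) a :
  a \in spec_pred y <-> forall i, (hpoly a)`_i \in spec_pred y.
Proof.
split=> [ay i|ay]; last by rewrite (hpoly_sum a); apply: rpred_sum => i _.
have [si|si] := leqP (size (hpoly a)) i; first by rewrite nth_default ?rpred0.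
have := proj_homogeneous (p := y) (n := size (hpoly a)) (c := fun i => (hpoly a)`_i).
by apply=> //; [exact: hpolyG | rewrite -hpoly_sum].
Qed.

(** [K d] prescribes the part of degree [d] of a homogeneous prime. Primality passes from
    homogeneous to arbitrary elements by comparing the lowest components outside [K] of the two
    factors. *)
Lemma proj_of_family (K : nat -> A -> Prop) :
  (forall d, K d 0) ->
  (forall d u v, u \in G d -> v \in G d -> K d u -> K d v -> K d (u + v)) ->
  (forall d e f g, f \in G d -> g \in G e -> K e g -> K (d + e)%N (f * g)) ->
  (forall d e f g, f \in G d -> g \in G e -> K (d + e)%N (f * g) -> K d f \/ K e g) ->
  (exists d f, [/\ (0 < d)%N, f \in G d & ~ K d f]) ->
  exists y : proj G, forall d f, f \in G d -> (f \in spec_pred y <-> K d f).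
Proof.
move=> K0 KD KM Kp Krel.
have KM' n j u v : (j <= n)%N -> u \in G j -> v \in G (n - j)%N ->
    K j u \/ K (n - j)%N v -> K n (u * v).
  move=> jn Gu Gv [Ku|Kv]; last by rewrite -(subnKC jn); apply: KM.
  by rewrite mulrC -(subnK jn); apply: KM.
pose Q a := forall i, K i (hpoly a)`_i.
have Ksum d n (F : 'I_n -> A) (P : pred 'I_n) : (forall j, P j -> F j \in G d) ->
    (forall j, P j -> K d (F j)) -> K d (\sum_(j < n | P j) F j).
  move=> GF KF; suff [] : K d (\sum_(j < n | P j) F j) /\ \sum_(j < n | P j) F j \in G d by [].
  apply: (big_ind (fun a => K d a /\ a \in G d)).
  - by split; [exact: K0 | exact: piece0].
  - by move=> u v [Ku Gu] [Kv Gv]; split; [exact: KD | exact: pieceD].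
  - by move=> j Pj; split; [exact: KF | exact: GF].
have QM a b : Q b -> Q (a * b).
  move=> Qb i; rewrite hpolyM coefM; apply: Ksum => j _.
    by apply: (pieceM_sub (ltnSE (ltn_ord j))); exact: hpolyG.
  by apply: (KM' _ _ _ _ (ltnSE (ltn_ord j))); [exact: hpolyG | exact: hpolyG | right].
have Q1 : ~ Q 1.
  move=> /(_ 0%N); rewrite hpoly_hom_coef ?piece1 // => K1.
  have [d [f [_ Gf]]] := Krel; apply.
  by have := KM d 0%N f 1 Gf (piece1 G) K1; rewrite mulr1 addn0.
pose p : A -> bool := fun a => `[< Q a >].
have pI : idealr_closed p.
  split; first by apply/asboolP => i; rewrite (hpoly_hom (piece0 0)) scale0r coef0.
    exact/asboolPn.
  move=> a u v /asboolP Qu /asboolP Qv; apply/asboolP => i; rewrite hpolyD coefD.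
  by apply: KD; [exact: hpolyG | exact: hpolyG | exact: QM | exact: Qv].
have pP : prime_idealr_closed p.
  move=> a b /asboolP Qab; apply/orP; apply: contrapT => /not_orP[/negP/asboolPn na /negP/asboolPn nb].
  have exP c : ~ Q c -> exists n, ~~ `[< K n (hpoly c)`_n >].
    by move=> /existsNP[n nK]; exists n; apply/asboolPn.
  have [i /asboolPn nKi imin] := ex_minnP (exP a na).
  have [j /asboolPn nKj jmin] := ex_minnP (exP b nb).
  have Ki l : (l < i)%N -> K l (hpoly a)`_l.
    by move=> li; apply/asboolP/negPn/negP => /imin; rewrite leqNgt li.
  have Kj l : (l < j)%N -> K l (hpoly b)`_l.
    by move=> lj; apply/asboolP/negPn/negP => /jmin; rewrite leqNgt lj.
  suff : K (i + j)%N ((hpoly a)`_i * (hpoly b)`_j) by case/Kp => //; exact: hpolyG.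
  have io : (i < (i + j).+1)%N by rewrite ltnS leq_addr.
  have := Qab (i + j)%N; rewrite hpolyM coefM (bigD1 (Ordinal io)) //= addKn.
  set F := \sum_(_ < _ | _) _ => KF.
  have GF l : (hpoly a)`_(l : 'I_(i + j).+1) * (hpoly b)`_(i + j - l) \in G (i + j)%N.
    by apply: (pieceM_sub (ltnSE (ltn_ord l))); exact: hpolyG.
  have KN u : u \in G (i + j)%N -> K (i + j)%N u -> K (i + j)%N (- u).
    move=> Gu Ku; rewrite -mulN1r -[(i + j)%N]add0n; apply: KM => //.
    by apply: pieceN; exact: piece1.
  rewrite -(addrK F (_ * _)); apply: KD => //.
  - by apply: pieceD; [exact: pieceM (hpolyG a i) (hpolyG b j) |
      apply: piece_sum => l _; exact: GF].
  - by apply: pieceN; apply: piece_sum => l _; exact: GF.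
  apply: KN; first by apply: piece_sum => l _; exact: GF.
  apply: Ksum => l nl; first exact: GF.
  apply: (KM' _ _ _ _ (ltnSE (ltn_ord l))); [exact: hpolyG | exact: hpolyG |].
  have [li|il] := ltnP l i; [left; exact: Ki | right; apply: Kj].
  have : (l : nat) <> i by move=> e; move/eqP: nl; apply; apply: val_inj.
  have := ltn_ord l; lia.
pose y0 : spec A := Spec pI pP.
have y0P d f : f \in G d -> (f \in spec_pred y0 <-> K d f).
  move=> Gf; split=> [/asboolP/(_ d)|Kf]; first by rewrite hpoly_hom_coef.
  apply/asboolP => i; rewrite (hpoly_hom Gf) coefZ coefXn.
  by case: eqP => [->|_]; rewrite ?mulr1 ?mulr0.
have y0h n (c : nat -> A) : (forall i, c i \in G i) ->
    \sum_(i < n) c i \in spec_pred y0 -> forall i, (i < n)%N -> c i \in spec_pred y0.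
  move=> cG /asboolP cy i lin; apply/(y0P i) => //.
  have := cy i; rewrite (@hpoly_unique (\poly_(i < n) c i)).
  - by rewrite coef_poly lin.
  - by move=> j; rewrite coef_poly; case: ifP => _; [exact: cG | exact: piece0].
  - by rewrite horner_poly; apply: eq_bigr => j _; rewrite expr1n mulr1.
have y0r : exists (d : nat) (f : A), [/\ (0 < d)%N, f \in G d & f \notin spec_pred y0].
  have [d [f [d0 Gf nK]]] := Krel; exists d, f; split=> //.
  by apply/negP => /(y0P d f Gf).
by exists (Proj y0h y0r).
Qed.

Section Standard.
Hypotheses (nR : noeth R) (Gstd : standard_graded G).

Lemma standard_noeth : noeth A.
Proof.
have [n [t [tG tgen]]] := Gstd.
have [B [phi [nB phir phit _]]] :=
  @fg_algebra_noeth R A (GRing.in_alg A : {rmorphism R -> A}) (codom t) nR.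
apply: (noeth_surj (f := phi)) => // a.
pose im : {pred A} := fun a => `[< exists b, phi b = a >].
suff /asboolP : a \in im by [].
apply: tgen => [|i]; last by apply/asboolP; apply: phit; exact: codom_f.
split; first by apply/asboolP; exists 1; rewrite rmorph1.
- move=> r u v /asboolP[b <-] /asboolP[c <-]; apply/asboolP.
  have [d e] := phir r; exists (d * b + c).
  by rewrite rmorphD rmorphM e /= mulr_algl.
- by move=> u v /asboolP[b <-] /asboolP[c <-]; apply/asboolP; exists (b * c); rewrite rmorphM.
Qed.

Local Notation scalarA := (fun c : A => exists r : R, c = r%:A).

(* [M n] lists the monomials of degree [n] in the generators. *)
Lemma standard_monomials : exists M : nat -> seq A,
  [/\ forall n a, a \in M n -> a \in G n,
      forall n a, a \in G n -> lincomb scalarA (M n) a,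
      M 0%N = [:: 1] &
      forall n k a, a \in M (n + k)%N -> exists u v,
        [/\ u \in M n, v \in M k & a = u * v]].
Proof.
have [n0 [t [tG tgen]]] := Gstd.
pose M := fix M n := if n is n'.+1 then [seq u * v | u <- codom t, v <- M n'] else [:: 1 : A].
have MG n a : a \in M n -> a \in G n.
  elim: n a => [|n IHn] a; first by rewrite inE => /eqP ->; exact: piece1.
  move=> /allpairsP[[u v] /= [/codomP[i ->] /IHn Gv ->]].
  by rewrite -add1n; apply: pieceM.
have Mmul n k a b : a \in M n -> b \in M k -> a * b \in M (n + k)%N.
  elim: n a => [|n IHn] a; first by rewrite inE => /eqP ->; rewrite mul1r.
  move=> /allpairsP[[u v] /= [ut vM ->]] bM; rewrite -mulrA.
  by apply/allpairsP; exists (u, v * b); split=> //; exact: IHn.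
have sc0 : scalarA 0 by exists 0; rewrite scale0r.
have scD c d : scalarA c -> scalarA d -> scalarA (c + d).
  by move=> [r ->] [s ->]; exists (r + s); rewrite scalerDl.
have scM c d : scalarA c -> scalarA d -> scalarA (c * d).
  by move=> [r ->] [s ->]; exists (r * s); rewrite -scalerAl mul1r scalerA.
have lM n k a b : lincomb scalarA (M n) a -> lincomb scalarA (M k) b ->
    lincomb scalarA (M (n + k)%N) (a * b).
  move=> la lb; move: a la; apply: lincomb_ind => [|u v lu lv|x c xM sc].
  - by rewrite mul0r; apply: lincomb0.
  - by rewrite mulrDl; apply: lincombD.
  move: b lb; apply: lincomb_ind => [|u v lu lv|y d yM sd].
  - by rewrite mulr0; apply: lincomb0.
  - by rewrite mulrDr; apply: lincombD.
  - by rewrite mulrACA; apply: lincomb_mem => //; [exact: Mmul | exact: scM].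
pose B : {pred A} := fun a => `[< forall i, lincomb scalarA (M i) (hpoly a)`_i >].
have lhom n x : x \in M n -> x \in B.
  move=> xM; apply/asboolP => i; rewrite (hpoly_hom (MG n x xM)) coefZ coefXn.
  case: eqP => [->|_]; last by rewrite mulr0; apply: lincomb0.
  by rewrite mulrC; apply: lincomb_mem => //; exists 1; rewrite scale1r.
have lsum n k (P : pred 'I_k) (F : 'I_k -> A) : (forall i, P i -> lincomb scalarA (M n) (F i)) ->
    lincomb scalarA (M n) (\sum_(i | P i) F i).
  exact: lincomb_sum.
have Ball a : a \in B.
  apply: tgen => [|i]; last first.
    apply: (lhom 1%N); apply/allpairsP; exists (t i, 1).
    by rewrite /= mulr1 codom_f inE.
  split; first by apply: (lhom 0%N); rewrite inE.
    move=> r u v /asboolP Bu /asboolP Bv; apply/asboolP => i.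
    rewrite hpolyD hpolyZ coefD coefCM; apply: lincombD => //.
    by apply: lincombM (Bu i) => c [s ->]; exists (r * s); rewrite -scalerAl mul1r scalerA.
  move=> u v /asboolP Bu /asboolP Bv; apply/asboolP => i.
  rewrite hpolyM coefM; apply: lsum => j _.
  by have := lM _ _ _ _ (Bu j) (Bv (i - j)%N); rewrite subnKC // -ltnS.
exists M; split=> //.
  by move=> n a Ga; have /asboolP/(_ n) := Ball a; rewrite hpoly_hom_coef.
elim=> [|n IHn] k a; first by exists 1, a; rewrite mul1r inE.
move=> /allpairsP[[u v] /= [ut /IHn[w [y [wM yM ->]]] ->]].
exists (u * w), y; rewrite mulrA; split=> //.
by apply/allpairsP; exists (u, w).
Qed.

Lemma standard_mul (I : A -> Prop) n k : ideal I ->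
  (forall u v, u \in G n -> v \in G k -> I (u * v)) ->
  forall a, a \in G (n + k)%N -> I a.
Proof.
have [M [MG Mspan _ Mmul]] := standard_monomials.
move=> iI nkI a /Mspan; move: a; apply: lincomb_ind => [||x c xM _].
- exact: ideal0.
- exact: idealD.
- have [u [v [uM vM ->]]] := Mmul _ _ _ xM; apply: idealM => //.
  by apply: nkI; exact: MG.
Qed.

(** If all of [A_1] vanished at [x], so would [A_1 * A_(d - 1)], which generates [A_d]. The powers
    of [T] serve as denominators in every degree. *)
Lemma standard_deg1 (x : proj G) : exists2 T, T \in G 1%N & T \notin spec_pred x.
Proof.
apply: contrapT => nT.
have [d [f [d0 Gf xf]]] := proj_relevant x; move/negP: xf; apply.
have Gf' : f \in G (1 + d.-1)%N by rewrite add1n prednK.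
move: f Gf' {Gf}; apply: (standard_mul (ideal_idealr (proj_spec x))) => u v Gu _.
rewrite mulrC idealMr //; apply/negPn/negP => xu; apply: nT; by exists u.
Qed.

End Standard.
End Graded.

Section Germs.
Variables (R : comNzRingType) (A : comAlgType R) (G : grading A) (x : proj G).
Local Notation S := (stalk x).

Lemma hdenom_mk d g : g \in G d -> g \notin spec_pred x -> g \in hdenom_set x.
Proof. by move=> Gg xg; apply/asboolP; exists d. Qed.

Lemma degree0_mk d f g (h : [/\ f \in G d, g \in G d & g \notin spec_pred x]) :
  mkfrac f (let: And3 _ Gg xg := h in hdenom_mk Gg xg) \in @degree0 _ _ _ x.
Proof. by case: h => Gf Gg xg; apply/asboolP; exists d, f, g, (hdenom_mk Gg xg). Qed.

(* The germ [f / g] of degree [0], and [0] if [f] and [g] are not homogeneous of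
   degree [d], or if [g] vanishes at [x]. *)
Definition germ d f g : S :=
  if pselect [/\ f \in G d, g \in G d & g \notin spec_pred x] is left h
  then Stalk (degree0_mk h) else 0.

Lemma germE d f g (xg : g \in hdenom_set x) : f \in G d -> g \in G d ->
  g \notin spec_pred x -> stalk_val (germ d f g) = mkfrac f xg.
Proof.
move=> Gf Gg xg'; rewrite /germ; case: pselect => [h|]; last by case.
by apply/mkfracP; exists 1; rewrite ?mul1r //; exact: mult_set1.
Qed.

Lemma germ_ex (z : S) : exists d f g,
  [/\ f \in G d, g \in G d, g \notin spec_pred x & z = germ d f g].
Proof.
have /asboolP[d [f [g [xg [Gf Gg ez]]]]] := valP z.
case: (pselect (g \in spec_pred x)) => [xg'|/negP xg'].
  have /asboolP[e [_ /negP]] := xg; by case.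
by exists d, f, g; split=> //; apply: val_inj; rewrite /= ez (germE xg).
Qed.

Lemma germ_eq d f g e h k : f \in G d -> g \in G d -> g \notin spec_pred x ->
  h \in G e -> k \in G e -> k \notin spec_pred x ->
  germ d f g = germ e h k <->
  exists l u, [/\ u \in G l, u \notin spec_pred x & u * (f * k) = u * (h * g)].
Proof.
move=> Gf Gg xg Gh Gk xk.
have eg := germE (hdenom_mk Gg xg) Gf Gg xg; have ek := germE (hdenom_mk Gk xk) Gh Gk xk.
split=> [e1|[l [u [Gu xu e1]]]].
  have := eg; rewrite e1 ek => /esym/mkfracP[u /asboolP[l [Gu xu]] e2].
  by exists l, u.
apply: val_inj; rewrite /= eg ek; apply/mkfracP; exists u => //.
exact: hdenom_mk Gu xu.
Qed.

Lemma germ_same d f g e h k : f \in G d -> g \in G d -> g \notin spec_pred x ->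
  h \in G e -> k \in G e -> k \notin spec_pred x -> f * k = h * g ->
  germ d f g = germ e h k.
Proof.
move=> Gf Gg xg Gh Gk xk e1; apply/germ_eq => //; exists 0%N, 1.
by rewrite piece1 idealr1 e1.
Qed.

Lemma notin_mul (y : proj G) g k : g \notin spec_pred y -> k \notin spec_pred y ->
  g * k \notin spec_pred y.
Proof. by move=> yg yk; rewrite prime_idealrM negb_or yg. Qed.

Lemma notin_exp (y : proj G) g n : g \notin spec_pred y -> g ^+ n \notin spec_pred y.
Proof.
move=> yg; elim: n => [|n IHn]; first by rewrite expr0 idealr1.
by rewrite exprS; apply: notin_mul.
Qed.

Lemma germM d f g e h k : f \in G d -> g \in G d -> g \notin spec_pred x ->
  h \in G e -> k \in G e -> k \notin spec_pred x ->
  germ d f g * germ e h k = germ (d + e) (f * h) (g * k).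
Proof.
move=> Gf Gg xg Gh Gk xk; apply: val_inj; have xg' := hdenom_mk Gg xg.
have xk' := hdenom_mk Gk xk.
transitivity (loc_mul (stalk_val (germ d f g)) (stalk_val (germ e h k))) => //.
rewrite (germE xg' Gf Gg xg) (germE xk' Gh Gk xk) loc_mulE.
by rewrite [RHS](germE (mult_setM xg' xk')) ?pieceM ?notin_mul.
Qed.

Lemma germDg d f g e h k : f \in G d -> g \in G d -> g \notin spec_pred x ->
  h \in G e -> k \in G e -> k \notin spec_pred x ->
  germ d f g + germ e h k = germ (d + e) (f * k + h * g) (g * k).
Proof.
move=> Gf Gg xg Gh Gk xk; apply: val_inj; have xg' := hdenom_mk Gg xg.
have xk' := hdenom_mk Gk xk.
transitivity (loc_add (stalk_val (germ d f g)) (stalk_val (germ e h k))) => //.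
rewrite (germE xg' Gf Gg xg) (germE xk' Gh Gk xk) loc_addE.
rewrite [RHS](germE (mult_setM xg' xk')) ?pieceM ?notin_mul //.
by apply: pieceD; [exact: pieceM | rewrite addnC; exact: pieceM].
Qed.

Lemma germD d f h g : f \in G d -> h \in G d -> g \in G d -> g \notin spec_pred x ->
  germ d f g + germ d h g = germ d (f + h) g.
Proof.
move=> Gf Gh Gg xg; rewrite germDg //; apply: germ_same => //.
- by apply: pieceD; exact: pieceM.
- exact: pieceM.
- exact: notin_mul.
- exact: pieceD.
- ring.
Qed.

Lemma germ0 d g : g \in G d -> g \notin spec_pred x -> germ d 0 g = 0.
Proof.
move=> Gg xg; have := germD (piece0 G d) (piece0 G d) Gg xg.
by rewrite addr0 => /eqP; rewrite -subr_eq0 addrK => /eqP.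
Qed.

Lemma germ1 d g : g \in G d -> g \notin spec_pred x -> germ d g g = 1.
Proof.
move=> Gg xg; apply: val_inj.
rewrite [LHS](germE (hdenom_mk Gg xg)) // -[RHS]/(mkfrac 1 (mult_set1 (hdenom_set x))).
by apply/mkfracP; exists 1; rewrite ?mulr1 ?mul1r //; exact: mult_set1.
Qed.

Lemma germN d f g : f \in G d -> g \in G d -> g \notin spec_pred x ->
  germ d (- f) g = - germ d f g.
Proof.
move=> Gf Gg xg; apply/eqP; rewrite -addr_eq0 germD ?pieceN //.
by rewrite addNr germ0.
Qed.

Lemma germB d f h g : f \in G d -> h \in G d -> g \in G d -> g \notin spec_pred x ->
  germ d f g - germ d h g = germ d (f - h) g.
Proof. by move=> Gf Gh Gg xg; rewrite -germN // germD ?pieceN. Qed.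

Lemma germ_inv d f g : f \in G d -> f \notin spec_pred x -> g \in G d ->
  g \notin spec_pred x -> germ d g f * germ d f g = 1.
Proof.
move=> Gf xf Gg xg; rewrite germM // -(germ1 (d := d + d) (g := f * g)).
- by rewrite [g * f]mulrC.
- exact: pieceM.
- exact: notin_mul.
Qed.

Lemma germ_unit d f g : f \in G d -> f \notin spec_pred x -> g \in G d ->
  g \notin spec_pred x -> is_unit (germ d f g).
Proof. by move=> Gf xf Gg xg; exists (germ d g f); apply: germ_inv. Qed.

Section MaxIdeal.
Variables (mx : idealr S) (Smx : local_ring mx).

Lemma germ_max d f g : f \in G d -> g \in G d -> g \notin spec_pred x ->
  (germ d f g \in mx) = (f \in spec_pred x).
Proof.
move=> Gf Gg xg; apply/idP/idP => [mf|xf].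
  by apply/negPn/negP => xf; apply: (local_nonunit mf); apply: germ_unit.
apply/negPn/negP => /(local_unit Smx)[v].
have [e [h [k [Gh Gk xk ->]]]] := germ_ex v; rewrite germM //.
rewrite -(germ1 (piece1 G) (introT negP (elimF idP (idealr1 (proj_spec x))))).
have x1 : 1 \notin spec_pred x by rewrite idealr1.
case/germ_eq; rewrite ?pieceM ?piece1 ?notin_mul // => l [u [Gu xu]].
rewrite mulr1 mul1r => e1.
have : u * (k * g) \in spec_pred x.
  by rewrite -e1 mulrA idealMr.
by apply/negP; rewrite !notin_mul.
Qed.

End MaxIdeal.

Definition base_germ (r : R) : S := germ 0 r%:A 1.

Lemma pieceA r : r%:A \in G 0%N.
Proof. by apply: pieceZ; exact: piece1. Qed.

Lemma notin1 (y : proj G) : 1 \notin spec_pred y.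
Proof. by rewrite idealr1. Qed.

Fact base_germ_zmod_morphism : zmod_morphism base_germ.
Proof.
move=> r s; rewrite /base_germ germB ?pieceA ?piece1 ?notin1 //.
by rewrite scalerBl.
Qed.

Fact base_germ_monoid_morphism : monoid_morphism base_germ.
Proof.
split; first by rewrite /base_germ scale1r germ1 ?piece1 ?notin1.
move=> r s; rewrite /base_germ germM ?pieceA ?piece1 ?notin1 // mulr1.
by rewrite -scalerAl mul1r scalerA.
Qed.

HB.instance Definition _ :=
  GRing.isZmodMorphism.Build R S base_germ base_germ_zmod_morphism.
HB.instance Definition _ :=
  GRing.isMonoidMorphism.Build R S base_germ base_germ_monoid_morphism.

Lemma base_germ_mul r d f g : f \in G d -> g \in G d -> g \notin spec_pred x ->
  base_germ r * germ d f g = germ d (r%:A * f) g.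
Proof.
move=> Gf Gg xg; rewrite /base_germ germM ?pieceA ?piece1 ?notin1 //.
by rewrite mul1r add0n.
Qed.

(** The numerators of germs in [J] are spanned by finitely many of them; in a relation between
    homogeneous numerators the coefficients can be replaced by their components of the right
    degree. *)
Lemma stalk_noeth : noeth A -> noeth S.
Proof.
move=> nA J iJ.
pose X a := exists d g, [/\ a \in G d, g \in G d, g \notin spec_pred x & J (germ d a g)].
have [s [sX gen]] := noeth_subset X nA.
have [gd [gg gP]] : exists (gd : A -> nat) (gg : A -> A), forall a, a \in s ->
    [/\ a \in G (gd a), gg a \in G (gd a), gg a \notin spec_pred x &
        J (germ (gd a) a (gg a))].
  have /choice[g gP] : forall a, exists z : nat * A, a \in s ->
      [/\ a \in G z.1, z.2 \in G z.1, z.2 \notin spec_pred x & J (germ z.1 a z.2)].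
    move=> a; have [/sX[d [g H]]|_] := boolP (a \in s); first by exists (d, g).
    by exists (0%N, 0).
  by exists (fun a => (g a).1), (fun a => (g a).2).
pose gens := [seq germ (gd a) a (gg a) | a <- s].
exists gens; split=> [_ /mapP[a /gP[_ _ _ Ja] ->] //|z].
have [d [f [g [Gf Gg xg ->]]]] := germ_ex z => Jz.
have sf : spanned s f by apply: gen; exists d, g.
(* The partial sums of the induction need not be homogeneous, hence a claim on their components in
   every degree. *)
suff : forall d g, g \in G d -> g \notin spec_pred x ->
    spanned gens (germ d (hpoly G f)`_d g).
  by move=> /(_ d g Gg xg); rewrite hpoly_hom_coef.
have is' := ideal_spanned gens.
move: f sf {Gf Jz}; apply: lincomb_ind => [|u v su sv|a c aS _] {}d {}g {}Gg {}xg.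
- by rewrite (hpoly_hom (piece0 G 0)) scale0r coef0 germ0 //; exact: ideal0.
- rewrite hpolyD coefD -germD //; try exact: hpolyG.
  by apply: idealD => //; [exact: su | exact: sv].
have [Ga Gga xga Ja] := gP a aS.
rewrite hpolyM (hpoly_hom Ga) -scalerAr coefZ coefMXn; case: ltnP => da.
  by rewrite mulr0 germ0 //; exact: ideal0.
have Gc := hpolyG G c (d - gd a); set c' := _`_(d - gd a) in Gc *.
have -> : germ d (a * c') g = germ d (c' * gg a) g * germ (gd a) a (gg a).
  have Gca : c' * gg a \in G d by rewrite mulrC; apply: (pieceM_sub da).
  have Gac : a * c' \in G d by apply: (pieceM_sub da).
  rewrite germM //; apply: germ_same => //; rewrite ?pieceM ?notin_mul //; ring.
by apply: idealM => //; apply: spanned_mem; exact: map_f.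
Qed.

End Germs.

(** * The closed fiber *)

Section ProjPoints.
Variables (R : comNzRingType) (A : comAlgType R) (G : grading A).
Implicit Types x y z : proj G.

Definition specializes y z := {subset spec_pred y <= spec_pred z}.

Lemma proj_closed_specializes (C : set (proj G)) y z : closed C -> C y ->
  specializes y z -> C z.
Proof.
move=> /closed_openC Cop Cy yz; apply: contrapT => nCz.
have [d [f [_ fz fC]]] := (Cop : proj_open (~` C)) z nCz.
by apply: (fC y) => //; apply/negP => /yz; apply/negP.
Qed.

Lemma closed_zeros (P : A -> Prop) :
  closed [set z : proj G | forall d f, f \in G d -> P f -> f \in spec_pred z].
Proof.
set Z := [set z | _]; suff -> : Z = ~` [set z : proj G | exists d f,
    [/\ f \in G d, P f & f \notin spec_pred z]].
  apply: open_closedC; suff: proj_open [set z : proj G | exists d f,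
    [/\ f \in G d, P f & f \notin spec_pred z]] by [].
  by move=> z [d [f [Gf Pf zf]]]; exists d, f; split=> // w wf; exists d, f.
apply/seteqP; split=> z /= H.
  by move=> [d [f [Gf Pf]]]; rewrite (H d f).
by move=> d f Gf Pf; apply/negPn/negP => zf; apply: H; exists d, f.
Qed.

Lemma specializes_hom y z : (forall d f, f \in G d -> f \in spec_pred y ->
  f \in spec_pred z) -> specializes y z.
Proof.
move=> H a /proj_memP ya; apply/proj_memP => i.
exact: H (hpolyG G a i) (ya i).
Qed.

End ProjPoints.

Section ClosedPoint.
Variables (R : comNzRingType) (A : comAlgType R) (G : grading A).
Hypotheses (nR : noeth R) (Gstd : standard_graded G).
Variables (x : proj G) (xclosed : closed [set x]).

(* A homogeneous ideal that contains no [A_n] for [n] large and is maximal with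
   this property is prime, hence a point of [Proj A]. *)
Lemma closed_point_irrelevant d g : g \in G d -> g \notin spec_pred x ->
  exists D, forall n a, (D <= n)%N -> a \in G n ->
    exists2 h, h \in G (n - d)%N & a - g * h \in spec_pred x.
Proof.
move=> Gg xg; have nA := standard_noeth nR Gstd.
pose small (I : A -> Prop) := forall D, ~ forall n a, (D <= n)%N -> a \in G n -> I a.
pose hom (I : A -> Prop) := forall a, I a <-> forall i, I (hpoly G a)`_i.
pose F I := [/\ ideal I, hom I & small I].
pose I0 a := exists h, a - g * h \in spec_pred x.
have ix := ideal_idealr (proj_spec x).
have iI0 : ideal I0.
  split; first by exists 0; rewrite mulr0 subrr; exact: (ideal0 ix).
    move=> u v [h hu] [k kv]; exists (h + k).
    by rewrite mulrDr opprD addrACA; exact: (idealD ix).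
  by move=> b u [h hu]; exists (b * h); rewrite mulrCA -mulrBr; exact: (idealM ix).
have hcoef a h i : a - g * h \in spec_pred x ->
    (hpoly G a)`_(d + i) - g * (hpoly G h)`_i \in spec_pred x.
  move=> /proj_memP/(_ (d + i)%N); rewrite hpolyD hpolyN coefD coefN.
  by rewrite hpolyM_hom.
have hcoef' a h i : a - g * h \in spec_pred x -> (i < d)%N ->
    (hpoly G a)`_i \in spec_pred x.
  move=> /proj_memP/(_ i); rewrite hpolyD hpolyN coefD coefN hpolyM (hpoly_hom Gg).
  by rewrite -scalerAl coefZ coefXnM => + id; rewrite id mulr0 subr0.
have hI0 : hom I0.
  move=> a; split=> [[h ah] i|]; last first.
    by move=> H; rewrite (hpoly_sum G a); apply: ideal_sum => // i _.
  have [id|di] := ltnP i d.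
    by exists 0; rewrite mulr0 subr0; exact: hcoef' ah id.
  exists (hpoly G h)`_(i - d); have := hcoef a h (i - d)%N ah.
  by rewrite subnKC.
have [[D DP]|nD] := pselect (exists D, forall n a, (D <= n)%N -> a \in G n -> I0 a).
  exists (D + d)%N => n a Dn Ga; have [|h ah] := DP n a _ Ga; first by lia.
  exists (hpoly G h)`_(n - d); first exact: hpolyG.
  have dn : (d <= n)%N by lia.
  by have := hcoef a h (n - d)%N ah; rewrite subnKC // hpoly_hom_coef.
exfalso.
have [P [[iP hP smallP] I0P Pmax]] : exists P, [/\ F P, (forall a, I0 a -> P a) &
    forall J, F J -> (forall a, P a -> J a) -> forall a, J a -> P a].
  apply: noeth_max => //; first by move=> I [].
  by split=> // D DP; apply: nD; exists D.
have Pprime i j a b : a \in G i -> b \in G j -> P (a * b) -> P a \/ P b.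
  move=> Ga Gb Pab; apply: contrapT => /not_orP[nPa nPb].
  have key l c : c \in G l -> ~ P c -> exists D, forall n u, (D <= n)%N -> u \in G n ->
      exists k, P (u - k * c).
    move=> Gc nPc; pose J u := exists k, P (u - k * c).
    have iJ : ideal J.
      split; first by exists 0; rewrite mul0r subrr; exact: ideal0.
        move=> u v [k Pu] [k' Pv]; exists (k + k').
        by rewrite mulrDl opprD addrACA; exact: idealD.
      by move=> w u [k Pu]; exists (w * k); rewrite -mulrA -mulrBr; exact: idealM.
    apply: contrapT => nE; apply: nPc; apply: (Pmax J).
    - split=> // [u|D JD]; last by apply: nE; exists D.
      split=> [[k /hP Pu] n|H]; last by rewrite (hpoly_sum G u); apply: ideal_sum => // n _.
      have := Pu n; rewrite hpolyD hpolyN hpolyM (hpoly_hom Gc) coefD coefN.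
      rewrite -scalerAr coefZ coefMXn; case: ltnP => nl; rewrite ?mulr0 => Pn.
        by exists 0; rewrite mul0r.
      by exists (hpoly G k)`_(n - l); rewrite mulrC.
    - by move=> u Pu; exists 0; rewrite mul0r subr0.
    - by exists 1; rewrite mul1r subrr; exact: ideal0.
  have [D DP] := key i a Ga nPa; have [D' DP'] := key j b Gb nPb.
  apply: (smallP (D + D')%N) => n u Dn Gu.
  have Gu' : u \in G (D + (n - D))%N by rewrite subnKC //; lia.
  move: u Gu' {Gu}; apply: (standard_mul Gstd iP) => u v Gu Gv.
  have [k Pu] := DP D u (leqnn D) Gu.
  have [|k' Pv] := DP' (n - D)%N v _ Gv; first by lia.
  have -> : u * v = v * (u - k * a) + k * a * (v - k' * b) + k * k' * (a * b) by ring.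
  by apply: idealD => //; [apply: idealD => //; exact: idealM | exact: idealM].
have [|||||y yP] := @proj_of_family _ _ G (fun _ a => P a).
- by move=> _; exact: ideal0.
- by move=> e u v _ _; exact: idealD.
- by move=> e e' u v _ _; exact: idealM.
- by move=> e e' u v Gu Gv; apply: Pprime Gu Gv.
- apply: contrapT => nrel; apply: (smallP 1%N) => n a n0 Ga; apply: contrapT => nPa.
  by apply: nrel; exists n, a.
(* The prime [P] is a point in the closure of [x], hence equal to [x]; but [g] vanishes there and
   not at [x]. *)
have xy : specializes x y.
  apply: specializes_hom => e f Gf xf; apply/(yP e) => //; apply: I0P.
  by exists 0; rewrite mulr0 subr0.
have yx : y = x by apply: (proj_closed_specializes xclosed _ xy).
move/negP: xg; apply; rewrite -yx; apply/(yP d) => //; apply: I0P.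
by exists 1; rewrite mulr1 subrr; exact: (ideal0 ix).
Qed.

Variables (mx : idealr (stalk x)) (Smx : local_ring mx).

(** In large degrees, multiplication by [g] or by [T] is onto modulo the prime [x]. Thus [f / g],
    expanded by [T ^ (D + D1)], is congruent to some [h / T ^ (D + D1)], where [h] can be divided by
    [T ^ D1]; so the fractions in [A_D / T ^ D] span the residue field over [R]. *)
Lemma residue_finite : exists es : seq (stalk x), forall s,
  exists2 e, lincomb (fun c => exists r, c = base_germ x r) es e & s - e \in mx.
Proof.
have [T GT xT] := standard_deg1 Gstd x.
have [M [MG Mspan _ _]] := standard_monomials Gstd.
have [D DP] := closed_point_irrelevant GT xT.
have GTn n : T ^+ n \in G n by exact: pieceX1.
have xTn n : T ^+ n \notin spec_pred x by exact: notin_exp.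
have ix := ideal_idealr (proj_spec x).
have germ_mx d f h g : f \in G d -> h \in G d -> g \in G d -> g \notin spec_pred x ->
    f - h \in spec_pred x -> germ x d f g - germ x d h g \in mx.
  move=> Gf Gh Gg xg fh; rewrite germB // germ_max //.
  by apply: pieceD => //; exact: pieceN.
exists [seq germ x D a (T ^+ D) | a <- M D] => s.
have [d [f [g [Gf Gg xg ->]]]] := germ_ex s.
have [D1 D1P] := closed_point_irrelevant Gg xg.
have [h Gh fh] := D1P (d + (D + D1))%N (f * T ^+ (D + D1)) (leq_trans (leq_addl _ _) (leq_addl _ _))
  (pieceM Gf (GTn _)).
rewrite addKn in Gh.
have down k : forall h, h \in G (D + k)%N -> exists2 h', h' \in G D &
    h - T ^+ k * h' \in spec_pred x.
  elim: k => [|k IHk] {}h {fh} {}Gh.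
    exists h; first by rewrite addn0 in Gh.
    by rewrite mul1r subrr; exact: (ideal0 ix).
  have [h1 Gh1 hh1] := DP (D + k.+1)%N h (leq_addr _ _) Gh.
  have e1 : (D + k.+1 - 1 = D + k)%N by rewrite addnS subn1.
  have [|h2 Gh2 hh2] := IHk h1; first by rewrite -e1.
  exists h2 => //; have -> : h - T ^+ k.+1 * h2 = h - T * h1 + T * (h1 - T ^+ k * h2).
    by rewrite exprS; ring.
  by apply: (idealD ix) => //; exact: (idealM ix).
have [h' Gh' hh'] := down D1 h Gh.
have es : germ x d f g - germ x D h' (T ^+ D) \in mx.
  set n := (D + D1)%N in Gh fh *.
  have -> : germ x d f g = germ x (d + n) (f * T ^+ n) (g * T ^+ n).
    by apply: germ_same; rewrite ?pieceM ?notin_mul //; ring.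
  have -> : germ x D h' (T ^+ D) = germ x (d + n) (g * (T ^+ D1 * h')) (g * T ^+ n).
    have GTh : T ^+ D1 * h' \in G n by rewrite /n addnC; exact: pieceM.
    have eT : T ^+ n = T ^+ D * T ^+ D1 by rewrite -exprD.
    apply: germ_same => //; [exact: pieceM | exact: pieceM Gg (GTn n) | |].
      exact: notin_mul.
    by rewrite eT; ring.
  have GTh : T ^+ D1 * h' \in G n by rewrite /n addnC; exact: pieceM.
  apply: germ_mx; [exact: pieceM Gf (GTn n) | exact: pieceM | exact: pieceM Gg (GTn n) |
    exact: notin_mul | ].
  have -> : f * T ^+ n - g * (T ^+ D1 * h') = f * T ^+ n - g * h + g * (h - T ^+ D1 * h') by ring.
  by apply: (idealD ix) => //; exact: (idealM ix).
exists (germ x D h' (T ^+ D)) => //.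
have sc0 : exists r, 0 = base_germ x r by exists 0; rewrite rmorph0.
have lG : lincomb (fun c : A => exists r : R, c = r%:A) (M D) h' by exact: Mspan.
suff [] : lincomb (fun c => exists r, c = base_germ x r)
    [seq germ x D a (T ^+ D) | a <- M D] (germ x D h' (T ^+ D)) /\ h' \in G D by [].
move: h' lG {Gh' hh' es}; apply: lincomb_ind.
- rewrite germ0 //; split; [exact: lincomb0 | exact: piece0].
- move=> u v [lu Gu] [lv Gv]; rewrite -germD //; split; last exact: pieceD.
  apply: lincombD => // c c' [r ->] [r' ->]; exists (r + r'); by rewrite rmorphD.
- move=> a c aM [r ->]; have Ga := MG D a aM; split; last by rewrite mulr_algl; exact: pieceZ.
  rewrite -base_germ_mul //; apply: lincomb_mem => //; last by exists r.
  exact: (map_f (fun a => germ x D a (T ^+ D))).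
Qed.

End ClosedPoint.

Lemma base_germ_eq0 (R : comNzRingType) (A : comAlgType R) (G : grading A)
    (x : proj G) r :
  base_germ x r = 0 <-> exists l u, [/\ u \in G l, u \notin spec_pred x & u * r%:A = 0].
Proof.
rewrite -(germ0 (piece1 G) (notin1 x)) /base_germ.
rewrite germ_eq ?pieceA ?piece0 ?piece1 ?notin1 //.
by split=> -[l [u [Gu xu e]]]; exists l, u; move: e; rewrite !mulr1 mulr0.
Qed.

Section Connected.
Variables (R : idomainType) (A : comAlgType R) (G : grading A).
Hypotheses (nA : noeth A) (Gstd : standard_graded G).
Hypotheses (Gconn : proj_connected G) (Gdom : dominant G).
Hypothesis domG : forall y : proj G, is_domain (stalk y).

(* The set of points at which a scalar does not vanish identically is open since
   the kernel of localization is finitely generated, and closed; it is not empty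
   by dominance. *)
Lemma base_germ_neq0 r : r != 0 -> forall x : proj G, base_germ x r != 0.
Proof.
move=> r0; pose U : set (proj G) := [set z | base_germ z r != 0].
suff UT : U = setT by move=> x; have : U x by rewrite UT.
apply: Gconn.2.
- pose p0 : R -> bool := fun a => a == 0.
  have p0I : idealr_closed p0.
    split; rewrite ?unfold_in ?oner_eq0 ?eqxx //.
    by move=> a u v; rewrite !unfold_in => /eqP -> /eqP ->; rewrite mulr0 addr0.
  have p0P : prime_idealr_closed p0.
    by move=> u v; rewrite !unfold_in mulf_eq0.
  have [||p [rp [y _ ey]]] := Gdom (O := spec_basic_open r : set (spec R)).
  + by exists (Spec p0I p0P); rewrite /spec_basic_open /= unfold_in.
  + suff: spec_open (spec_basic_open r : set (spec R)) by [].
    by move=> p rp; exists r.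
  rewrite -ey in rp; exists y; apply/eqP => /base_germ_eq0[l [u [Gu yu e]]].
  have : u * r%:A \in spec_pred y by rewrite e rpred0.
  by rewrite prime_idealrM (negPf yu) => /= ry; move/negP: rp; apply.
- exists U; last by rewrite setTI.
  suff: proj_open U by [].
  move=> y Uy; pose N a := exists l u, [/\ u \in G l, u \notin spec_pred y & u * a = 0].
  have iN : ideal N.
    split; first by exists 0%N, 1; rewrite piece1 notin1 mulr0.
      move=> a b [l [u [Gu yu ua]]] [k [v [Gv yv vb]]]; exists (l + k)%N, (u * v).
      rewrite pieceM ?notin_mul //; split=> //.
      by rewrite mulrDr mulrAC ua mul0r -mulrA vb mulr0 addr0.
    by move=> b a [l [u [Gu yu ua]]]; exists l, u; rewrite mulrCA ua mulr0.
  have [s [sN gen]] := nA iN.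
  have [l [g [Gg yg gs]]] : exists l g, [/\ g \in G l, g \notin spec_pred y &
      forall a, a \in s -> g * a = 0].
    elim: s sN {gen} => [|a s IHs] sN; first by exists 0%N, 1; rewrite piece1 notin1.
    have [|l [g [Gg yg gs]]] := IHs; first by move=> b bs; apply: sN; rewrite inE bs orbT.
    have [k [u [Gu yu ua]]] := sN a (mem_head a s).
    exists (l + k)%N, (g * u); rewrite pieceM ?notin_mul //; split=> // b.
    rewrite inE => /orP[/eqP ->|/gs gb]; first by rewrite -mulrA ua mulr0.
    by rewrite mulrAC gb mul0r.
  have gN a : N a -> g * a = 0.
    move=> /gen; apply: (spanned_sub (I := fun a => g * a = 0)) => //.
    split; first by rewrite mulr0.
      by move=> u v gu gv; rewrite mulrDr gu gv addr0.
    by move=> b u gu; rewrite mulrCA gu mulr0.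
  exists l, g; split=> // z zg; apply/eqP => /base_germ_eq0[e [h [Gh zh hr]]].
  have [T GT yT] := standard_deg1 Gstd y.
  have GTe : T ^+ e \in G e by exact: pieceX1.
  have yTe : T ^+ e \notin spec_pred y by exact: notin_exp.
  (* As the stalk is a domain, a homogeneous [h] with [h * r = 0] has zero germ at [y], so
     [g * h = 0], although neither factor vanishes at [z]. *)
  have /domG[/eqP|h0] : base_germ y r * germ y e h (T ^+ e) = 0.
  + by rewrite base_germ_mul // mulrC hr germ0.
  + by rewrite (negPf Uy).
  have Nh : N h.
    move: h0; rewrite -(germ0 GTe yTe).
    case/germ_eq => //; first exact: piece0.
    move=> k [u [Gu yu]]; rewrite mul0r mulr0 => uh.
    exists (k + e)%N, (u * T ^+ e); rewrite pieceM ?notin_mul //; split=> //.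
    by rewrite -mulrA [T ^+ e * h]mulrC.
  have : g * h \in spec_pred z by rewrite gN // rpred0.
  by apply/negP; exact: notin_mul.
- exists U; last by rewrite setTI.
  rewrite -[U]setCK; apply: open_closedC; suff: proj_open (~` U) by [].
  move=> z /= /negP; rewrite negbK => /eqP/base_germ_eq0[l [u [Gu zu e]]].
  exists l, u; split=> // w wu /=; apply/negP; rewrite negbK; apply/eqP/base_germ_eq0.
  by exists l, u.
Qed.

End Connected.

(** * Primes of the local ring as points, and components of the closed fiber *)

Section PointsOfPrimes.
Variables (R : comNzRingType) (A : comAlgType R) (G : grading A).

(** The closure of the point [y]. *)
Definition specializations (y : proj G) : set (proj G) := [set z | specializes y z].

Local Notation V := specializations.

Lemma specializations_closed y : closed (V y).
Proof.
suff -> : V y = [set z : proj G | forall d f, f \in G d -> f \in spec_pred y ->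
    f \in spec_pred z] by exact: (@closed_zeros _ _ G (fun f => f \in spec_pred y)).
apply/seteqP; split=> z /=; last exact: specializes_hom.
by move=> yz d f _; exact: yz.
Qed.

Lemma specializations_refl y : V y y.
Proof. by []. Qed.

Lemma specializations_irreducible (Y : set (proj G)) y : V y `<=` Y -> irreducible_closed_in Y (V y).
Proof.
move=> VY; split; last first.
  by exists (V y); [exact: specializations_closed | rewrite setIC; apply/esym/setIidl].
split; first by exists y.
move=> C D cC cD VCD.
have [Cy|Dy] := VCD y (@specializations_refl y); [left | right] => z yz.
  exact: proj_closed_specializes yz.
exact: proj_closed_specializes yz.
Qed.

Lemma irreducible_vanish (Z : set (proj G)) d e a b : irreducible Z ->
  a \in G d -> b \in G e -> (forall z, Z z -> a * b \in spec_pred z) ->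
  (forall z, Z z -> a \in spec_pred z) \/ (forall z, Z z -> b \in spec_pred z).
Proof.
move=> [_ irr] Ga Gb ab.
have [|||H|H] := irr [set z | forall d f, f \in G d -> f = a -> f \in spec_pred z]
    [set z | forall d f, f \in G d -> f = b -> f \in spec_pred z].
- exact: (@closed_zeros _ _ G (fun f => f = a)).
- exact: (@closed_zeros _ _ G (fun f => f = b)).
- move=> z /ab; rewrite prime_idealrM => /orP[za|zb]; [left | right].
    by move=> ? ? _ ->.
  by move=> ? ? _ ->.
- by left=> z /H; apply; first exact: Ga.
- by right=> z /H; apply; first exact: Gb.
Qed.

Variables (x : proj G) (T : A) (GT : T \in G 1%N) (xT : T \notin spec_pred x).

Lemma deg1_expr d : T ^+ d \in G d. Proof. exact: pieceX1. Qed.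

Lemma deg1_expr_notin d : T ^+ d \notin spec_pred x. Proof. exact: notin_exp. Qed.

(** In degree [d] the homogeneous prime consists of the [f] with [f / T ^ d] in [q]; any other
    denominator differs from [T ^ d] by a unit of the stalk. *)
Lemma point_of_prime (q : stalk x -> Prop) : prime_ideal q ->
  exists y : proj G, forall d f g, f \in G d -> g \in G d -> g \notin spec_pred x ->
    (f \in spec_pred y <-> q (germ x d f g)).
Proof.
move=> [iq q1 qp].
have [|||||y yP] := @proj_of_family _ _ G (fun d f => q (germ x d f (T ^+ d))).
- by move=> d; rewrite germ0 ?deg1_expr ?deg1_expr_notin //; exact: ideal0.
- by move=> d u v Gu Gv qu qv; rewrite -germD ?deg1_expr ?deg1_expr_notin //; exact: idealD.
- by move=> d e f g Gf Gg qg; rewrite exprD -germM ?deg1_expr ?deg1_expr_notin //; exact: idealM.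
- by move=> d e f g Gf Gg; rewrite exprD -germM ?deg1_expr ?deg1_expr_notin // => /qp.
- by exists 1%N, T; split=> //; rewrite expr1 germ1.
exists y => d f g Gf Gg xg; rewrite (yP d f Gf).
have GTd := deg1_expr d; have xTd := deg1_expr_notin d.
have fgT : germ x d f g * germ x d g (T ^+ d) = germ x d f (T ^+ d).
  rewrite germM //; apply: germ_same => //; rewrite ?pieceM ?notin_mul //; ring.
split=> [|qf]; rewrite -fgT; last exact: idealMl.
by case/qp=> // /(unit_ideal iq (germ_unit Gg xg GTd xTd)).
Qed.

Lemma point_specializes (q : stalk x -> Prop) (y : proj G) : prime_ideal q ->
  (forall d f g, f \in G d -> g \in G d -> g \notin spec_pred x ->
    (f \in spec_pred y <-> q (germ x d f g))) -> specializes y x.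
Proof.
move=> [iq q1 _] yP; apply: specializes_hom => d f Gf.
move=> /(yP d f (T ^+ d) Gf (deg1_expr d) (deg1_expr_notin d)) qf; apply/negPn/negP => xf.
by apply: q1; apply: unit_ideal iq _ qf; apply: germ_unit => //; [exact: deg1_expr | exact: deg1_expr_notin].
Qed.

End PointsOfPrimes.

Section Components.
Variables (R : comNzRingType) (mR : idealr R) (Rloc : local_ring mR).
Variables (A : comAlgType R) (G : grading A) (Gstd : standard_graded G).
Variables (x : proj G) (mx : idealr (stalk x)) (Smx : local_ring mx).
Local Notation V := (@specializations R A G).

Lemma specializations_fiber (y : proj G) : (forall r, r \in mR -> r%:A \in spec_pred y) -> V y `<=` fiber G mR.
Proof.
move=> yR z yz r; apply/idP/idP => [zr|/yR/yz //].
apply: (proper_sub_max Rloc (ideal_idealr (structure_map z))) zr.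
by rewrite idealr1.
Qed.

Variables (q : stalk x -> Prop) (qprime : prime_ideal q).
Hypothesis qR : forall r, r \in mR -> q (base_germ x r).

Lemma prime_fiber (P : stalk x -> Prop) (y : proj G) : (forall a, q a -> P a) ->
  (forall d f g, f \in G d -> g \in G d -> g \notin spec_pred x ->
    (f \in spec_pred y <-> P (germ x d f g))) -> V y `<=` fiber G mR.
Proof.
move=> qP yP; apply: specializations_fiber => r mr.
by apply/(yP 0%N _ 1); rewrite ?pieceA ?piece1 ?notin1 //; apply/qP/qR.
Qed.

Variable y : proj G.
Hypothesis yP : forall d f g, f \in G d -> g \in G d -> g \notin spec_pred x ->
    (f \in spec_pred y <-> q (germ x d f g)).

Lemma generic_specializes : specializes y x.
Proof.
have [T GT xT] := standard_deg1 Gstd x.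
exact: (point_specializes GT xT qprime yP).
Qed.

Lemma germs_vanishingE (Vx : V y x) z : (z \in germs_vanishing Vx) <-> q z.
Proof.
split=> [/asboolP[d [f [g [xg [Gf Gg ez Zf]]]]]|qz].
  have xg' : g \notin spec_pred x.
    by have /asboolP[? []] := xg.
  have -> : z = germ x d f g by apply: val_inj; rewrite [LHS]ez [RHS](germE xg).
  apply/(yP Gf Gg xg'); apply: Zf => //.
  by apply/negP => /generic_specializes; apply/negP.
have [d [f [g [Gf Gg xg ez]]]] := germ_ex z.
apply/asboolP; exists d, f, g, (hdenom_mk Gg xg); split=> //; first by rewrite ez; exact: germE.
move=> w yw _; apply: yw; apply/(yP Gf Gg xg).
by rewrite -ez.
Qed.

(** The germs vanishing on an irreducible closed [Z'] containing [V y] form a prime inside [q] that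
    contains [t]. By minimality it is [q], so all functions vanishing at [y] vanish on [Z']. *)
Lemma component_of_minimal t : q t -> (exists2 r, r \in mR & t = base_germ x r) ->
  (forall P, prime_ideal P -> P t -> (forall a, P a -> q a) -> forall a, q a -> P a) ->
  irreducible_component (fiber G mR) (V y).
Proof.
move=> qt [r mr er] qmin; split.
  by apply: specializations_irreducible; apply: (prime_fiber (P := q)).
move=> Z' [irrZ [C cC eZ']] VZ'; apply/seteqP; split=> //.
have Z'x : Z' x by apply: VZ'; exact: generic_specializes.
have Z'fib : Z' `<=` fiber G mR by rewrite eZ' => z [].
pose vanish f := forall z, Z' z -> f \in spec_pred z.
pose P z := exists d f g, [/\ f \in G d, g \in G d, g \notin spec_pred x,
  z = germ x d f g & vanish f].
have vanM a f : vanish f -> vanish (a * f) by move=> vf z /vf; exact: idealMr.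
have nvan g : g \notin spec_pred x -> ~ vanish g by move=> xg /(_ x Z'x); apply/negP.
have vanP d f e g : f \in G d -> g \in G e -> vanish (f * g) -> vanish f \/ vanish g.
  by move=> Gf Gg; apply: irreducible_vanish Gf Gg.
have Pgerm d f g : f \in G d -> g \in G d -> g \notin spec_pred x ->
    P (germ x d f g) -> vanish f.
  move=> Gf Gg xg [e [h [k [Gh Gk xk]]]] /germ_eq[] // l [u [Gu xu eu]] vh.
  have : vanish ((u * k) * f).
    by rewrite -mulrA [k * f]mulrC eu mulrCA mulrC; apply: (vanM).
  case/(vanP _ _ _ _ (pieceM Gu Gk) Gf) => // H.
  by case: (nvan (u * k)) => //; exact: notin_mul.
have pP : prime_ideal P.
  split.
  - split.
    + exists 0%N, 0, 1; rewrite piece0 piece1 notin1; split=> //.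
        by rewrite germ0 ?piece1 ?notin1.
      by move=> z _; exact: rpred0.
    + move=> _ _ [d [f [g [Gf Gg xg -> vf]]]] [e [h [k [Gh Gk xk -> vh]]]].
      exists (d + e)%N, (f * k + h * g), (g * k).
      rewrite germDg // pieceM ?notin_mul //; split=> //.
        by apply: pieceD; [exact: pieceM | rewrite addnC; exact: pieceM].
      by move=> z Z'z; apply: rpredD; rewrite mulrC idealMr //; [exact: vf | exact: vh].
    + move=> a _ [d [f [g [Gf Gg xg -> vf]]]].
      have [e [h [k [Gh Gk xk ->]]]] := germ_ex a.
      exists (e + d)%N, (h * f), (k * g).
      by rewrite germM // !pieceM ?notin_mul //; split=> //; exact: vanM.
  - rewrite -(germ1 (piece1 G) (notin1 x)) => /Pgerm H.
    by apply: (nvan 1 (notin1 x)); apply: H; rewrite ?piece1 ?notin1.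
  - move=> a b; have [d [f [g [Gf Gg xg ->]]]] := germ_ex a.
    have [e [h [k [Gh Gk xk ->]]]] := germ_ex b.
    rewrite germM // => /Pgerm H.
    have /(vanP _ _ _ _ Gf Gh)[vf|vh] : vanish (f * h).
    + by apply: H; rewrite ?pieceM ?notin_mul.
    + by left; exists d, f, g.
    + by right; exists e, h, k.
have Pt : P t.
  rewrite er; exists 0%N, r%:A, 1; rewrite pieceA piece1 notin1; split=> //.
  by move=> z /Z'fib/(_ r); rewrite mr => zr; exact: zr.
have Pq a : P a -> q a.
  move=> [d [f [g [Gf Gg xg -> vf]]]]; apply/(yP Gf Gg xg); apply: vf.
  exact: VZ' (@specializations_refl _ _ _ y).
have qP := qmin P pP Pt Pq.
have [T GT xT] := standard_deg1 Gstd x.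
move=> z Z'z; apply: specializes_hom => d f Gf yf.
have GTd : T ^+ d \in G d by exact: pieceX1.
have xTd : T ^+ d \notin spec_pred x by exact: notin_exp.
have /(Pgerm _ _ _ Gf GTd xTd) : P (germ x d f (T ^+ d)) by apply/qP/(yP Gf GTd xTd).
exact.
Qed.

(** A prime [P] strictly between would be a point [w], and the closures of [x], [w] and [y] would
    form a chain of length two in a one-dimensional component. *)
Lemma no_intermediate_prime (P : stalk x -> Prop) :
  (forall r, r \in mR -> r%:A \in spec_pred x) ->
  dimension (V y) 1 -> prime_ideal P -> (forall a, q a -> P a) ->
  (exists2 a, P a & ~ q a) -> (exists2 a, a \in mx & ~ P a) -> False.
Proof.
move=> xR [_ nchain] pP qP [a Pa nqa] [b mb nPb]; apply: nchain.
have [T GT xT] := standard_deg1 Gstd x.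
have [w wP] := point_of_prime GT xT pP.
have wx := point_specializes GT xT pP wP.
have yw : specializes y w.
  apply: specializes_hom => d f Gf.
  have GTd : T ^+ d \in G d by exact: pieceX1.
  have xTd : T ^+ d \notin spec_pred x by exact: notin_exp.
  by move=> /(yP Gf GTd xTd)/qP/(wP _ _ _ Gf GTd xTd).
have nwy : ~ specializes w y.
  move=> wy; apply: nqa; have [d [f [g [Gf Gg xg ea]]]] := germ_ex a.
  rewrite ea; apply/(yP Gf Gg xg); apply: wy; apply/(wP _ _ _ Gf Gg xg).
  by rewrite -ea.
have nxw : ~ specializes x w.
  move=> xw; apply: nPb; have [d [f [g [Gf Gg xg eb]]]] := germ_ex b.
  rewrite eb; apply/(wP _ _ _ Gf Gg xg); apply: xw.
  by rewrite -(germ_max Smx Gf Gg xg) -eb.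
have Vtr u v : specializes u v -> V v `<=` V u by move=> uv z vz f /uv/vz.
pose c (i : nat) := if i is i'.+1 then (if i' is _.+1 then V y else V w) else V x.
exists c; split=> [[|[|i]] _|[|[|i]]] //=.
- by apply: specializations_irreducible; apply: Vtr; exact: generic_specializes.
- by apply: specializations_irreducible; exact: Vtr.
- exact: specializations_irreducible.
- move=> _; split; first exact: Vtr.
  by move=> H; apply: nxw; exact: H (@specializations_refl _ _ _ w).
- move=> _; split; first exact: Vtr.
  by move=> H; apply: nwy; exact: H (@specializations_refl _ _ _ y).
Qed.

End Components.

(** * Transfer from the component rings to the vertical primes *)

Section Quotient.
Variables (S D : comNzRingType) (f : {rmorphism S -> D}) (m : idealr S) (n : idealr D).
Variables (t c : S).
Hypothesis fsurj : forall b, exists a, f a = b.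
Hypothesis fm : forall a, (f a \in n) = (a \in m).
Hypothesis fker : forall a, f a = 0 <-> colon t c a.

(** [vert t c] is the kernel of the surjection of completions induced by [f], so both properties are
    read off in the completion of [D]. *)
Lemma vert_quotient : is_domain (completion n) ->
  (forall g : completion n, g != 0 -> exists N, forall z, fil N z -> exists h, z = g * h) ->
  (forall g h : completion m, vert t c (g * h) -> vert t c g \/ vert t c h) /\
  forall g : completion m, ~ vert t c g -> exists M, forall z, ideal_pow m M z ->
    exists h, vert t c (completion_map m z - g * h).
Proof.
move=> domn dimn; have [psi [psiB psiM psi_iota psi_surj psi_ker]] := completion_lift fsurj fm.
have psi0 z : psi z = 0 <-> vert t c z.
  split=> [/psi_ker zk k|zk].
    by have [_ [a /fker ca ->] za] := zk k; exists a.
  by apply/psi_ker => k; have [a /fker ca za] := zk k; exists (completion_map m a) => //; exists a.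
split=> [g h /psi0|g ng].
  by rewrite psiM => /domn[/psi0|/psi0]; [left | right].
have /dimn[N NP] : psi g != 0 by apply/eqP => /psi0.
exists N => z Nz; have [|h eh] := NP (completion_map n (f z)).
  by apply/fil_iota; apply: pow_map Nz => a; rewrite fm.
have [k ek] := psi_surj h; exists k; apply/psi0.
by rewrite psiB psi_iota psiM ek eh subrr.
Qed.

End Quotient.

Lemma prime_idealrE (A : comNzRingType) (I : A -> Prop) : prime_ideal I ->
  {J : prime_idealr A | forall a, (a \in J) <-> I a}.
Proof.
move=> [iI I1 Ip]; pose p : A -> bool := fun a => `[< I a >].
have pc : idealr_closed p.
  split; [by apply/asboolP; exact: ideal0 | exact/asboolPn |].
  move=> a u v /asboolP Iu /asboolP Iv; apply/asboolP.
  by apply: idealD => //; apply: idealM.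
have pp : prime_idealr_closed p.
  by move=> u v /asboolP/Ip[Iu|Iv]; apply/orP; [left | right]; apply/asboolP.
pose J : prime_idealr A :=
  HB.pack p (isIdealr.Build A p pc) (isPrimeIdealrClosed.Build A p pp).
by exists J => a; split => /asboolP.
Qed.

Section OneDimensionalBase.
Variables (R : idomainType) (mR : idealr R) (Rloc : local_ring mR) (Rdim : ring_dim R 1).

(** Otherwise [0], [P] and [mR] would be a chain of primes of length two. *)
Lemma base_prime_max (P : R -> Prop) r : prime_ideal P -> r != 0 -> P r ->
  forall a, a \in mR -> P a.
Proof.
move=> pP r0 Pr a ma; apply: contrapT => nPa; apply: Rdim.2.
have p0 : prime_ideal (fun b : R => b = 0).
  split; [by split=> [//|u v -> ->|b u ->]; rewrite ?addr0 ?mulr0 | |].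
    by move/eqP; rewrite oner_eq0.
  by move=> b c /eqP; rewrite mulf_eq0 => /orP[/eqP|/eqP]; [left | right].
have [J0 J0P] := prime_idealrE p0; have [J1 J1P] := prime_idealrE pP.
have [J2 J2P] := prime_idealrE (max_ideal_prime Rloc).
have [iP P1 _] := pP.
exists (fun i => if i is i'.+1 then (if i' is _.+1 then J2 else J1) else J0).
case=> [|[|i]] //= _; split.
- by move=> b /J0P ->; rewrite idealr0.
- by exists r; [apply/J1P | apply/negP => /J0P/eqP; rewrite (negPf r0)].
- by move=> b /J1P Pb; apply/J2P; exact: (proper_sub_max Rloc iP P1 Pb).
- by exists a; [apply/J2P | apply/negP => /J1P].
Qed.

Lemma base_max_neq0 : exists2 r, r \in mR & r != 0.
Proof.
have [[p /(_ 0%N isT)[_ [a pa npa]]] _] := Rdim; exists a.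
  by apply: (proper_sub_max Rloc (ideal_idealr (p 1%N))) pa; rewrite idealr1.
by apply: contraNneq npa => ->; rewrite idealr0.
Qed.

End OneDimensionalBase.

Section ComponentRing.
Variables (S D : comNzRingType) (f : {rmorphism S -> D}) (m : idealr S) (n : idealr D).
Hypotheses (nS : noeth S) (Sloc : local_ring m) (Dloc : local_ring n).
Hypothesis fsurj : forall b, exists a, f a = b.
Variable q : S -> Prop.
Hypotheses (qprime : prime_ideal q) (fker : forall a, f a = 0 <-> q a).

Lemma quotient_max a : (f a \in n) = (a \in m).
Proof.
have [iq q1 _] := qprime.
apply/idP/idP => [na|ma]; apply/negPn/negP.
  move=> /(local_unit Sloc)[v va]; apply: (local_nonunit na).
  by exists (f v); rewrite -rmorphM va rmorph1.
move=> /(local_unit Dloc)[w]; have [b <-] := fsurj w => e.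
have /fker/(proper_sub_max Sloc iq q1) : f (b * a - 1) = 0.
  by rewrite rmorphB rmorphM e rmorph1 subrr.
move=> mba; have : b * a - (b * a - 1) \in m by rewrite rpredB // idealMr.
by rewrite subKr idealr1.
Qed.

Lemma quotient_domain : is_domain D.
Proof.
have [_ _ qp] := qprime; move=> u v.
have [a <-] := fsurj u; have [b <-] := fsurj v.
by rewrite -rmorphM => /fker/qp[/fker|/fker]; [left | right].
Qed.

(** If no power of [m] lay in [q + s' S], some prime containing this ideal would contain no power of
    [m], and so lie strictly between [q] and [m]. *)
Lemma quotient_one_dim :
  (forall P, prime_ideal P -> (forall a, q a -> P a) -> (exists2 a, P a & ~ q a) ->
    (exists2 a, a \in m & ~ P a) -> False) ->
  forall s, s != 0 -> exists N, forall a, ideal_pow n N a -> exists b, a = s * b.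
Proof.
move=> qmax s; have [s' <-] := fsurj s => s0; have [iq _ _] := qprime.
pose I a := exists b, q (a - s' * b).
have iI : ideal I.
  split; first by exists 0; rewrite mulr0 subrr; exact: ideal0.
    move=> u v [b qu] [c qv]; exists (b + c).
    by rewrite mulrDr opprD addrACA; exact: idealD.
  by move=> a u [b qu]; exists (a * b); rewrite mulrCA -mulrBr; exact: idealM.
have [[N NP]|nN] := pselect (exists N, forall a, ideal_pow m N a -> I a).
  have nm c : c \in n -> exists2 a, a \in m & f a = c.
    by have [a <-] := fsurj c => na; exists a; rewrite // -quotient_max.
  exists N => b Nb; have [a Na <-] := pow_map_surj fsurj nm Nb.
  have [b' /fker] := NP a Na; rewrite rmorphB rmorphM => /eqP.
  by rewrite subr_eq0 => /eqP ->; exists (f b').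
have [P [pP IP Pm]] : exists P, [/\ prime_ideal P, (forall a, I a -> P a) &
    forall N, ~ forall a, ideal_pow m N a -> P a].
  by apply: prime_no_power => // N NP; apply: nN; exists N.
exfalso; apply: (qmax P pP).
- by move=> a qa; apply: IP; exists 0; rewrite mulr0 subr0.
- exists s'; last by move/fker/eqP; rewrite (negPf s0).
  by apply: IP; exists 1; rewrite mulr1 subrr; exact: ideal0.
- apply: contrapT => nex; apply: (Pm 1%N) => a /pow1P ma; apply: contrapT => nPa.
  by apply: nex; exists a.
Qed.

End ComponentRing.

Theorem theorem3p5
  (R : idomainType) (mR : idealr R)
  (R_noetherian : noetherian R)
  (R_local : local_ring mR)
  (R_complete : adic_complete mR)
  (R_dim1 : ring_dim R 1)
  (A : comAlgType R) (G : grading A)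
  (X_projective : standard_graded G)
  (X_connected : proj_connected G)
  (X_normal : proj_normal G)
  (X_dominant : dominant G)
  (X_curve : relative_dimension G 1)
  (x : proj G)
  (x_closed_fiber : fiber G mR x)
  (x_closed : closed [set x])
  (mx : idealr (stalk x))
  (Rx_local : local_ring mx)
  (components_hyp :
    forall (Xi : set (proj G)) (Xi_x : Xi x),
      irreducible_component (fiber G mR) Xi ->
      analytically_unramified (reduced_stalk Xi_x) /\
      unibranch (reduced_stalk Xi_x)) :
  weierstrass (completion_map mx).
Proof.
have nR := noetherianP R_noetherian.
have nA := standard_noeth nR X_projective.
have nS := @stalk_noeth R A G x nA.
have normS := X_normal x.
have [tau mtau tau0] := base_max_neq0 R_local R_dim1.
pose t := base_germ x tau.
have t0 : t != 0.
  by apply: base_germ_neq0 => // y; have [] := X_normal y.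
have xR r : r \in mR -> r%:A \in spec_pred x.
  by move=> mr; have := x_closed_fiber r; rewrite mr.
have rho_m r : r \in mR -> base_germ x r \in mx.
  by move=> /xR xr; rewrite (germ_max Rx_local) ?pieceA ?piece1 ?notin1.
have [L [Lprime Lreg Lunit]] := vertical_primes nS normS t0.
have [T GT xT] := standard_deg1 X_projective x.
have [es fg1] := residue_finite nR X_projective x_closed Rx_local.
have Lvert c : c \in L ->
  (forall g h : completion mx, vert t c (g * h) -> vert t c g \/ vert t c h) /\
  forall g : completion mx, ~ vert t c g -> exists M, forall z, ideal_pow mx M z ->
    exists h, vert t c (completion_map mx z - g * h).
  move=> /Lprime cprime; have [ic c1 cp] := cprime.
  (* The contraction of [colon t c] to [R] is a prime containing [tau], hence [mR]: the component
     lies in the closed fiber. *)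
  have qR r : r \in mR -> colon t c (base_germ x r).
    apply: (base_prime_max R_local R_dim1 (P := fun r => colon t c (base_germ x r)))
      tau0 (colon_t t c) r.
    split; first exact: (ideal_preim (base_germ x : {rmorphism R -> stalk x}) ic).
      by rewrite rmorph1.
    by move=> a b; rewrite rmorphM; exact: cp.
  have [y yP] := point_of_prime GT xT cprime.
  have Vx : specializations y x := generic_specializes X_projective cprime yP.
  have comp : irreducible_component (fiber G mR) (specializations y).
    apply: (component_of_minimal R_local X_projective cprime qR yP (colon_t t c)).
      by exists tau.
    by move=> P; exact: associated_prime_min.
  have [[/noetherianP nD [mD Dloc redD]] [_ Dunib]] := components_hyp _ Vx comp.
  pose D := reduced_stalk Vx.
  pose f : {rmorphism stalk x -> D} := \pi_D%qT.
  have fsurj b : exists a, f a = b by exists (repr b); exact: reprK.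
  have fker a : f a = 0 <-> colon t c a.
    rewrite -(germs_vanishingE X_projective cprime yP Vx) -(rmorph0 f).
    split=> [/eqP|va]; first by rewrite -Quotient.idealrBE subr0.
    by apply/eqP; rewrite -Quotient.idealrBE subr0.
  have fm := quotient_max Rx_local Dloc fsurj cprime fker.
  have domD := quotient_domain fsurj cprime fker.
  have dimV : dimension (specializations y) 1.
    have [pm pmP] := prime_idealrE (max_ideal_prime R_local).
    apply: (X_curve pm); suff -> : fiber G pm = fiber G mR by [].
    by apply/seteqP; split=> z zP r; rewrite zP; apply/idP/idP => /pmP.
  have dimD := quotient_one_dim nS Rx_local Dloc fsurj cprime fker
    (fun P => no_intermediate_prime X_projective Rx_local cprime yP xR dimV).
  have domE := completion_domain nD Dloc domD dimD redD Dunib.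
  apply: (vert_quotient fsurj fm fker domE).
  exact: (completion_one_dim nD Dloc domD dimD redD).
move=> b; apply: (vertical_weierstrass nS Rx_local normS t0 (rho_m _ mtau) Lprime Lreg Lunit).
- by move=> c /Lvert[].
- by move=> c /Lvert[].
- by move=> f M; exact: (finite_over_complete nS R_complete rho_m mtau fg1).
Qed.
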